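(* Let $\{\lambda_n\}_{n\geq 0}\subset(0,1)$ satisfy $\lambda_n<\lambda_{n+1}$ for all $n$ and the Carleson condition: there exists $\delta>0$ such that $|B_n(\lambda_n)|\geq\delta$ for every $n$. Let $\mathcal H_0$ be a Hilbert space and $\{x_n\}_{n\geq 0}\subset\mathcal H_0$ a family such that every finite subfamily is linearly independent, $\mathcal H_0=\bigvee_{n\geq 0}x_n$, $\inf_{n\geq 0}\|x_n\|>0$, the mappings $\mathcal P_n$ given on finite linear combinations by $\mathcal P_n\sum_k a_kx_k=\sum_{k=0}^n a_kx_k$ extend to bounded operators on $\mathcal H_0$ with $\sup_{n\geq 0}\|\mathcal P_n\|<\infty$, and there is a (bounded linear) transformation $W\colon\mathcal K_B\to\mathcal H_0$ with $Wu_n=x_n$ for all $n\geq 0$. Suppose that $\{x_n\}_{n\geq 0}$ is not a Riesz basis of $\mathcal H_0$. Let $g\in H^\infty$ be an outer function with $\sum_{n\geq 0}|g(\lambda_n)|^2<\infty$, and set $g_*(z)=\overline{g(\overline z)}$, $z\in\mathbb D$. Let $R_0\colon\mathcal H_0\to\mathcal H_0$ be the bounded operator with $R_0x_n=\lambda_nx_n$, $n\geq 0$, and let $Z\colon\mathcal H_0\to\mathcal K_B$ be the bounded transformation with $Zx_n=g(\lambda_n)u_n$, $n\geq 0$. Define $$T\colon BH^2\oplus\mathcal H_0\to BH^2\oplus\mathcal H_0,\quad Y\colon BH^2\oplus\mathcal H_0\to H^2=BH^2\oplus\mathcal K_B,\quad X\colon H^2=BH^2\oplus\mathcal K_B\to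 BH^2\oplus\mathcal H_0,$$ $$T=\begin{pmatrix}S|_{BH^2} & P_{BH^2}S|_{\mathcal K_B}W^*\\ 0 & R_0^*\end{pmatrix},\quad Y=\begin{pmatrix}I_{BH^2} & 0\\ 0 & W^*\end{pmatrix},\quad X=\begin{pmatrix}g_*(S)|_{BH^2} & P_{BH^2}g_*(S)|_{\mathcal K_B}\\ 0 & Z^*\end{pmatrix}.$$ Then $T$ is power bounded, $T$ is not polynomially bounded, $X$ and $Y$ are quasiaffinities, $YT=SY$, $XS=TX$, $YX=g_*(S)$, and if $\sum_{n\geq 0}|\widehat g(n)|<\infty$, then $XY=g_*(T)$. Moreover, $$\|Y^*h_\lambda\|\asymp\|h_\lambda\|=\frac{1}{(1-|\lambda|^2)^{1/2}}\qquad(\lambda\in\mathbb D).$$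
   Context: Hilbert spaces are complex and separable; ''operator'' and ''transformation'' mean bounded linear map; $\bigvee$ denotes closed linear span. $\mathbb D$ is the open unit disc, $H^2$ the Hardy space on $\mathbb D$, $H^\infty$ the algebra of bounded analytic functions on $\mathbb D$, $S\colon H^2\to H^2$, $(Sh)(z)=zh(z)$, the unilateral shift of multiplicity 1, and $h_\lambda(z)=\frac{1}{1-\overline\lambda z}$ for $z,\lambda\in\mathbb D$. $P_{\mathcal M}$ is the orthogonal projection onto $\mathcal M$ and $I_{\mathcal M}$ the identity on $\mathcal M$. For $\lambda\in\mathbb D$, $b_\lambda(z)=\frac{|\lambda|}{\lambda}\frac{\lambda-z}{1-\overline\lambda z}$ is the Blaschke factor; $B=\prod_n b_{\lambda_n}$ is the Blaschke product with zeros $\lambda_n$ (it converges under the Carleson condition), $B_n=\prod_{k\neq n}b_{\lambda_k}$, $\mathcal K_B=H^2\ominus BH^2$, and $u_n=(1-|\lambda_n|^2)^{1/2}h_{\lambda_n}$, which under the Carleson condition form a Riesz basis of $\mathcal K_B$. A family $\{x_n\}_{n\ge0}$ is a Riesz basis of $\mathcal H_0$ if the mapping sending some orthonormal basis $\{e_n\}$ to $\{x_n\}$ ($e_n\mapsto x_n$) is an invertible bounded transformation onto $\mathcal H_0$. Under the stated assumptions the maps $R_0$ and $Z$ given on the $x_n$ do extend to bounded maps. $T$ is power bounded if $\sup_{n\geq 1}\|T^n\|<\infty$; polynomially bounded if there is $C>0$ with $\|p(T)\|\leq C\max_{|z|\leq 1}|p(z)|$ for every analytic polynomial $p$. A quasiaffinity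 is a transformation with zero kernel and dense range. $\widehat g(n)$ are the Taylor coefficients of $g$; $g_*(S)$ is multiplication by $g_*$ on $H^2$; when $\sum_n|\widehat g(n)|<\infty$ and $T$ is power bounded, $g_*(T)=\sum_{n\geq 0}\overline{\widehat g(n)}T^n$. The notation $a(\lambda)\asymp b(\lambda)$ means that there are constants $c,C>0$ independent of $\lambda$ with $c\,b(\lambda)\leq a(\lambda)\leq C\,b(\lambda)$. *)

(* Defs.v *)
From HB Require Import structures.
From mathcomp Require Import all_boot all_order all_algebra.
From mathcomp Require Import all_classical all_reals all_analysis.
From mathcomp Require Import complex sesquilinear ring lra.

Set Implicit Arguments.
Unset Strict Implicit.
Unset Printing Implicit Defensive.

Import Order.TTheory GRing.Theory Num.Theory.
Import numFieldNormedType.Exports.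

Local Open Scope classical_set_scope.
Local Open Scope ring_scope.

(* Num.Theory also exports Re and Im, valued in the closed field itself *)
Local Notation Re := complex.Re.
Local Notation Im := complex.Im.

HB.instance Definition _ (R : realType) := NormedModule.copy R[i] (R[i])^o.

(* [dot] is linear in its first argument and conjugate-linear in the second;
   norms of normed modules over C take their values in C. *)
HB.mixin Record NormedModule_hasDot (C : numClosedFieldType) V
    of NormedModule C V := {
  dot : {dot V for (@Num.conj C)};
  dot_norm : forall x : V, dot x x = `|x| ^+ 2 }.

#[short(type="innerProductType")]
HB.structure Definition InnerProduct (C : numClosedFieldType) :=
  {V of NormedModule C V & NormedModule_hasDot C V}.

#[short(type="hilbertType")]
HB.structure Definition Hilbert (C : numClosedFieldType) :=
  {V of InnerProduct C V & Complete V}.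

Section form_norm.
Variables (C : numClosedFieldType) (V : lmodType C).
Variable form : {dot V for (@Num.conj C)}.

Lemma form_CauchySchwarz x y :
  `|form x y| ^+ 2 <= form x x * form y y.
Proof.
have [->|y0] := eqVneq y 0.
  by rewrite !linear0r normr0 expr0n.
have fy0 : 0 < form y y by rewrite dnorm_gt0.
have fyr : (form y y)^* = form y y by rewrite conj_Creal// ger0_real// ltW.
set d := form x y; pose a := d / form y y; pose q := `|d| ^+ 2 / form y y.
have qr : q^* = q.
  by rewrite conj_Creal// ger0_real// divr_ge0// ltW.
have ad : a^* * d = q.
  by rewrite /a /q normCK rmorphM fmorphV /= fyr mulrAC (mulrC d).
have aa : `|a| ^+ 2 * form y y = q.
  by rewrite normCK -(mulrC a^* ) -mulrA /a divfK ?gt_eqF// ad.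
have : 0 <= form (x - a *: y) (x - a *: y) by exact: dnorm_ge0.
rewrite dnormB dnormZ aa linearZr_LR /= -/d ad qr opprD addrA addrK subr_ge0.
by rewrite /q ler_pdivrMr.
Qed.

Lemma form_triangle x y :
  sqrtC (form (x + y) (x + y)) <= sqrtC (form x x) + sqrtC (form y y).
Proof.
rewrite -(ler_pXn2r (n := 2)) ?nnegrE ?addr_ge0 ?sqrtC_ge0 ?dnorm_ge0//.
rewrite sqrrD !sqrtCK dnormD /= [leRHS]addrAC lerD2l.
have -> : form x y + (form x y)^* = 'Re (form x y) *+ 2.
  by rewrite ReE mulr2n -splitr.
rewrite lerMn2r /= (le_trans (leif_Re_Creal _)) //.
rewrite -(ler_pXn2r (n := 2)) ?nnegrE ?mulr_ge0 ?sqrtC_ge0 ?dnorm_ge0//.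
by rewrite exprMn !sqrtCK form_CauchySchwarz.
Qed.
End form_norm.

HB.factory Record Lmodule_hasInner (C : numClosedFieldType) V
    of GRing.Lmodule C V := {
  inner : V -> V -> C;
  inner_linear : forall (a : C) (x y z : V),
    inner (a *: x + y) z = a * inner x z + inner y z;
  inner_conj : forall x y : V, inner x y = (inner y x)^*;
  inner_gt0 : forall x : V, x != 0 -> 0 < inner x x }.

HB.builders Context C V of Lmodule_hasInner C V.

Let innerL y : scalar (inner^~ y).
Proof. by move=> a x z; exact: inner_linear. Qed.

Let innerR x : GRing.linear_for (Num.conj \; *%R) (inner x).
Proof.
move=> a y z /=.
by rewrite inner_conj inner_linear rmorphD rmorphM (inner_conj x y) (inner_conj x z).
Qed.

HB.instance Definition _ :=
  @bilinear_isBilinear.Build C V V C *%R (Num.conj \; *%R) inner (innerL, innerR).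

Let inner_herm x y : inner x y = (-1) ^+ false * (inner y x)^*.
Proof. by rewrite expr0 mul1r; exact: inner_conj. Qed.

HB.instance Definition _ :=
  @isHermitianSesquilinear.Build C V false Num.conj inner inner_herm.

HB.instance Definition _ := @isDotProduct.Build C V inner inner_gt0.

Let form : {dot V for (@Num.conj C)} := inner.

Let norm (x : V) : C := sqrtC (form x x).

Let normD x y : norm (x + y) <= norm x + norm y.
Proof. exact: form_triangle. Qed.

Let normZ (a : C) x : norm (a *: x) = `|a| * norm x.
Proof.
by rewrite /norm dnormZ sqrtCM ?nnegrE ?exprn_ge0 ?dnorm_ge0// sqrCK.
Qed.

Let norm0_eq0 x : norm x = 0 -> x = 0.
Proof. by move=> /eqP; rewrite sqrt_dnorm_eq0 => /eqP. Qed.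

HB.instance Definition _ :=
  Lmodule_isNormed.Build C V normD normZ norm0_eq0.

Let form_norm x : form x x = `|x| ^+ 2.
Proof. by rewrite sqrtCK. Qed.

HB.instance Definition _ := NormedModule_hasDot.Build C V form_norm.

HB.end.

Record sub_of (C : numClosedFieldType) (V : lmodType C) (M : submodClosed V) :=
  SubOf { sub_val : V; _ : sub_val \in M }.

Section sub_of.
Variables (C : numClosedFieldType) (V : innerProductType C).
Variable M : submodClosed V.

HB.instance Definition _ := [isSub of sub_of M for @sub_val C V M].
HB.instance Definition _ := [Choice of sub_of M by <:].
HB.instance Definition _ := [SubChoice_isSubLmodule of sub_of M by <:].

Let inner (x y : sub_of M) : C := dot (val x) (val y).

Let inner_linear (a : C) (x y z : sub_of M) :
  inner (a *: x + y) z = a * inner x z + inner y z.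
Proof. by rewrite /inner linearP linearDl linearZl_LR. Qed.

Let inner_conj (x y : sub_of M) : inner x y = (inner y x)^*.
Proof. by rewrite /inner hermC expr0 mul1r. Qed.

Let inner_gt0 (x : sub_of M) : x != 0 -> 0 < inner x x.
Proof. by move=> x0; rewrite dnorm_gt0 raddf_eq0//; exact: val_inj. Qed.

HB.instance Definition _ :=
  Lmodule_hasInner.Build C (sub_of M) inner_linear inner_conj inner_gt0.

End sub_of.

(* An alias of V * W, because V * W itself carries the max norm. *)
Definition dsum (V W : Type) : Type := (V * W)%type.

Section dsum.
Variables (C : numClosedFieldType) (V W : innerProductType C).

HB.instance Definition _ := GRing.Lmodule.copy (dsum V W) (V * W)%type.

Let inner (x y : dsum V W) : C := dot x.1 y.1 + dot x.2 y.2.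

Let inner_linear (a : C) (x y z : dsum V W) :
  inner (a *: x + y) z = a * inner x z + inner y z.
Proof. by rewrite /inner !linearDl !linearZl_LR/= mulrDr addrACA. Qed.

Let inner_conj (x y : dsum V W) : inner x y = (inner y x)^*.
Proof.
by rewrite /inner rmorphD/=; congr (_ + _); rewrite hermC expr0 mul1r.
Qed.

Let inner_gt0 (x : dsum V W) : x != 0 -> 0 < inner x x.
Proof.
move=> x0; rewrite lt_def addr_ge0 ?dnorm_ge0// andbT.
apply: contra x0; rewrite paddr_eq0 ?dnorm_ge0// !dnorm_eq0.
by case: x => x1 x2 /= /andP[/eqP -> /eqP ->].
Qed.

HB.instance Definition _ :=
  Lmodule_hasInner.Build C (dsum V W) inner_linear inner_conj inner_gt0.

End dsum.

Section orthc.
Variables (C : numClosedFieldType) (V : innerProductType C).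

Definition orthc (M : {pred V}) : {pred V} :=
  [pred x | `[< forall y, y \in M -> dot x y = 0 >]].

Let orthc_submod (M : {pred V}) : submod_closed (orthc M).
Proof.
split=> [|a x y /asboolP xM /asboolP yM].
  by apply/asboolP => y _; rewrite linear0l.
apply/asboolP => z zM.
by rewrite linearDl linearZl_LR/= xM// yM// mulr0 addr0.
Qed.
HB.instance Definition _ (M : {pred V}) :=
  GRing.isSubmodClosed.Build C V (orthc M) (orthc_submod M).
End orthc.

Section ell2.
Variable R : realType.
Local Notation C := R[i].

Lemma ReK (x : C) : 0 <= x -> (Re x)%:C%C = x.
Proof. by case: x => a b; rewrite lecE /= => /andP[/eqP -> _]. Qed.

Lemma cvg_realC (u : nat -> R) (l : R) :
  u @ \oo --> l -> (fun n => (u n)%:C%C : C) @ \oo --> (l%:C%C : C).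
Proof.
move=> ul; apply/cvgrPdist_lt => e e0.
have e0' : 0 < Re e by move: e0; rewrite ltcE /= => /andP[].
move/cvgrPdist_lt : ul => /(_ _ e0'); apply: filterS => n.
by rewrite -rmorphB normc_def /= expr0n addr0 sqrtr_sqr -(ReK (ltW e0)) ltcR.
Qed.

Lemma nneg_series_cvg (u : nat -> C) : (forall n, 0 <= u n) ->
  (exists M, forall n, series u n <= M) -> cvgn (series u).
Proof.
move=> u0 [M uM].
have E n : series u n = (series (fun k => Re (u k)) n)%:C%C.
  by rewrite /series /= (rmorph_sum (real_complex R)); apply: eq_bigr => k _; apply/esym; exact: ReK.
have -> : series u = fun n => (series (fun k => Re (u k)) n)%:C%C by exact/funext.
apply: (cvgP ((limn (series (fun k => Re (u k))))%:C%C : C)).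
apply: cvg_realC; apply: nondecreasing_is_cvgn.
  by apply: nondecreasing_series => n _ _; have := u0 n; rewrite lecE => /andP[].
exists (Re M) => _ [n _ <-].
by have := uM n; rewrite E lecE /= => /andP[].
Qed.

Lemma nneg_series_bounded (u : nat -> C) : (forall n, 0 <= u n) ->
  cvgn (series u) -> exists M, forall n, series u n <= M.
Proof.
move=> u0 /cvgrPdist_lt /(_ 1 ltr01) [N _ HN].
exists (`|limn (series u)| + 1) => n.
have s0 m : 0 <= series u m by exact: sumr_ge0.
have le : series u n <= series u (maxn n N).
  rewrite /series /= [leRHS](@big_cat_nat _ _ _ n) ?leq_maxl//= lerDl.
  exact: sumr_ge0.
apply: (le_trans le); rewrite -(ger0_norm (s0 _)).
rewrite -[X in `|X|](subKr (limn (series u))).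
rewrite (le_trans (ler_normB _ _))// lerD2l ltW//.
by apply: HN; rewrite /= leq_maxr.
Qed.

Lemma nneg_series_le (u v : nat -> C) : (forall n, 0 <= u n <= v n) ->
  cvgn (series v) -> cvgn (series u).
Proof.
move=> uv cv.
have [|M vM] := nneg_series_bounded _ cv.
  by move=> n; have /andP[] := uv n; exact: le_trans.
apply: nneg_series_cvg => [n|]; first by have /andP[] := uv n.
exists M => n; apply: le_trans (vM n).
by apply: ler_sum => k _; have /andP[] := uv k.
Qed.

Lemma sqr_normD_le (x y : C) :
  `|x + y| ^+ 2 <= 2 * `|x| ^+ 2 + 2 * `|y| ^+ 2.
Proof.
apply: (@le_trans _ _ ((`|x| + `|y|) ^+ 2)).
  by rewrite ler_pXn2r ?nnegrE ?addr_ge0 ?ler_normD.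
rewrite -subr_ge0; move: `|x| `|y| (normr_real x) (normr_real y) => p q pR qR.
rewrite [X in 0 <= X](_ : _ = (p - q) ^+ 2); last by ring.
by rewrite real_exprn_even_ge0// rpredB.
Qed.

Lemma is_cvg_seriesZ (k : C) (u : nat -> C) :
  cvgn (series u) -> cvgn (series (fun n => k * u n)).
Proof.
move=> cu; rewrite (_ : series _ = k \*: series u); first exact: is_cvgZl_tmp.
by apply/funext => n; rewrite /series /= -mulr_sumr.
Qed.

Lemma is_cvg_seriesD (u v : nat -> C) : cvgn (series u) -> cvgn (series v) ->
  cvgn (series (fun n => u n + v n)).
Proof.
move=> cu cv; rewrite (_ : series _ = (fun n => series u n + series v n)).
  exact: is_cvgD cu cv.
by apply/funext => n; rewrite /series /= big_split.
Qed.



Definition ell2 : {pred nat -> C} :=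
  [pred a : nat -> C | `[< cvgn (series (fun n => `|a n| ^+ 2 : C)) >]].

Let ell2_submod : submod_closed ell2.
Proof.
split=> [|c a b /asboolP ca /asboolP cb]; apply/asboolP.
  apply: nneg_series_cvg => [n|]; first exact: exprn_ge0.
  by exists 0 => n; rewrite /series /= big1// => k _; rewrite normr0 expr0n.
apply: (@nneg_series_le _
  (fun n => 2 * `|c| ^+ 2 * `|a n| ^+ 2 + 2 * `|b n| ^+ 2)).
  move=> n; rewrite exprn_ge0//=.
  have := sqr_normD_le (c * a n) (b n).
  by rewrite normrM exprMn mulrA; exact.
exact: (is_cvg_seriesD (is_cvg_seriesZ ca) (is_cvg_seriesZ cb)).
Qed.

HB.instance Definition _ :=
  GRing.isSubmodClosed.Build C (nat -> C)%type ell2 ell2_submod.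
End ell2.

(* The Hardy space H^2, a function being represented by its sequence of Taylor
   coefficients; its values on the disc are given by [psum] below. *)
Record hardy (R : realType) := Hardy { coef :> nat -> R[i]; _ : coef \in @ell2 R }.

Section hardy.
Variable R : realType.
Local Notation C := R[i].

HB.instance Definition _ := [isSub of hardy R for @coef R].
HB.instance Definition _ := [Choice of hardy R by <:].
HB.instance Definition _ := [SubChoice_isSubLmodule of hardy R by <:].

Lemma polarization (a b : C) : a * b^* =
  4^-1 * `|a + b| ^+ 2 + (- 4^-1) * `|a + - b| ^+ 2
  + (4^-1 * 'i * `|a + 'i * b| ^+ 2 + (- (4^-1 * 'i)) * `|a + (- 'i) * b| ^+ 2).
Proof.
rewrite !normCK !(rmorphD, rmorphN, rmorphM) /= conjCi.
have i2 : 'i ^+ 2 = -1 :> C := sqrCi C.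
move: 'i a^* b^* i2 => i A B i2.
transitivity (4^-1 * (2 * (a * B + b * A) - 2 * i ^+ 2 * (a * B - b * A))).
  by rewrite i2; field.
by ring.
Qed.

Lemma ell2P (a : nat -> C) :
  reflect (cvgn (series (fun n => `|a n| ^+ 2 : C))) (a \in @ell2 R).
Proof. exact: asboolP. Qed.

Lemma is_cvg_inner (a b : nat -> C) : a \in @ell2 R -> b \in @ell2 R ->
  cvgn (series (fun n => a n * (b n)^*)).
Proof.
move=> aE bE.
have h (k : C) : cvgn (series (fun n => `|a n + k * b n| ^+ 2 : C)).
  by have /ell2P := rpredD aE (rpredZ k bE).
have h1 : cvgn (series (fun n => `|a n + b n| ^+ 2 : C)).
  by have /ell2P := rpredD aE bE.
have hN : cvgn (series (fun n => `|a n + - b n| ^+ 2 : C)).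
  by have /ell2P := rpredB aE bE.
have H := is_cvg_seriesD
  (is_cvg_seriesD (is_cvg_seriesZ (k := 4^-1) h1) (is_cvg_seriesZ (k := (- 4^-1)) hN))
  (is_cvg_seriesD (is_cvg_seriesZ (k := (4^-1 * 'i)) (h 'i))
                  (is_cvg_seriesZ (k := (- (4^-1 * 'i))) (h (- 'i)))).
have -> : (fun n => a n * (b n)^*) = (fun n =>
    4^-1 * `|a n + b n| ^+ 2 + (- 4^-1) * `|a n + - b n| ^+ 2
    + (4^-1 * 'i * `|a n + 'i * b n| ^+ 2
       + (- (4^-1 * 'i)) * `|a n + (- 'i) * b n| ^+ 2)).
  by apply/funext => n; exact: polarization.
exact: H.
Qed.

Lemma limC (u : nat -> C) (l : C) : u @ \oo --> l -> limn u = l.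
Proof. exact: (@cvg_lim C (@norm_hausdorff C C)). Qed.

Lemma le_limC (u : nat -> C) (l c : C) : u @ \oo --> l ->
  (\forall n \near \oo, c <= u n) -> c <= l.
Proof.
move=> ul cu.
have FF : Filter (nbhs \oo) by exact _.
have c2 := cvgB (FF := FF) ul (cvg_cst c (F := nbhs \oo)).
move/(_ FF): c2 => c2; have c1 := cvg_norm (FF := FF) c2.
rewrite -subr_ge0; suff <- : `|l - c| = l - c by [].
apply: (cvg_unique (@norm_hausdorff C C) c1); apply: cvg_trans c2; apply: near_eq_cvg; apply: filterS cu => n cun.
by rewrite /= ger0_norm// subr_ge0.
Qed.

Let inner (a b : hardy R) : C := limn (series (fun n => a n * (b n)^*)).

Let inner_cvg (a b : hardy R) :
  series (fun n => a n * (b n)^*) @ \oo --> inner a b.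
Proof. apply: is_cvg_inner; exact: valP. Qed.

Let inner_linear (k : C) (x y z : hardy R) :
  inner (k *: x + y) z = k * inner x z + inner y z.
Proof.
apply: limC.
rewrite (_ : series _ = k \*: series (fun n => x n * (z n)^*)
                        + series (fun n => y n * (z n)^*)).
  by apply: cvgD; [exact: cvgZl_tmp|]; exact: inner_cvg.
have E n : (k *: x + y : hardy R) n * (z n)^* = k * (x n * (z n)^*) + y n * (z n)^*.
  by rewrite mulrA -mulrDl.
apply/funext => n; rewrite /series /=.
under eq_bigr do rewrite E.
by rewrite big_split /= -mulr_sumr.
Qed.

Let inner_conj (x y : hardy R) : inner x y = (inner y x)^*.
Proof.
apply: limC; apply/cvgrPdist_lt => e e0.
have /cvgrPdist_lt /(_ _ e0) := @inner_cvg y x; apply: filterS => n.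
rewrite -norm_conjC rmorphB /= /series /= rmorph_sum /=.
under eq_bigr do rewrite rmorphM /= conjCK mulrC.
by [].
Qed.

Let inner_gt0 (x : hardy R) : x != 0 -> 0 < inner x x.
Proof.
move=> x0.
have [m xm] : exists m, x m != 0.
  apply: contrapT => /forallNP h; move/eqP: x0; apply; apply: val_inj; apply/funext => m.
  by apply/eqP; rewrite -[_ == _]negbK; apply/negP; exact: h.
apply: (@lt_le_trans _ _ (`|x m| ^+ 2)); first by rewrite exprn_gt0 ?normr_gt0.
have xx n : x n * (x n)^* = `|x n| ^+ 2 by rewrite normCK.
apply: (le_limC (@inner_cvg x x)).
near=> n; rewrite /series /=.
under [leRHS]eq_bigr do rewrite xx.
rewrite big_mkord.
have mn : (m < n)%N by near: n; exact: nbhs_infty_gt.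
rewrite (bigD1 (Ordinal mn)) //= lerDl.
by apply: sumr_ge0 => i _; rewrite exprn_ge0.
Unshelve. all: by end_near. Qed.

HB.instance Definition _ :=
  Lmodule_hasInner.Build C (hardy R) inner_linear inner_conj inner_gt0.

Lemma dot_hardyE (x y : hardy R) :
  dot x y = limn (series (fun n => x n * (y n)^*)).
Proof. by []. Qed.

End hardy.

Definition psum (R : realType) (a : nat -> R[i]) (z : R[i]) : R[i] :=
  limn (series (fun n => a n * z ^+ n)).

Section hardy_eval.
Variable R : realType.
Local Notation C := R[i].

Lemma pow_ell2 (z : C) : `|z| < 1 -> (fun n => z ^+ n) \in @ell2 R.
Proof.
move=> z1; apply/ell2P; apply: nneg_series_cvg => [n|]; first exact: exprn_ge0.
have q1 : `|z| ^+ 2 < 1 by rewrite exprn_ilt1.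
exists (1 - `|z| ^+ 2)^-1 => n; rewrite /series /= big_mkord.
under eq_bigr do rewrite normrX exprAC.
rewrite -[leRHS]mul1r ler_pdivlMr ?subr_gt0// mulrC.
by rewrite -opprB mulNr -subrX1 opprB gerBl exprn_ge0// exprn_ge0.
Qed.

Lemma cvg_psum (f : hardy R) (z : C) : `|z| < 1 ->
  series (fun n => f n * z ^+ n) @ \oo --> psum f z.
Proof.
move=> z1; have zc1 : `|z^*| < 1 by rewrite norm_conjC.
have H := is_cvg_inner (valP f) (pow_ell2 zc1).
have E : (fun n => f n * (z^* ^+ n)^*) = (fun n => f n * z ^+ n).
  by apply/funext => n; rewrite rmorphXn /= conjCK.
by rewrite E in H.
Qed.

Lemma psum0 (z : C) : `|z| < 1 -> psum (0 : hardy R) z = 0.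
Proof.
move=> z1; apply: limC.
have -> : series (fun n => (0 : hardy R) n * z ^+ n) = fun=> 0.
  by apply/funext => n; rewrite /series /= big1 // => k _; exact: mul0r.
exact: cvg_cst.
Qed.

Lemma psumP (k : C) (f g : hardy R) (z : C) : `|z| < 1 ->
  psum (k *: f + g : hardy R) z = k * psum f z + psum g z.
Proof.
move=> z1; apply: limC.
rewrite (_ : series _ = k \*: series (fun n => f n * z ^+ n)
                        + series (fun n => g n * z ^+ n)).
  by apply: cvgD; [apply: cvgZl_tmp|]; exact: cvg_psum.
have E n : (k *: f + g : hardy R) n * z ^+ n = k * (f n * z ^+ n) + g n * z ^+ n.
  by rewrite mulrA -mulrDl.
apply/funext => n; rewrite /series /=.
under eq_bigr do rewrite E.
by rewrite big_split /= -mulr_sumr.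
Qed.

Definition mul_range (phi : C -> C) : {pred hardy R} :=
  [pred f : hardy R | `[< exists h : hardy R,
     forall z, `|z| < 1 -> psum f z = phi z * psum h z >]].

Let mul_range_submod phi : submod_closed (mul_range phi).
Proof.
split=> [|k f g /asboolP[f' ff'] /asboolP[g' gg']]; apply/asboolP.
  by exists 0 => z z1; rewrite psum0// mulr0.
exists (k *: f' + g') => z z1.
by rewrite !psumP// ff'// gg'// mulrDr mulrCA.
Qed.

HB.instance Definition _ (phi : C -> C) :=
  GRing.isSubmodClosed.Build C (hardy R) (mul_range phi) (mul_range_submod phi).
End hardy_eval.

Section operators.
Variable C : numClosedFieldType.

Definition bounded_op (V W : normedModType C) (A : V -> W) : Prop :=
  linear A /\ exists M : C, forall x, `|A x| <= M * `|x|.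

Definition quasiaffinity (V W : normedModType C) (A : V -> W) : Prop :=
  [/\ bounded_op A, forall x, A x = 0 -> x = 0 & dense (range A)].

Definition power_bounded (V : normedModType C) (T : V -> V) : Prop :=
  exists M : C, forall n, (1 <= n)%N -> forall x, `|iter n T x| <= M * `|x|.

Definition op_series_cvg (V : normedModType C) (c : nat -> C) (T A : V -> V) :
    Prop :=
  forall e : C, 0 < e -> \forall n \near \oo, forall x,
    `|A x - \sum_(k < n) c k *: iter k T x| <= e * `|x|.

Definition adjoint (V W : innerProductType C) (A : V -> W) (y : W) : V :=
  xget 0 [set v | forall x, dot (A x) y = dot x v].

Definition orthoproj (V : innerProductType C) (M : submodClosed V) (x : V) :
    sub_of M :=
  xget 0 [set p : sub_of M | forall y, y \in M -> dot (x - val p) y = 0].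

(* The restriction A|_M of an operator A leaving M invariant; the default value
   0 of [insubd] is reached only at vectors that A sends outside M. *)
Definition restr (V : innerProductType C) (M : submodClosed V) (A : V -> V)
    (x : sub_of M) : sub_of M :=
  insubd (0 : sub_of M) (A (val x)).

Definition closed_span (V : normedModType C) (x : nat -> V) : set V :=
  closure [set v | exists n (a : nat -> C), v = \sum_(k < n) a k *: x k].

Definition finitely_independent (V : normedModType C) (x : nat -> V) : Prop :=
  forall (s : seq nat) (a : nat -> C), uniq s ->
    \sum_(k <- s) a k *: x k = 0 -> forall k, k \in s -> a k = 0.

Definition bounded_basis_projections (V : normedModType C) (x : nat -> V) :
    Prop :=
  exists P : nat -> V -> V,
    [/\ forall n, bounded_op (P n),
        forall n N (a : nat -> C), P n (\sum_(k < N) a k *: x k) =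
          \sum_(k < N | (k <= n)%N) a k *: x k
      & exists M : C, forall n v, `|P n v| <= M * `|v|].

Definition orthonormal_basis (V : innerProductType C) (e : nat -> V) : Prop :=
  (forall m n, dot (e m) (e n) = (m == n)%:R) /\ closed_span e = setT.

Definition riesz_basis (V : innerProductType C) (x : nat -> V) : Prop :=
  exists (e : nat -> V) (A A' : V -> V),
    [/\ orthonormal_basis e, bounded_op A, bounded_op A',
        cancel A A' /\ cancel A' A & forall n, A (e n) = x n].

End operators.

Section disc.
Variable R : realType.
Local Notation C := R[i].

Definition disc_max (p : {poly C}) : R :=
  sup [set Re `|p.[z]| | z in [set z : C | `|z| <= 1]].

Definition polynomially_bounded (V : normedModType C) (T : V -> V) : Prop :=
  exists2 K : R, 0 < K & forall (p : {poly C}) (x : V),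
    `|\sum_(i < size p) p`_i *: iter i T x| <= (K * disc_max p)%:C%C * `|x|.

(* c is the sequence of Taylor coefficients of the analytic function g *)
Definition taylor_coefs (g : C -> C) (c : nat -> C) : Prop :=
  forall z, `|z| < 1 -> series (fun n => c n * z ^+ n) @ \oo --> g z.

Definition hardy_infty (g : C -> C) : Prop :=
  (exists c, taylor_coefs g c) /\
  exists M : C, forall z, `|z| < 1 -> `|g z| <= M.

Definition cexp (z : C) : C := (expR (Re z))%:C%C * (cos (Im z) +i* sin (Im z))%C.

Definition herglotz_kernel (z : C) (t : R) : C :=
  let w := (cos t +i* sin t)%C in (w + z) / (w - z).

Definition herglotz (k : R -> R) (z : C) : C :=
  let I (q : C -> R) := (2 * pi)^-1 *
    \int[lebesgue_measure]_(t in `[0, 2 * pi]) (q (herglotz_kernel z t) * k t) in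
  (I (@complex.Re R) +i* I (@complex.Im R))%C.

(* outer functions: g(z) = c exp (1/2pi int_0^2pi (e^it + z)/(e^it - z) k(t) dt)
   with |c| = 1 and k real-valued and integrable *)
Definition outer (g : C -> C) : Prop :=
  exists (c : C) (k : R -> R), [/\ `|c| = 1,
    lebesgue_measure.-integrable `[0, 2 * pi] (EFin \o k)
    & forall z, `|z| < 1 -> g z = c * cexp (herglotz k z)].

Definition gstar (g : C -> C) (z : C) : C := (g z^*)^*.

(* the element of H^2 whose values on the disc are those of phi *)
Definition hardy_of (phi : C -> C) : hardy R :=
  xget 0 [set h : hardy R | forall z, `|z| < 1 -> psum h z = phi z].

Definition mulop (phi : C -> C) (f : hardy R) : hardy R :=
  hardy_of (fun z => phi z * psum f z).

Definition ushift : hardy R -> hardy R := mulop (fun z => z).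

Definition szego (l : C) : hardy R := hardy_of (fun z => 1 / (1 - l^* * z)).

Definition blaschke_factor (l z : C) : C :=
  `|l| / l * ((l - z) / (1 - l^* * z)).

Definition blaschke (lam : nat -> C) (z : C) : C :=
  limn (fun N => \prod_(k < N) blaschke_factor (lam k) z).

Definition blaschke_omit (lam : nat -> C) (n : nat) (z : C) : C :=
  limn (fun N => \prod_(k < N | k != n :> nat) blaschke_factor (lam k) z).

Definition carleson (lam : nat -> C) : Prop :=
  exists2 delta : C, 0 < delta &
    forall n, delta <= `|blaschke_omit lam n (lam n)|.

Definition BH2 (lam : nat -> C) := sub_of (mul_range (blaschke lam)).

Definition KB (lam : nat -> C) := sub_of (orthc (mul_range (blaschke lam))).

Definition projBH2 (lam : nat -> C) : hardy R -> BH2 lam :=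
  @orthoproj _ _ (mul_range (blaschke lam)).

Definition projKB (lam : nat -> C) : hardy R -> KB lam :=
  @orthoproj _ _ (orthc (mul_range (blaschke lam))).

(* The vector u_n belongs to K_B, because B vanishes at lam n, so the default
   value of [insubd] is not reached. *)
Definition unit_kernel (lam : nat -> C) (n : nat) : KB lam :=
  insubd (0 : KB lam) (sqrtC (1 - `|lam n| ^+ 2) *: szego (lam n)).

Section TYX.
Variables (lam : nat -> C) (H0 : hilbertType C).

Definition opT (W : KB lam -> H0) (R0 : H0 -> H0) (v : dsum (BH2 lam) H0) :
    dsum (BH2 lam) H0 :=
  (restr ushift v.1 + projBH2 lam (ushift (val (adjoint W v.2))),
   adjoint R0 v.2).

Definition opY (W : KB lam -> H0) (v : dsum (BH2 lam) H0) : hardy R :=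
  val v.1 + val (adjoint W v.2).

Definition opX (g : C -> C) (Z : H0 -> KB lam) (f : hardy R) :
    dsum (BH2 lam) H0 :=
  (restr (mulop (gstar g)) (projBH2 lam f)
     + projBH2 lam (mulop (gstar g) (val (projKB lam f))),
   adjoint Z (projKB lam f)).

End TYX.
End disc.

(* Main.v *)
Require Import Defs.
From mathcomp Require Import all_boot all_order all_algebra.
From mathcomp Require Import all_classical all_reals all_analysis.
From mathcomp Require Import complex sesquilinear ring lra.
From mathcomp Require Import measurable_realfun.
From mathcomp Require cyclic separable cyclotomic.
Set Implicit Arguments.
Unset Strict Implicit.
Unset Printing Implicit Defensive.
Import Order.TTheory GRing.Theory Num.Theory.
Import numFieldNormedType.Exports.
Local Open Scope classical_set_scope.
Local Open Scope ring_scope.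
Local Notation Re := complex.Re.
Local Notation Im := complex.Im.

(** Every vector of the model space K_B is determined by its inner products
    with the normalized kernels u n, which are eigenvectors of the adjoint of
    every multiplication operator. Testing against u n (and against x n in H0)
    therefore turns each operator identity into an identity between scalars:
    W* intertwines R0* with the compression of S to K_B, W* Z* is the compression
    of g_*(S), and Z* intertwines the compression of S with R0*. In terms of Y,
    the block operators become T v = (P S Y v, R0* v_2) and
    X f = (P g_*(S) f, Z* P_K f), with P and P_K the projections onto BH^2 and
    K_B, and the relations Y T = S Y, X S = T X, Y X = g_*(S) and the formula for
    the powers of T are immediate (lemmas [PK_fshift], [PK_mul], [iter_T]).

    Power boundedness. The first component of T^n v is P S^n Y v. For the second
    one, R0^n multiplies the n-th powers of an increasing sequence in [0, 1) into
    the coefficients; Abel summation against the bounded partial sum projections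
    bounds it by twice their supremum ([abel_bound], [rn_iter_R0a]).

    Failure of polynomial boundedness. A polynomial bound for T gives one for the
    multipliers (p(lam k))_k acting on the coefficients of finite combinations of
    the x n. The Carleson condition makes 1 - lam n decay geometrically, and then
    explicit sums of finite Blaschke products weighted by peaks interpolate any
    signs at lam 0, ..., lam (N-1) with a sup norm independent of N
    ([interpolation]). So all sign changes are uniformly bounded, and choosing
    signs that make the cross terms of a squared norm favourable shows that the
    x n form a Riesz basis ([riesz_of_unconditional]), contrary to the hypothesis.

    Quasiaffinities. Injectivity of Y and X is read off the identities above.
    The range of Y contains that of g_*(S), which is dense because g is outer
    ([outer_dense]): g times suitable bounded functions has modulus at most 1 and
    value at 0 tending to 1, hence tends to 1 in H^2. Density of the range of X
    requires Z to be injective: the partial sum projections factor through Z,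
    the coefficient functionals being given by projected Blaschke products with
    one factor omitted ([P_of_Z]).

    The kernels. Y* h = (P h, W P_K h). If l is close to some lam n in the
    pseudohyperbolic metric, h_l is nearly a multiple of u n, and |x n| is
    bounded below; otherwise |B(l)| is bounded below, and it is at most
    |P h_l| / |h_l| ([adjoint_Y_ge]).

    Functions of H^2 are constructed throughout from their values on the disc, by
    a compactness argument for bounded sequences that converge pointwise
    ([hardy_limit]), without boundary values. *)

(** * Real norms and convergence of sequences *)
Section RealNorm.
Variable R : realType.
Local Notation C := R[i].

(** Norms are valued in the field of scalars, here R[i]; this is the same norm
    as a real number, so that estimates are real inequalities. *)
Definition rn (V : normedZmodType C) (x : V) : R := Re `|x|.

Lemma rnE (V : normedZmodType C) (x : V) : `|x| = (rn x)%:C%C.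
Proof. by rewrite /rn ReK. Qed.

Lemma rn_ge0 (V : normedZmodType C) (x : V) : 0 <= rn x.
Proof. by rewrite -lecR -rnE normr_ge0. Qed.

Lemma rn0 (V : normedZmodType C) : rn (0 : V) = 0.
Proof. by rewrite /rn normr0. Qed.

Lemma rn0_eq (V : normedZmodType C) (x : V) : rn x = 0 -> x = 0.
Proof. by move=> h; apply/eqP; rewrite -normr_eq0 rnE h. Qed.

Lemma rn_gt0 (V : normedZmodType C) (x : V) : x != 0 -> 0 < rn x.
Proof.
by move=> x0; rewrite lt_def rn_ge0 andbT; apply: contra x0 => /eqP /rn0_eq ->.
Qed.

Lemma rnN (V : normedZmodType C) (x : V) : rn (- x) = rn x.
Proof. by rewrite /rn normrN. Qed.

Lemma rnBC (V : normedZmodType C) (x y : V) : rn (x - y) = rn (y - x).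
Proof. by rewrite -rnN opprB. Qed.

Lemma rnD (V : normedZmodType C) (x y : V) : rn (x + y) <= rn x + rn y.
Proof. by rewrite -lecR rmorphD /= -!rnE ler_normD. Qed.

Lemma rnB (V : normedZmodType C) (x y : V) : rn (x - y) <= rn x + rn y.
Proof. by rewrite -(rnN y) rnD. Qed.

Lemma rn_tri (V : normedZmodType C) (y x z : V) :
  rn (x - z) <= rn (x - y) + rn (y - z).
Proof. by rewrite (le_trans _ (rnD _ _))// addrA subrK. Qed.

Lemma rn_subl (V : normedZmodType C) (x y : V) : rn x - rn y <= rn (x - y).
Proof. by rewrite lerBlDr (le_trans _ (rnD _ _))// subrK. Qed.

Lemma rn_sum (V : normedZmodType C) (I : Type) (r : seq I) (P : pred I)
  (F : I -> V) : rn (\sum_(i <- r | P i) F i) <= \sum_(i <- r | P i) rn (F i).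
Proof.
apply: (big_ind2 (fun (a : V) b => rn a <= b)); first by rewrite rn0.
  by move=> a b c d h1 h2; rewrite (le_trans (rnD _ _))// lerD.
by [].
Qed.

Lemma rnZ (V : normedModType C) (a : C) (x : V) : rn (a *: x) = rn a * rn x.
Proof. by apply: complexI; rewrite rmorphM /= -!rnE normrZ. Qed.

Lemma rnM (a b : C) : rn (a * b) = rn a * rn b.
Proof. by apply: complexI; rewrite rmorphM /= -!rnE normrM. Qed.

Lemma rn1 : rn (1 : C) = 1.
Proof. by rewrite /rn normr1. Qed.

Lemma rnX (a : C) n : rn (a ^+ n) = rn a ^+ n.
Proof. by elim: n => [|n IH]; rewrite ?expr0 ?rn1// !exprS rnM IH. Qed.

Lemma rnV (a : C) : rn (a^-1) = (rn a)^-1.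
Proof. by apply: complexI; rewrite fmorphV /= -!rnE normfV. Qed.

Lemma rnr (r : R) : rn (r%:C%C : C) = `|r|.
Proof. by rewrite /rn normc_def /= expr0n addr0 sqrtr_sqr. Qed.

Lemma rn_conj (a : C) : rn (a^* ) = rn a.
Proof. by rewrite /rn norm_conjC. Qed.

Lemma rn_prod (I : Type) (r : seq I) (P : pred I) (F : I -> C) :
  rn (\prod_(i <- r | P i) F i) = \prod_(i <- r | P i) rn (F i).
Proof.
by apply: (big_morph (@rn C)) => [a b|]; rewrite ?rnM ?rn1.
Qed.

Lemma rn_sqr (a : C) : rn a ^+ 2 = Re a ^+ 2 + Im a ^+ 2.
Proof. by apply: complexI; rewrite add_Re2_Im2 rmorphXn /= -rnE. Qed.

Lemma Re_le_rn (a : C) : `|Re a| <= rn a.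
Proof.
by rewrite -(ler_pXn2r (n := 2)) ?nnegrE ?rn_ge0// rn_sqr real_normK ?num_real// lerDl sqr_ge0.
Qed.

Lemma Im_le_rn (a : C) : `|Im a| <= rn a.
Proof.
by rewrite -(ler_pXn2r (n := 2)) ?nnegrE ?rn_ge0// rn_sqr real_normK ?num_real// lerDr sqr_ge0.
Qed.

Lemma rn_le_ReIm (a : C) : rn a <= `|Re a| + `|Im a|.
Proof.
rewrite -(ler_pXn2r (n := 2)) ?nnegrE ?rn_ge0 ?addr_ge0// rn_sqr sqrrD.
by rewrite !real_normK ?num_real// addrAC lerDl mulrn_wge0// mulr_ge0.
Qed.

Lemma mul_conj (a : C) : a * a^* = (rn a ^+ 2)%:C%C.
Proof. by rewrite -normCK rnE rmorphXn. Qed.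

Lemma lt1C (z : C) : (`|z| < 1) = (rn z < 1).
Proof. by rewrite rnE -(ltcR _ 1). Qed.

Lemma le1C (z : C) : (`|z| <= 1) = (rn z <= 1).
Proof. by rewrite rnE -(lecR _ 1). Qed.

Lemma gt0C (z : C) : 0 < z -> exists2 r : R, 0 < r & z = r%:C%C.
Proof.
move=> z0; exists (Re z); last by rewrite ReK ?ltW.
by move: z0; rewrite ltcE => /andP[].
Qed.

Definition tends (V : normedZmodType C) (u : nat -> V) (l : V) :=
  forall e : R, 0 < e -> exists N, forall n, (N <= n)%N -> rn (u n - l) < e.

Definition cauchyseq (V : normedZmodType C) (u : nat -> V) :=
  forall e : R, 0 < e ->
    exists N, forall m n, (N <= m)%N -> (N <= n)%N -> rn (u m - u n) < e.

Lemma tendsP (V : normedModType C) (u : nat -> V) (l : V) :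
  tends u l <-> u @ \oo --> l.
Proof.
split=> [h|/cvgrPdist_lt h e e0].
  apply/cvgrPdist_lt => _ /gt0C[e e0 ->]; have [N hN] := h e e0.
  by exists N => // n /= Nn; rewrite distrC rnE ltcR hN.
have [|N _ hN] := h (e%:C%C); first by rewrite -[0]/(0%:C%C) ltcR.
by exists N => n Nn; have := hN _ Nn; rewrite distrC rnE ltcR.
Qed.

Lemma tends_lim (u : nat -> C) (l : C) : tends u l -> limn u = l.
Proof. by move=> h; apply: limC; apply/(tendsP (V := C)). Qed.

Section tends_alg.
Variable V : normedZmodType C.
Implicit Types u v : nat -> V.

Lemma tends_uniq u l l' : tends u l -> tends u l' -> l = l'.
Proof.
move=> h h'; apply/eqP; rewrite -subr_eq0; apply/eqP; apply: rn0_eq.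
apply/eqP; rewrite eq_le rn_ge0 andbT; apply/ler_addgt0Pl => e e0; rewrite addr0.
have [|N hN] := h (e / 2); first lra.
have [|M hM] := h' (e / 2); first lra.
have h1 := hN (N + M)%N (leq_addr _ _); have h2 := hM (N + M)%N (leq_addl _ _).
have := rn_tri (u (N + M)%N) l l'; rewrite (rnBC l (u _)); lra.
Qed.

Lemma tends_cst (l : V) : tends (fun=> l) l.
Proof. by move=> e e0; exists 0%N => n _; rewrite subrr rn0. Qed.

Lemma tends_ext u v l : (forall n, u n = v n) -> tends u l -> tends v l.
Proof. by move=> h; rewrite (_ : u = v)//; exact/funext. Qed.

Lemma tends_near u v l :
  (exists N, forall n, (N <= n)%N -> u n = v n) -> tends u l -> tends v l.
Proof.
move=> [N hN] h e /h[M hM]; exists (maxn N M) => n; rewrite geq_max => /andP[a b].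
by rewrite -hN// hM.
Qed.

Lemma tendsD u v l l' : tends u l -> tends v l' ->
  tends (fun n => u n + v n) (l + l').
Proof.
move=> h h' e e0.
have [|N hN] := h (e / 2); first lra.
have [|M hM] := h' (e / 2); first lra.
exists (maxn N M) => n; rewrite geq_max => /andP[a b].
have h1 := hN n a; have h2 := hM n b.
rewrite opprD addrACA (le_lt_trans (rnD _ _))//; lra.
Qed.

Lemma tendsN u l : tends u l -> tends (fun n => - u n) (- l).
Proof. by move=> h e /h[N hN]; exists N => n /hN; rewrite -opprD rnN. Qed.

Lemma tendsB u v l l' : tends u l -> tends v l' ->
  tends (fun n => u n - v n) (l - l').
Proof. by move=> h /tendsN; exact: tendsD. Qed.

Lemma tends_cauchy u l : tends u l -> cauchyseq u.
Proof.
move=> h e e0; have [|N hN] := h (e / 2); first lra.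
exists N => m n a b; have := rn_tri l (u m) (u n); rewrite (rnBC l).
by have := hN m a; have := hN n b; lra.
Qed.

Lemma tends_S u l : tends u l -> tends (fun n => u n.+1) l.
Proof. by move=> h e /h[N hN]; exists N => n Nn; rewrite hN// leqW. Qed.

Lemma tends_rn_le u l (c : R) : tends u l -> (forall n, rn (u n) <= c) -> rn l <= c.
Proof.
move=> h hc; apply/ler_addgt0Pl => e e0; have [N hN] := h e e0.
have h1 := hN N (leqnn _); have h2 := hc N.
have := rn_subl l (u N); rewrite rnBC; lra.
Qed.

Lemma tends_rn_le_near u l (c : R) N : tends u l ->
  (forall n, (N <= n)%N -> rn (u n) <= c) -> rn l <= c.
Proof.
move=> h hc; apply/ler_addgt0Pl => e e0; have [M hM] := h e e0.
have h1 := hM (N + M)%N (leq_addl _ _); have h2 := hc (N + M)%N (leq_addr _ _).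
have := rn_subl l (u (N + M)%N); rewrite rnBC; lra.
Qed.

Lemma cauchy_bounded u : cauchyseq u -> exists2 M, 0 <= M & forall n, rn (u n) <= M.
Proof.
move=> h; have [N hN] := h 1 ltr01.
exists (1 + \sum_(i < N.+1) rn (u i)).
  by rewrite addr_ge0// sumr_ge0// => i _; exact: rn_ge0.
move=> n; have [nN|Nn] := leqP n N.
  rewrite (bigD1 (Ordinal (nN : n < N.+1)%N))//= addrCA lerDl addr_ge0//.
  by rewrite sumr_ge0// => i _; exact: rn_ge0.
have h1 : rn (u n) <= 1 + rn (u N).
  have := hN n N (ltnW Nn) (leqnn _); have := rn_subl (u n) (u N); lra.
rewrite (le_trans h1)// lerD2l big_ord_recr /= lerDr sumr_ge0// => i _.
exact: rn_ge0.
Qed.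

End tends_alg.

Lemma tendsZl (V : normedModType C) (a : C) (u : nat -> V) l :
  tends u l -> tends (fun n => a *: u n) (a *: l).
Proof.
move=> h e e0; have a0 := rn_ge0 a.
have [|N hN] := h (e / (rn a + 1)); first by rewrite divr_gt0//; lra.
exists N => n /hN; rewrite ltr_pdivlMr ?ltr_pwDr// -scalerBr rnZ mulrDr mulr1.
by have := rn_ge0 (u n - l); rewrite mulrC; lra.
Qed.

Lemma tendsM (u v : nat -> C) l l' : tends u l -> tends v l' ->
  tends (fun n => u n * v n) (l * l').
Proof.
move=> h h'; apply: (tends_ext (u := fun n => u n * (v n - l') + l' * u n)).
  by move=> n; ring.
rewrite -[X in tends _ X]add0r (mulrC l l').
apply: tendsD; last exact: (tendsZl (V := C)).
have [M M0 hM] := cauchy_bounded (tends_cauchy h).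
move=> e e0; have [|N hN] := h' (e / (M + 1)); first by rewrite divr_gt0//; lra.
exists N => n /hN; rewrite ltr_pdivlMr; last lra.
rewrite subr0 rnM; have := hM n; have := rn_ge0 (v n - l'); have := rn_ge0 (u n).
by nra.
Qed.

Lemma tendsMl (a : C) (u : nat -> C) l : tends u l -> tends (fun n => a * u n) (a * l).
Proof. by apply: tendsM; exact: tends_cst. Qed.

Lemma tends_conj (u : nat -> C) l : tends u l -> tends (fun n => (u n)^* ) (l^* ).
Proof. by move=> h e /h[N hN]; exists N => n /hN; rewrite -rmorphB rn_conj. Qed.

Lemma tends_sum (V : normedZmodType C) (m : nat) (u : nat -> nat -> V) (l : nat -> V) :
  (forall k, (k < m)%N -> tends (u k) (l k)) ->
  tends (fun n => \sum_(k < m) u k n) (\sum_(k < m) l k).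
Proof.
elim: m => [_|m IH h].
  rewrite big_ord0; apply: tends_ext (tends_cst 0) => n; by rewrite big_ord0.
rewrite big_ord_recr /=; apply: tends_ext; last first.
  by apply: tendsD; [apply: IH => k km; apply: h; exact: ltnW|exact: h].
by move=> n; rewrite big_ord_recr.
Qed.

Definition completeV (V : normedZmodType C) :=
  forall u : nat -> V, cauchyseq u -> exists l, tends u l.

Lemma complete_seq (K : numFieldType) (V : completeNormedModType K) (u : nat -> V) :
  (forall e : K, 0 < e ->
    exists N, forall m n, (N <= m)%N -> (N <= n)%N -> `|u m - u n| < e) ->
  cvgn u.
Proof.
move=> h; apply: cauchy_cvg; apply: cauchy_exP => e e0.
have [N hN] := h e e0; exists (u N); exists N => // n /= Nn.
by rewrite -ball_normE /=; exact: hN.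
Qed.

Lemma hilbert_complete (V : hilbertType C) : completeV V.
Proof.
move=> u h; suff /cvg_ex[l hl] : cvgn u by exists l; apply/tendsP.
apply: complete_seq => _ /gt0C[e e0 ->]; have [N hN] := h e e0.
by exists N => m n a b; rewrite rnE ltcR hN.
Qed.

Lemma real_complete (u : nat -> R) :
  (forall e : R, 0 < e ->
    exists N, forall m n, (N <= m)%N -> (N <= n)%N -> `|u m - u n| < e) ->
  exists l : R, u @ \oo --> l.
Proof. by move=> /(@complete_seq R R^o)/cvg_ex. Qed.

Lemma C_complete : completeV C.
Proof.
move=> u h.
have [a ha] : exists l : R, (fun n => Re (u n)) @ \oo --> l.
  apply: real_complete => e /h[N hN]; exists N => m n p q.
  by rewrite (le_lt_trans _ (hN m n p q))//= -raddfB Re_le_rn.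
have [b hb] : exists l : R, (fun n => Im (u n)) @ \oo --> l.
  apply: real_complete => e /h[N hN]; exists N => m n p q.
  by rewrite (le_lt_trans _ (hN m n p q))//= -raddfB Im_le_rn.
exists (a +i* b)%C => e e0.
move/cvgrPdist_lt : ha => /(_ (e / 2) ltac:(lra))[N _ hN].
move/cvgrPdist_lt : hb => /(_ (e / 2) ltac:(lra))[M _ hM].
exists (maxn N M) => n; rewrite geq_max => /andP[p q].
have := hN n p; have := hM n q; rewrite /= (distrC a) (distrC b) => h1 h2.
rewrite (le_lt_trans (rn_le_ReIm _))//.
rewrite !raddfB /=; lra.
Qed.

(** The partial sums of the bounds [w] are nondecreasing and bounded, hence
    Cauchy, and they dominate the increments of [u]. *)
Lemma cauchy_summable (V : normedZmodType C) (u : nat -> V) (w : nat -> R) (M : R) :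
  (forall n, rn (u n.+1 - u n) <= w n) -> (forall N, \sum_(i < N) w i <= M) ->
  cauchyseq u.
Proof.
move=> h hM e e0.
pose s N := \sum_(i < N) w i.
have w0 n : 0 <= w n := le_trans (rn_ge0 _) (h n).
have smono : {homo s : m n / (m <= n)%N >-> m <= n}.
  move=> m n mn; rewrite /s -(subnKC mn) big_split_ord /= lerDl.
  by rewrite sumr_ge0.
have inc m k : rn (u (m + k)%N - u m) <= s (m + k)%N - s m.
  elim: k => [|k IH]; first by rewrite addn0 !subrr rn0.
  rewrite addnS; have -> : s (m + k).+1 = s (m + k)%N + w (m + k)%N.
    by rewrite /s big_ord_recr.
  have := rn_tri (u (m + k)%N) (u (m + k).+1) (u m); have := h (m + k)%N; lra.
have cs : cvgn s.
  apply: nondecreasing_is_cvgn; first exact: smono.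
  by exists M => _ [n _ <-]; exact: hM.
move: cs => /cvg_ex[l /cvgrPdist_lt/(_ (e / 2) ltac:(lra))[N _ hN]].
exists N => m n.
wlog mn : m n / (m <= n)%N => [H p q|p q].
  by have [/H|/ltnW/H] := leqP m n; [exact|rewrite rnBC; exact].
rewrite rnBC -(subnKC mn) (le_lt_trans (inc _ _))// subnKC//.
have := hN m p; have := hN n q; rewrite /= !ltr_distl; lra.
Qed.

Definition inv_succ (n : nat) : R := n.+1%:R^-1.

Lemma inv_succ_gt0 n : 0 < inv_succ n.
Proof. by rewrite invr_gt0 ltr0n. Qed.

Lemma inv_succ_le1 n : inv_succ n <= 1.
Proof. by rewrite invf_le1 ?ltr0n// ler1n. Qed.

Lemma inv_succ_small e : 0 < e -> exists N, forall n, (N <= n)%N -> inv_succ n < e.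
Proof.
move=> e0; exists (Num.truncn e^-1) => n Nn.
rewrite -[ltRHS]invrK ltf_pV2 ?posrE ?invr_gt0 ?ltr0n//.
by rewrite (lt_le_trans (truncnS_gt _))// ler_nat ltnS.
Qed.

End RealNorm.
Arguments inv_succ : clear implicits.

(** * Inner product spaces *)
Section InnerProduct.
Variable R : realType.
Local Notation C := R[i].

Lemma conj_re (r : R) : (r%:C%C : C)^* = r%:C%C.
Proof. by rewrite conj_Creal// complex_real. Qed.

Section dot_alg.
Variable V : innerProductType C.
Implicit Types x y z : V.

Lemma dotxx x : dot x x = (rn x ^+ 2)%:C%C.
Proof. by rewrite dot_norm rnE rmorphXn. Qed.

Lemma dotC x y : dot x y = (dot y x)^*.
Proof. by rewrite hermC expr0 mul1r. Qed.

Lemma dotDl x y z : dot (x + y) z = dot x z + dot y z.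
Proof. exact: linearDl. Qed.
Lemma dotDr x y z : dot z (x + y) = dot z x + dot z y.
Proof. exact: linearDr. Qed.
Lemma dotNl x z : dot (- x) z = - dot x z.
Proof. exact: linearNl. Qed.
Lemma dotNr x z : dot z (- x) = - dot z x.
Proof. exact: linearNr. Qed.
Lemma dotBl x y z : dot (x - y) z = dot x z - dot y z.
Proof. by rewrite dotDl dotNl. Qed.
Lemma dotBr x y z : dot z (x - y) = dot z x - dot z y.
Proof. by rewrite dotDr dotNr. Qed.
Lemma dot0l z : dot 0 z = 0.
Proof. exact: linear0l. Qed.
Lemma dot0r z : dot z 0 = 0.
Proof. exact: linear0r. Qed.
Lemma dotZl a x z : dot (a *: x) z = a * dot x z.
Proof. exact: linearZl_LR. Qed.
Lemma dotZr a x z : dot z (a *: x) = a^* * dot z x.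
Proof. by rewrite dotC dotZl rmorphM /= -dotC. Qed.

Lemma dot_suml (I : Type) (r : seq I) (P : pred I) (F : I -> V) z :
  dot (\sum_(i <- r | P i) F i) z = \sum_(i <- r | P i) dot (F i) z.
Proof.
apply: (big_ind2 (fun (a : V) b => dot a z = b)); first exact: dot0l.
  by move=> a b c d <- <-; rewrite dotDl.
by [].
Qed.

Lemma dot_eq0 x : (forall y, dot x y = 0) -> x = 0.
Proof.
move=> /(_ x); rewrite dotxx => h; apply: rn0_eq; apply/eqP.
by rewrite -sqrf_eq0 -(inj_eq (@complexI R)) h.
Qed.

Lemma dot_inj x y : (forall z, dot z x = dot z y) -> x = y.
Proof.
move=> h; apply/eqP; rewrite -subr_eq0; apply/eqP; apply: dot_eq0 => z.
by rewrite dotC dotBr h subrr conjC0.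
Qed.

Lemma dot_CS x y : rn (dot x y) <= rn x * rn y.
Proof.
rewrite -(ler_pXn2r (n := 2)) ?nnegrE ?mulr_ge0 ?rn_ge0// exprMn -lecR.
have -> : (rn x ^+ 2 * rn y ^+ 2)%:C%C = dot x x * dot y y by rewrite !dotxx -rmorphM.
by rewrite rmorphXn /= -rnE form_CauchySchwarz.
Qed.

Lemma rnD_sq x y : rn (x + y) ^+ 2 = rn x ^+ 2 + rn y ^+ 2 + 2 * Re (dot x y).
Proof.
apply: complexI; rewrite -dotxx dnormD /= !dotxx addcJ !rmorphD /=.
have -> : (2 * Re (dot x y))%:C%C = 2 * (Re (dot x y))%:C%C :> C by rewrite -[2 in RHS](rmorph_nat (real_complex R)) -rmorphM.
by [].
Qed.

Lemma rnB_sq x y : rn (x - y) ^+ 2 = rn x ^+ 2 + rn y ^+ 2 - 2 * Re (dot x y).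
Proof. by rewrite rnD_sq rnN dotNr raddfN /= mulrN. Qed.

Lemma parallelogram x y :
  rn (x + y) ^+ 2 + rn (x - y) ^+ 2 = 2 * rn x ^+ 2 + 2 * rn y ^+ 2.
Proof. by rewrite rnD_sq rnB_sq; ring. Qed.

Lemma tends_dotl (u : nat -> V) l y : tends u l -> tends (fun n => dot (u n) y) (dot l y).
Proof.
move=> h e e0; have [|N hN] := h (e / (rn y + 1)).
  by rewrite divr_gt0//; have := rn_ge0 y; lra.
exists N => n /hN; rewrite ltr_pdivlMr; last by have := rn_ge0 y; lra.
rewrite -dotBl; have := dot_CS (u n - l) y; have := rn_ge0 (u n - l); nra.
Qed.

Lemma rn_dual (M : R) x : 0 <= M -> (forall y, rn (dot x y) <= M * rn y) -> rn x <= M.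
Proof.
move=> M0 /(_ x); rewrite dotxx rnr ger0_norm ?sqr_ge0// => h.
have [->//|x0] := eqVneq x 0; first by rewrite rn0.
by have := rn_gt0 x0 => xp; rewrite expr2 ler_pM2r in h.
Qed.

(** The nearest-point argument: a minimizing sequence for the distance from [v]
    to a linear subspace is Cauchy by the parallelogram law. The subspace need
    not be closed, so the projection is only a limit of its points. *)
Lemma orth_decomp (D : set V) : completeV V -> D 0 ->
  (forall a x y, D x -> D y -> D (a *: x + y)) ->
  forall v, exists p, (exists u : nat -> V, (forall n, D (u n)) /\ tends u p) /\
    (forall d, D d -> dot (v - p) d = 0).
Proof.
move=> cV D0 DP v.
pose S := [set rn (v - d) ^+ 2 | d in D].
have S0 : S !=set0 by exists (rn (v - 0) ^+ 2), 0.
have Slb : has_lbound S by exists 0 => _ [d _ <-]; exact: sqr_ge0.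
pose I := inf S.
have II d : D d -> I <= rn (v - d) ^+ 2 by move=> Dd; apply: ge_inf => //; exists d.
have /choice[u hu] : forall n, exists d, D d /\ rn (v - d) ^+ 2 < I + inv_succ R n.
  move=> n; have [_ [d Dd <-] h] : exists2 x, S x & x < I + inv_succ R n.
    by apply: inf_adherent => //; exact: inv_succ_gt0.
  by exists d.
have uD n := (hu n).1; have uI n := (hu n).2.
have mid m n : rn (u m - u n) ^+ 2 <= 2 * (inv_succ R m + inv_succ R n).
  have Dm : D (2^-1 *: (u m + u n)).
    rewrite -[X in D X]addr0; apply: (DP) => //.
    by rewrite -(scale1r (u m)); exact: DP.
  have := parallelogram (v - u m) (v - u n).
  have -> : v - u m - (v - u n) = u n - u m by rewrite opprB addrC addrA subrK.
  have -> : v - u m + (v - u n) = 2 *: (v - 2^-1 *: (u m + u n)).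
    by rewrite scalerBr scalerA divff ?pnatr_eq0// scale1r scaler_nat mulr2n opprD addrACA.
  rewrite rnZ (rnBC (u n)).
  have -> : rn (2 : C) = 2 by rewrite -[2]/(2%:R) /rn ger0_norm ?ler0n//.
  have := II _ Dm; have := uI m; have := uI n; rewrite exprMn.
  move: (rn (v - u m) ^+ 2) (rn (v - u n) ^+ 2) (rn (u m - u n) ^+ 2).
  move: (rn (v - 2^-1 *: (u m + u n)) ^+ 2) (inv_succ R m) (inv_succ R n).
  move=> r1 r2 r3 r4 r5 r6; lra.
have cu : cauchyseq u.
  move=> e e0; have [|N hN] := @inv_succ_small R (e ^+ 2 / 4).
    by rewrite divr_gt0// exprn_gt0.
  exists N => m n hm hn.
  rewrite -(ltr_pXn2r (n := 2)) ?nnegrE ?rn_ge0 ?ltW//.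
  have := mid m n; have := hN m hm; have := hN n hn; lra.
have [p hp] := cV _ cu.
exists p; split; first by exists u.
move=> d Dd; have [->|d0] := eqVneq d 0; first exact: dot0r.
have dp : 0 < rn d := rn_gt0 d0.
apply: (tends_uniq (u := fun n => dot (v - u n) d)).
  by apply: tends_dotl; apply: tendsB => //; exact: tends_cst.
move=> e e0.
have [|N hN] := @inv_succ_small R (e ^+ 2 / rn d ^+ 2).
  by rewrite divr_gt0// exprn_gt0.
exists N => n Nn; rewrite subr0.
set c := dot (v - u n) d; pose s : R := (rn d ^+ 2)^-1.
have Dn : D (u n + (s%:C%C * c) *: d) by rewrite addrC; exact: DP.
have := II _ Dn; rewrite opprD addrA rnB_sq dotZr -/c rmorphM /= conj_re.
rewrite -mulrA (mulrC c^*) mul_conj -rmorphM /= rnZ rnM rnr ger0_norm ?invr_ge0 ?sqr_ge0//.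
have sE : s * rn d ^+ 2 = 1 by rewrite mulVf// expf_neq0// gt_eqF.
move=> h; rewrite -(ltr_pXn2r (n := 2)) ?nnegrE ?rn_ge0 ?ltW//.
have h2 : s * rn c ^+ 2 < inv_succ R n.
  have := uI n; have : (s * rn c * rn d) ^+ 2 = (s * rn d ^+ 2) * (s * rn c ^+ 2) by ring.
  rewrite sE mul1r => E; rewrite E in h; lra.
have : s * rn c ^+ 2 < s * e ^+ 2 by rewrite (lt_trans h2)// mulrC hN.
by rewrite ltr_pM2l// invr_gt0 exprn_gt0.
Qed.

Lemma dense_of_orth (D : set V) : completeV V -> D 0 ->
  (forall a x y, D x -> D y -> D (a *: x + y)) ->
  (forall v, (forall d, D d -> dot v d = 0) -> v = 0) ->
  forall v (e : R), 0 < e -> exists2 d, D d & rn (v - d) < e.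
Proof.
move=> cV D0 DP h v e e0; have [p [[u [uD up]] hp]] := orth_decomp cV D0 DP v.
have /eqP : v - p = 0 by exact: h.
rewrite subr_eq0 => /eqP ->; have [N hN] := up e e0.
by exists (u N) => //; rewrite rnBC hN.
Qed.

(** A vector orthogonal to the kernel, suitably scaled, represents the
    functional. *)
Lemma riesz (phi : V -> C) (M : R) : completeV V ->
  (forall a x y, phi (a *: x + y) = a * phi x + phi y) ->
  (forall x, rn (phi x) <= M * rn x) ->
  exists v, forall x, phi x = dot x v.
Proof.
move=> cV lphi bphi.
have phi0 : phi 0 = 0.
  by have := lphi (-1) 0 0; rewrite scaler0 addr0 mulN1r addNr.
have [[w pw]|/forallNP z] := pselect (exists w, phi w != 0); last first.
  exists 0 => x; rewrite dot0r; apply/eqP; apply: contrapT => h.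
  by apply: (z x); apply/negP.
pose D := [set x | phi x = 0].
have [|a x y /= dx dy|p [[u [uD up]] hp]] := @orth_decomp D cV _ _ w.
- exact: phi0.
- by rewrite /D /= lphi dx dy mulr0 addr0.
have pB x y : phi (x - y) = phi x - phi y.
  by rewrite -[- y]scaleN1r addrC lphi mulN1r addrC.
have pp : phi p = 0.
  apply: (tends_uniq (u := fun n => phi (u n))).
    move=> e e0; have [|N hN] := up (e / (`|M| + 1)).
      by rewrite divr_gt0// ltr_pwDr.
    exists N => n /hN; rewrite ltr_pdivlMr ?ltr_pwDr// -pB.
    have := bphi (u n - p); have := rn_ge0 (u n - p); have := ler_norm M; nra.
  by apply: tends_ext (tends_cst 0) => n; have /= := uD n.
pose q := w - p.
have pq : phi q != 0 by rewrite pB pp subr0.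
have q0 : q != 0 by apply: contra pq => /eqP ->; rewrite phi0.
have qq : dot q q != 0 by rewrite dotxx (inj_eq (@complexI R)) sqrf_eq0 gt_eqF ?rn_gt0.
exists ((phi q / dot q q)^* *: q) => x.
rewrite dotZr conjCK.
have : dot q (x - (phi x / phi q) *: q) = 0.
  by apply: hp; rewrite /D /= -scaleNr addrC lphi mulNr divfK// addNr.
rewrite dotC; move/eqP; rewrite conjC_eq0 dotBl dotZl subr_eq0 => /eqP ->.
by field; rewrite qq pq.
Qed.

End dot_alg.

Lemma rn_sub (V : innerProductType C) (M : submodClosed V) (x : sub_of M) :
  rn x = rn (val x).
Proof.
apply/eqP; rewrite -(eqrXn2 (n := 2)) ?rn_ge0//; apply/eqP.
by apply: complexI; rewrite -!dotxx.
Qed.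

Lemma dot_sub (V : innerProductType C) (M : submodClosed V) (x y : sub_of M) :
  dot x y = dot (val x) (val y).
Proof. by []. Qed.

Lemma rn_dsum (V W : innerProductType C) (x : dsum V W) :
  rn x ^+ 2 = rn x.1 ^+ 2 + rn x.2 ^+ 2.
Proof. by apply: complexI; rewrite rmorphD /= -!dotxx. Qed.

Lemma rn_dsum1 (V W : innerProductType C) (x : dsum V W) : rn x.1 <= rn x.
Proof.
by rewrite -(ler_pXn2r (n := 2)) ?nnegrE ?rn_ge0// rn_dsum lerDl sqr_ge0.
Qed.

Lemma rn_dsum2 (V W : innerProductType C) (x : dsum V W) : rn x.2 <= rn x.
Proof.
by rewrite -(ler_pXn2r (n := 2)) ?nnegrE ?rn_ge0// rn_dsum lerDr sqr_ge0.
Qed.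

Lemma rn_dsum_le (V W : innerProductType C) (x : dsum V W) : rn x <= rn x.1 + rn x.2.
Proof.
rewrite -(ler_pXn2r (n := 2)) ?nnegrE ?addr_ge0 ?rn_ge0// rn_dsum.
have := rn_ge0 x.1; have := rn_ge0 x.2; nra.
Qed.

Section operators.
Implicit Types V W : normedModType C.

Lemma bounded_opP V W (A : V -> W) : bounded_op A <->
  linear A /\ exists2 M : R, 0 <= M & forall x, rn (A x) <= M * rn x.
Proof.
split=> [[lA [[M N] hM]]|[lA [M M0 hM]]]; split=> //.
  exists `|M|; first by []; move=> x.
  have := hM x; rewrite !rnE (_ : _ * _ = (M * rn x +i* (N * rn x))%C); last by simpc.
  rewrite lecE /= => /andP[_ h].
  by rewrite (le_trans h)// ler_wpM2r ?rn_ge0 ?ler_norm.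
by exists M%:C%C => x; rewrite !rnE -rmorphM lecR.
Qed.

Section linear_op.
Variables (V W : lmodType C) (A : V -> W) (lA : linear A).
Lemma lin0 : A 0 = 0.
Proof. by have := lA (-1) 0 0; rewrite scaler0 addr0 scaleN1r addNr. Qed.
Lemma linD x y : A (x + y) = A x + A y.
Proof. by rewrite -(scale1r x) lA !scale1r. Qed.
Lemma linZ a x : A (a *: x) = a *: A x.
Proof. by rewrite -(addr0 (a *: x)) lA lin0 addr0. Qed.
Lemma linN x : A (- x) = - A x.
Proof. by rewrite -(scaleN1r x) linZ scaleN1r. Qed.
Lemma linB x y : A (x - y) = A x - A y.
Proof. by rewrite linD linN. Qed.
Lemma lin_sum (I : Type) (r : seq I) (P : pred I) (F : I -> V) :
  A (\sum_(i <- r | P i) F i) = \sum_(i <- r | P i) A (F i).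
Proof.
apply: (big_ind2 (fun (a : V) b => A a = b)); first exact: lin0.
  by move=> a b c d <- <-; rewrite linD.
by [].
Qed.
End linear_op.

Lemma tends_op V W (A : V -> W) u l : bounded_op A -> tends u l ->
  tends (fun n => A (u n)) (A l).
Proof.
move=> /bounded_opP[lA [M M0 hM]] h e e0; have [|N hN] := h (e / (M + 1)).
  by rewrite divr_gt0//; lra.
exists N => n /hN; rewrite ltr_pdivlMr; last lra.
rewrite -linB//; have := hM (u n - l); have := rn_ge0 (u n - l); nra.
Qed.

Lemma adjoint_uniq (V W : innerProductType C) (A : V -> W) y v :
  (forall x, dot (A x) y = dot x v) -> adjoint A y = v.
Proof.
move=> h; apply: xget_unique => // v' hv'.
by apply: dot_inj => z; rewrite -hv' h.
Qed.

Lemma adjoint_dot (V W : innerProductType C) (A : V -> W) :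
  completeV V -> bounded_op A -> forall x y, dot (A x) y = dot x (adjoint A y).
Proof.
move=> cV /bounded_opP[lA [M M0 hM]] x y.
suff [v hv] : exists v, forall x, dot (A x) y = dot x v.
  by rewrite (adjoint_uniq hv) hv.
apply: (@riesz _ (fun x => dot (A x) y) (M * rn y)) => //.
  by move=> a z t; rewrite lA dotDl dotZl.
move=> z; have := dot_CS (A z) y; have := hM z; have := rn_ge0 y; nra.
Qed.

Lemma dense_rangeP V (D : set V) :
  (forall v (e : R), 0 < e -> exists2 d, D d & rn (v - d) < e) -> dense D.
Proof.
move=> h O [v Ov] oO.
have /nbhs_ballP[_ /gt0C[e e0 ->] he] := open_nbhs_nbhs (conj oO Ov).
have [d Dd hd] := h v e e0; exists d; split=> //; apply: he.
by rewrite -ball_normE /= rnE ltcR.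
Qed.

End operators.
End InnerProduct.

(** * The Hardy space *)
Section Hardy.
Variable R : realType.
Local Notation C := R[i].
Local Notation H2 := (hardy R).
Implicit Types (f g h : H2) (z w l : C).

Lemma hcoefP (a : C) f g n : (a *: f + g : H2) n = a * f n + g n.
Proof. by []. Qed.
Lemma hcoefB f g n : (f - g : H2) n = f n - g n.
Proof. by []. Qed.
Lemma hcoefZ (a : C) f n : (a *: f : H2) n = a * f n.
Proof. by []. Qed.

Lemma hardy_ext f g : (forall n, f n = g n) -> f = g.
Proof. by move=> h; apply: val_inj; apply/funext. Qed.

Lemma dot_tends f g : tends (fun N => \sum_(n < N) f n * (g n)^*) (dot f g).
Proof.
have := is_cvg_inner (valP f) (valP g) => h.
apply: (tends_ext (u := series (fun n => f n * (g n)^* ))).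
  by move=> n; rewrite /series /= big_mkord.
by apply/(tendsP (V := C)).
Qed.

Lemma sumsq f N : \sum_(n < N) f n * (f n)^* = (\sum_(n < N) rn (f n) ^+ 2)%:C%C.
Proof.
rewrite (rmorph_sum (real_complex R)) /=; apply: eq_bigr => n _.
by rewrite mul_conj.
Qed.

Lemma sumsq_ge0 (I : Type) (r : seq I) (P : pred I) (F : I -> C) :
  0 <= \sum_(i <- r | P i) rn (F i) ^+ 2.
Proof. by rewrite sumr_ge0// => i _; rewrite sqr_ge0. Qed.

Lemma bessel f N : \sum_(n < N) rn (f n) ^+ 2 <= rn f ^+ 2.
Proof.
apply/ler_addgt0Pl => e e0.
have [M hM] := dot_tends f f e0.
have := hM (N + M)%N (leq_addl _ _); rewrite sumsq dotxx -rmorphB rnr.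
rewrite ltr_distl => /andP[_].
rewrite big_split_ord /= => h.
by have := sumsq_ge0 (index_enum 'I_M) xpredT (fun i => f (N + i)%N); rewrite -/(rn _); lra.
Qed.

Lemma hardy_rn_le f (M : R) : 0 <= M ->
  (forall N, \sum_(n < N) rn (f n) ^+ 2 <= M ^+ 2) -> rn f <= M.
Proof.
move=> M0 h; rewrite -(ler_pXn2r (n := 2)) ?nnegrE ?rn_ge0//.
have : rn (dot f f) <= M ^+ 2.
  apply: (tends_rn_le (dot_tends f f)) => N.
  by rewrite sumsq rnr ger0_norm// sumsq_ge0.
by rewrite dotxx rnr ger0_norm ?sqr_ge0.
Qed.

Lemma hardy_exists (a : nat -> C) (M : R) :
  (forall N, \sum_(n < N) rn (a n) ^+ 2 <= M) -> exists f : H2, forall n, f n = a n.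
Proof.
move=> h; suff aE : a \in @ell2 R by exists (Hardy aE).
apply/ell2P; apply: nneg_series_cvg => [n|]; first by rewrite exprn_ge0.
exists M%:C%C => n; rewrite /series /= big_mkord.
under eq_bigr do rewrite rnE -rmorphXn.
by rewrite -(rmorph_sum (real_complex R)) lecR.
Qed.

Lemma psum_tends f (z : C) : rn z < 1 ->
  tends (fun N => \sum_(n < N) f n * z ^+ n) (psum f z).
Proof.
rewrite -lt1C => z1; have h := @cvg_psum _ f _ z1; apply: (tends_ext (u := series (fun n => f n * z ^+ n))).
  by move=> n; rewrite /series /= big_mkord.
by apply/(tendsP (V := C)).
Qed.

Lemma psumPr (k : C) f g z : rn z < 1 ->
  psum (k *: f + g : H2) z = k * psum f z + psum g z.
Proof. by rewrite -lt1C; exact: psumP. Qed.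

Lemma psumB f g z : rn z < 1 -> psum (f - g : H2) z = psum f z - psum g z.
Proof.
by move=> z1; rewrite -[- g]scaleN1r addrC psumPr// mulN1r addrC.
Qed.

Lemma psumD f g z : rn z < 1 -> psum (f + g : H2) z = psum f z + psum g z.
Proof. by move=> z1; rewrite -(scale1r f) psumPr// mul1r scale1r. Qed.

Lemma psumZ k f z : rn z < 1 -> psum (k *: f : H2) z = k * psum f z.
Proof.
by move=> z1; rewrite -(addr0 (k *: f)) psumPr// psum0 ?lt1C// addr0.
Qed.

Lemma kern_ex (z : C) : exists g : H2, rn z < 1 -> forall n, g n = (z^* ) ^+ n.
Proof.
have [z1|_] := boolP (rn z < 1); last by exists 0.
have zE : (fun n => (z^* ) ^+ n) \in @ell2 R by rewrite pow_ell2// lt1C rn_conj.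
by exists (Hardy zE).
Qed.

(** The reproducing kernel of the Hardy space at [z], the Szego kernel. *)
Definition kern (z : C) : H2 := sval (cid (kern_ex z)).

Lemma kernE z n : rn z < 1 -> kern z n = (z^* ) ^+ n.
Proof. by move=> z1; exact: (svalP (cid (kern_ex z)) z1 n). Qed.

Lemma psum_dot f z : rn z < 1 -> psum f z = dot f (kern z).
Proof.
move=> z1; apply: (tends_uniq (psum_tends f z1)).
apply: tends_ext (dot_tends f (kern z)) => N.
by apply: eq_bigr => n _; rewrite kernE// rmorphXn /= conjCK.
Qed.

Lemma bshift_ex f : exists g : H2, forall n, g n = f n.+1.
Proof.
apply: (@hardy_exists (fun n => f n.+1) (rn f ^+ 2)) => N.
apply: le_trans (bessel f N.+1).
by rewrite [leRHS]big_ord_recl /= lerDr sqr_ge0.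
Qed.

Lemma fshift_ex f : exists g : H2, forall n, g n = if n is m.+1 then f m else 0.
Proof.
apply: (@hardy_exists (fun n => if n is m.+1 then f m else 0) (rn f ^+ 2)).
case=> [|N]; first by rewrite big_ord0 sqr_ge0.
rewrite big_ord_recl /= rn0 expr0n add0r; exact: bessel.
Qed.

Definition bshift f : H2 := sval (cid (bshift_ex f)).
Definition fshift f : H2 := sval (cid (fshift_ex f)).

Lemma bshiftE f n : bshift f n = f n.+1.
Proof. exact: svalP (cid (bshift_ex f)) n. Qed.

Lemma fshiftE f n : fshift f n = if n is m.+1 then f m else 0.
Proof. exact: svalP (cid (fshift_ex f)) n. Qed.

Lemma bshift_fshift f : bshift (fshift f) = f.
Proof. by apply: hardy_ext => n; rewrite bshiftE fshiftE. Qed.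

Lemma rn_bshift f : rn f ^+ 2 = rn (f 0%N) ^+ 2 + rn (bshift f) ^+ 2.
Proof.
apply: complexI; rewrite rmorphD /= -!dotxx.
apply: (tends_uniq (tends_S (dot_tends f f))).
apply: (tends_ext (u := fun N => (rn (f 0%N) ^+ 2)%:C%C
    + \sum_(n < N) bshift f n * (bshift f n)^* )).
  move=> N; rewrite big_ord_recl /= mul_conj; congr (_ + _).
  by apply: eq_bigr => n _; rewrite bshiftE.
by apply: tendsD (dot_tends _ _); exact: tends_cst.
Qed.

Lemma rn_bshift_le f : rn (bshift f) <= rn f.
Proof.
by rewrite -(ler_pXn2r (n := 2)) ?nnegrE ?rn_ge0// (rn_bshift f) lerDr sqr_ge0.
Qed.

Lemma rn_fshift f : rn (fshift f) = rn f.
Proof.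
apply/eqP; rewrite -(eqrXn2 (n := 2)) ?rn_ge0// rn_bshift bshift_fshift fshiftE rn0 expr0n add0r.
by [].
Qed.

Lemma dot_fshift f g : dot (fshift f) g = dot f (bshift g).
Proof.
apply: (tends_uniq (tends_S (dot_tends (fshift f) g))).
apply: tends_ext (dot_tends f (bshift g)) => N.
rewrite big_ord_recl /= (fshiftE f 0) mul0r add0r; apply: eq_bigr => n _.
by rewrite fshiftE bshiftE.
Qed.

Lemma psum_bshift f z : rn z < 1 -> psum f z = f 0%N + z * psum (bshift f) z.
Proof.
move=> z1; apply: (tends_uniq (tends_S (psum_tends f z1))).
apply: (tends_ext (u := fun N => f 0%N + z * \sum_(n < N) bshift f n * z ^+ n)).
  move=> N; rewrite big_ord_recl /= expr0 mulr1; congr (_ + _).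
  by rewrite mulr_sumr; apply: eq_bigr => n _; rewrite bshiftE exprS mulrCA.
by apply: tendsD; [exact: tends_cst|apply: tendsMl; exact: psum_tends].
Qed.

Lemma psum_fshift f z : rn z < 1 -> psum (fshift f) z = z * psum f z.
Proof. by move=> z1; rewrite psum_bshift// fshiftE bshift_fshift add0r. Qed.

Lemma psum_at0 f : psum f 0 = f 0%N.
Proof. by rewrite psum_bshift ?rn0// mul0r addr0. Qed.

(** Values of the backward shifts are the remainders of the Taylor series. *)
Lemma psum_tail K f z : rn z < 1 ->
  psum f z = \sum_(n < K) f n * z ^+ n + z ^+ K * psum (iter K bshift f) z.
Proof.
move=> z1; elim: K f => [|K IH] f; first by rewrite big_ord0 expr0 mul1r add0r.
rewrite psum_bshift// IH big_ord_recl /= expr0 mulr1 mulrDr addrA -iterSr /=.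
congr (_ + _ + _); last by rewrite exprS mulrA.
rewrite mulr_sumr; apply: eq_bigr => n _.
by rewrite bshiftE exprS mulrCA.
Qed.

Lemma rn_iter_bshift K f : rn (iter K bshift f) <= rn f.
Proof. by elim: K => //= K IH; rewrite (le_trans (rn_bshift_le _)). Qed.

Lemma psum_kern l z : rn l < 1 -> rn z < 1 -> psum (kern l) z = 1 / (1 - l^* * z).
Proof.
move=> l1 z1; have := psum_bshift (kern l) z1.
have -> : bshift (kern l) = l^* *: kern l.
  by apply: hardy_ext => n; rewrite bshiftE hcoefZ !kernE// exprS.
rewrite psumZ// kernE// expr0 => h.
have w0 : 1 - l^* * z != 0.
  rewrite subr_eq0; apply/eqP => /(congr1 (@rn R C)).
  rewrite rn1 rnM rn_conj => /esym/eqP; apply/negP; rewrite lt_eqF//.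
  by rewrite mulr_ilt1 ?rn_ge0.
by apply: (canRL (mulfK w0)); rewrite mulrBr mulr1 {1}h; ring.
Qed.

Lemma rn_kern l : rn l < 1 -> rn (kern l) ^+ 2 = (1 - rn l ^+ 2)^-1.
Proof.
move=> l1; apply: complexI; rewrite -dotxx -psum_dot// psum_kern// div1r.
by rewrite mulrC mul_conj -[1]/(1%:C%C) -rmorphB fmorphV.
Qed.

Lemma kern_gt0 l : rn l < 1 -> 0 < rn (kern l).
Proof.
move=> l1; rewrite lt_def rn_ge0 andbT -sqrf_eq0 rn_kern// invr_eq0 subr_eq0.
by rewrite eq_sym lt_eqF// expr_lt1// rn_ge0.
Qed.

Lemma rn_psum f z : rn z < 1 -> rn (psum f z) <= rn f * rn (kern z).
Proof. by move=> z1; rewrite psum_dot//; exact: dot_CS. Qed.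

Lemma kern_half z : rn z <= 2^-1 -> rn (kern z) <= 2.
Proof.
move=> h; have z0 := rn_ge0 z; have z1 : rn z < 1 by lra.
rewrite -(ler_pXn2r (n := 2)) ?nnegrE ?rn_ge0// rn_kern//.
rewrite invf_ple ?posrE; nra.
Qed.

Lemma tends_psum (u : nat -> H2) f z : rn z < 1 -> tends u f ->
  tends (fun n => psum (u n) z) (psum f z).
Proof.
move=> z1 /(tends_dotl (kern z)); rewrite psum_dot//.
by apply: tends_ext => n; rewrite psum_dot.
Qed.

(** By induction on the coefficient: the constant term is the value at 0, and
    the remaining coefficients are those of (f - f(0)) / z, which converges
    pointwise away from 0 and, by equicontinuity, at 0 as well. *)
Lemma coef_cauchy n (h : nat -> H2) (M : R) : (forall N, rn (h N) <= M) ->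
  (forall z : C, rn z < 1 -> cauchyseq (fun N => psum (h N) z)) ->
  cauchyseq (fun N => h N n).
Proof.
elim: n h => [|n IH] h hM hc.
  move=> e /(hc 0 ltac:(by rewrite rn0))[N hN]; exists N => m k p q.
  by have := hN m k p q; rewrite !psum_at0.
have h0 : cauchyseq (fun N => h N 0%N).
  move=> e /(hc 0 ltac:(by rewrite rn0))[N hN]; exists N => m k p q.
  by have := hN m k p q; rewrite !psum_at0.
have [c0 hc0] := C_complete h0.
have M0 : 0 <= M by rewrite (le_trans (rn_ge0 (h 0%N))).
have cz z : rn z < 1 -> z != 0 -> cauchyseq (fun N => psum (bshift (h N)) z).
  move=> z1 z0; have [c hcz] := C_complete (hc z z1).
  apply: (tends_cauchy (l := z^-1 * (c - c0))).
  apply: (tends_ext (u := fun N => z^-1 * (psum (h N) z - h N 0%N))).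
    by move=> N; rewrite psum_bshift// addrC addKr mulKf.
  by apply: tendsMl; exact: tendsB.
have : cauchyseq (fun N => bshift (h N) n); last first.
  by move=> H e /H[N hN]; exists N => m k p q; have := hN m k p q; rewrite !bshiftE.
apply: IH => [N|z z1]; first exact: le_trans (rn_bshift_le _) (hM _).
have [->|z0] := eqVneq z 0; last exact: cz.
(* The values at 0 are compared with those at a nearby point t > 0, where
   convergence is known already. *)
move=> e e0; pose t : R := Num.min 2^-1 (e / (8 * (M + 1))).
have t0 : 0 < t by rewrite lt_min invr_gt0 ltr0n divr_gt0// mulr_gt0//; lra.
have t1 : t <= 2^-1 by rewrite ge_min lexx.
have t2 : t * (8 * (M + 1)) <= e.
  by rewrite -ler_pdivlMr ?ge_min ?lexx ?orbT// mulr_gt0//; lra.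
clearbody t; have tM : 2 * t * M * 2 <= e / 2 by lra.
have rt : rn (t%:C%C : C) = t by rewrite rnr gtr0_norm.
have w1 : rn (t%:C%C : C) < 1 by rewrite rt; lra.
have w0 : (t%:C%C : C) != 0 by rewrite (inj_eq (@complexI R)) gt_eqF.
have [|N hN] := cz _ w1 w0 (e / 2); first lra.
have close m : rn (psum (bshift (h m)) 0 - psum (bshift (h m)) t%:C%C) <= 2 * t * M.
  rewrite psum_at0 (psum_bshift (bshift (h m)) w1) opprD addNKr rnN rnM rt.
  have := rn_psum (bshift (bshift (h m))) w1; have := @kern_half t%:C%C; rewrite rt => /(_ t1).
  have := le_trans (rn_bshift_le _) (le_trans (rn_bshift_le _) (hM m)).
  have := rn_ge0 (bshift (bshift (h m))); have := rn_ge0 (kern t%:C%C).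
  set p := rn (kern _); set q := rn (bshift _); set s := rn (psum _ _) => p0 q0 qM p2 sle.
  have sM : s <= 2 * M by nra.
  by have := rn_ge0 (psum (bshift (bshift (h m))) t%:C%C); rewrite -/s; nra.
have key (a b c d : C) : rn (a - b) <= 2 * t * M -> rn (d - c) <= 2 * t * M ->
    rn (b - c) < e / 2 -> rn (a - d) < e.
  have := rn_tri b a d; have := rn_tri c b d; rewrite (rnBC c d); lra.
by exists N => m k p q; exact: key (close m) (close k) (hN m k p q).
Qed.

(** The sequence f, g, f, g, ... converges pointwise on the disc, so its
    coefficients form a Cauchy sequence. *)
Lemma psum_inj f g : (forall z, rn z < 1 -> psum f z = psum g z) -> f = g.
Proof.
move=> fg; apply: hardy_ext => n.
have H : cauchyseq (fun N => (if odd N then f else g) n).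
  apply: (@coef_cauchy n (fun N => if odd N then f else g) (rn f + rn g)).
    by move=> N; case: ifP => _; rewrite ?lerDl ?lerDr rn_ge0.
  move=> z z1 e e0; exists 0%N => m k _ _.
  by case: ifP => _; case: ifP => _; rewrite ?fg// subrr rn0.
apply/eqP; rewrite -subr_eq0; apply/negPn/negP => /rn_gt0 /H[N hN].
have := hN (N.*2.+1) (N.*2) ltac:(by rewrite -addnn leqW// leq_addr) ltac:(by rewrite -addnn leq_addr).
by rewrite /= odd_double /= ltxx.
Qed.

(** Compactness of balls of H^2: the limit has the coefficientwise limits as
    coefficients, and at a fixed point of the disc the tails of the Taylor
    series are uniformly small. *)
Lemma hardy_limit (h : nat -> H2) (phi : C -> C) (M : R) :
  (forall N, rn (h N) <= M) ->
  (forall z, rn z < 1 -> tends (fun N => psum (h N) z) (phi z)) ->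
  exists2 f : H2, rn f <= M & forall z, rn z < 1 -> psum f z = phi z.
Proof.
move=> hM hphi.
have M0 : 0 <= M by rewrite (le_trans (rn_ge0 (h 0%N))).
have /choice[c hc] n : exists c, tends (fun N => h N n) c.
  by apply: C_complete; apply: coef_cauchy hM _ => z z1; exact: tends_cauchy (hphi z z1).
have cM K : \sum_(n < K) rn (c n) ^+ 2 <= M ^+ 2.
  have E : \sum_(n < K) c n * (c n)^* = (\sum_(n < K) rn (c n) ^+ 2)%:C%C.
    by rewrite (rmorph_sum (real_complex R)) /=; apply: eq_bigr => n _; rewrite mul_conj.
  rewrite -[leLHS]ger0_norm ?sumsq_ge0// -rnr -E.
  apply: (@tends_rn_le _ _ (fun N => \sum_(n < K) h N n * (h N n)^* )).
    apply: (@tends_sum _ _ _ (fun n N => h N n * (h N n)^* ) (fun n => c n * (c n)^* )) => k _.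
    by apply: tendsM => //; exact: tends_conj.
  move=> N; rewrite sumsq rnr ger0_norm ?sumsq_ge0//.
  by rewrite (le_trans (bessel _ _))// ler_pXn2r ?nnegrE ?rn_ge0.
have [f fc] := hardy_exists cM.
have fM : rn f <= M by apply: hardy_rn_le => // N; under eq_bigr do rewrite fc.
exists f => // z z1; apply: tends_uniq (hphi z z1) => e e0.
have k0 := kern_gt0 z1.
have [K hK] : exists K, rn z ^+ K * (2 * M * rn (kern z)) < e / 2.
  have := @cvg_expr R (rn z); rewrite ger0_norm ?rn_ge0// => /(_ z1).
  move=> /cvgrPdist_lt/(_ (e / 2 / (2 * M * rn (kern z) + 1))).
  rewrite divr_gt0 ?ltr_pwDr ?mulr_ge0 ?rn_ge0//; last lra.
  move=> /(_ isT)[N _ /(_ N (leqnn _))]; rewrite sub0r normrN ger0_norm ?exprn_ge0 ?rn_ge0//.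
  rewrite ltr_pdivlMr ?ltr_pwDr ?mulr_ge0 ?rn_ge0// => hN; exists N.
  by rewrite (le_lt_trans _ hN)// ler_wpM2l ?exprn_ge0 ?rn_ge0// lerDl.
have : tends (fun N => \sum_(n < K) (h N n - f n) * z ^+ n) (\sum_(n < K) (0 * z ^+ n)).
  apply: (@tends_sum _ _ _ (fun n N => (h N n - f n) * z ^+ n) (fun n => 0 * z ^+ n)) => k _.
  apply: tendsM; last exact: tends_cst.
  by rewrite -(subrr (f k)); apply: tendsB; [rewrite fc; exact: hc|exact: tends_cst].
rewrite big1; last by move=> i _; rewrite mul0r.
move=> /(_ (e / 2) ltac:(lra))[N hN]; exists N => n Nn.
rewrite -psumB// (psum_tail K)// (le_lt_trans (rnD _ _))//.
have h1 := hN n Nn; rewrite subr0 in h1.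
rewrite [e]splitr; apply: ltr_leD => //.
rewrite (le_trans _ (ltW hK))// rnM rnX ler_wpM2l ?exprn_ge0 ?rn_ge0//.
rewrite (le_trans (rn_psum _ z1))// ler_wpM2r ?rn_ge0// (le_trans (rn_iter_bshift _ _))//.
by rewrite mulr_natl mulr2n (le_trans (rnB _ _))// lerD.
Qed.

Lemma hardy_complete : completeV H2.
Proof.
move=> u cu.
have cz z : rn z < 1 -> cauchyseq (fun n => psum (u n) z).
  move=> z1 e e0; have k0 := kern_gt0 z1; have [|N hN] := cu (e / rn (kern z)).
    by rewrite divr_gt0.
  exists N => m n p q; rewrite -psumB// (le_lt_trans (rn_psum _ z1))//.
  by rewrite -ltr_pdivlMr// hN.
have [M M0 hM] := cauchy_bounded cu.
have hl z : rn z < 1 -> tends (fun n => psum (u n) z) (limn (fun n => psum (u n) z)).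
  by move=> z1; have [l hl] := C_complete (cz z z1); rewrite (tends_lim hl).
have [f _ hf] := hardy_limit hM hl.
exists f => e e0; have [|N hN] := cu (e / 2); first lra.
exists N => n Nn.
have [|z z1|g g_le hg] := @hardy_limit (fun m => u n - u (N + m)%N) (fun z => psum (u n) z - psum f z) (e / 2).
- by move=> m; rewrite ltW// hN// leq_addr.
- apply: (tends_ext (u := fun m => psum (u n) z - psum (u (N + m)%N) z)).
    by move=> m; rewrite psumB.
  apply: tendsB; first exact: tends_cst.
  move=> d /(hl z z1)[K hK]; exists K => m Km; rewrite hf//.
  by apply: hK; rewrite (leq_trans Km)// leq_addl.
have <- : g = u n - f by apply: psum_inj => z z1; rewrite hg// psumB.
by rewrite (le_lt_trans g_le)//; lra.
Qed.

(** * Functions determined by their values on the disc *)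
Lemma hardy_ofE (phi : C -> C) f : (forall z, rn z < 1 -> psum f z = phi z) ->
  hardy_of phi = f.
Proof.
move=> h; apply: xget_unique => [z|g hg]; first by rewrite lt1C; exact: h.
by apply: psum_inj => z z1; rewrite h// hg// lt1C.
Qed.

Lemma mulopE (phi : C -> C) f g :
  (forall z, rn z < 1 -> psum g z = phi z * psum f z) -> mulop phi f = g.
Proof. by move=> h; apply: hardy_ofE. Qed.

Lemma ushiftE f : ushift f = fshift f.
Proof. by apply: mulopE => z z1; rewrite psum_fshift. Qed.

Lemma szegoE l : rn l < 1 -> szego l = kern l.
Proof. by move=> l1; apply: hardy_ofE => z z1; exact: psum_kern. Qed.

Lemma fshift_linear : linear fshift.
Proof.
by move=> a f g; apply: hardy_ext => -[|n]; rewrite hcoefP 3!fshiftE // mulr0 addr0.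
Qed.

End Hardy.

(** * Polynomials at roots of unity *)
Section Multipliers.
Variable R : realType.
Local Notation C := R[i].
Local Notation H2 := (hardy R).
Implicit Types (f g h : H2) (z w l : C) (p q : {poly C}).

Lemma root_of_unity_exists N : (0 < N)%N -> {w : C | N.-primitive_root w}.
Proof.
move=> N0; pose p : {poly C} := 'X^N - 1.
have [r Dp] := closed_field_poly_normal p; apply/sigW.
rewrite (monicP _) ?monicXnsubC// scale1r in Dp.
have rn1 : all N.-unity_root r by apply/allP=> z; rewrite -root_prod_XsubC -Dp.
have sz_r : (N < (size r).+1)%N by rewrite -(size_prod_XsubC r id) -Dp size_XnsubC.
have [|z] := hasP (cyclic.has_prim_root N0 rn1 _ sz_r); last by exists z.
rewrite -separable.separable_prod_XsubC -Dp cyclotomic.separable_Xn_sub_1 // pnatr_eq0.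
by rewrite -lt0n.
Qed.

Lemma rn_unity_root (w : C) N : (0 < N)%N -> w ^+ N = 1 -> rn w = 1.
Proof.
move=> N0 /(congr1 (@rn R C)); rewrite rnX rn1 => /eqP.
by rewrite pexpr_eq1 ?rn_ge0// => /eqP.
Qed.

Lemma sum_unity_root (u : C) N : u ^+ N = 1 -> u != 1 -> \sum_(j < N) u ^+ j = 0.
Proof.
move=> uN u1; have := subrX1 u N; rewrite uN subrr => /esym/eqP.
by rewrite mulf_eq0 subr_eq0 (negPf u1) => /eqP.
Qed.

(** Summing over the roots of unity annihilates the cross terms, the exponents
    being less than [N]. *)
Lemma parseval_unity p N (w : C) : (size p <= N)%N -> N.-primitive_root w ->
  \sum_(j < N) rn p.[w ^+ j] ^+ 2 = N%:R * \sum_(i < N) rn p`_i ^+ 2.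
Proof.
move=> sp wN; have N0 := prim_order_gt0 wN.
have w1 : rn w = 1 by exact: rn_unity_root (prim_expr_order wN).
have w0 : w != 0 by apply/eqP => w0; move: w1; rewrite w0 rn0 => /esym/eqP; rewrite oner_eq0.
have wc : w^* = w^-1.
  by apply: (mulfI w0); rewrite mul_conj w1 expr1n divff.
apply: complexI; rewrite rmorphM /= !(rmorph_sum (real_complex R)) /=.
under eq_bigr do rewrite -mul_conj.
under [in RHS]eq_bigr do rewrite -mul_conj.
transitivity (\sum_(j < N) \sum_(i < N) \sum_(k < N)
    p`_i * (p`_k)^* * (w ^+ i / w ^+ k) ^+ j).
  apply: eq_bigr => j _; rewrite (horner_coef_wide _ sp) rmorph_sum /= big_distrlr /=.
  apply: eq_bigr => i _; apply: eq_bigr => k _.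
  rewrite rmorphM !rmorphXn /= wc mulrACA; congr (_ * _).
  by rewrite expr_div_n -!exprM (mulnC j i) (mulnC j k) exprVn.
rewrite exchange_big /= rmorph_nat mulr_sumr; apply: eq_bigr => i _.
rewrite exchange_big /= (bigD1 i)//= [X in _ + X]big1 ?addr0.
  under eq_bigr do rewrite divff ?expf_neq0// expr1n mulr1.
  by rewrite sumr_const card_ord mulr_natl.
move=> k ki; rewrite -mulr_sumr sum_unity_root ?mulr0//.
  by rewrite expr_div_n -!exprM !(mulnC _ N) !exprM (prim_expr_order wN) !expr1n divr1.
apply/eqP => /(canRL (divfK (expf_neq0 _ w0))); rewrite mul1r => /eqP.
rewrite (eq_prim_root_expr wN) !modn_small// => /eqP ik.
by move/eqP: ki; apply; apply: val_inj.
Qed.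

(** * Polynomials as elements of H^2 *)
Lemma hpoly_ex p : exists f : H2, forall n, f n = p`_n.
Proof.
apply: (@hardy_exists _ (fun n => p`_n) (\sum_(n < size p) rn p`_n ^+ 2)) => N.
have [Np|pN] := leqP N (size p).
  rewrite -(subnKC Np) [leRHS]big_split_ord /= lerDl; exact: sumsq_ge0.
rewrite -(subnKC (ltnW pN)) big_split_ord /= [X in _ + X]big1 ?addr0// => i _.
by rewrite nth_default ?leq_addr// rn0 expr0n.
Qed.

Definition hpoly p : H2 := sval (cid (hpoly_ex p)).

Lemma hpolyE p n : hpoly p n = p`_n.
Proof. exact: svalP (cid (hpoly_ex p)) n. Qed.

Lemma psum_hpoly p z : rn z < 1 -> psum (hpoly p) z = p.[z].
Proof.
move=> z1; apply: (tends_uniq (psum_tends (hpoly p) z1)).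
apply: (tends_near (u := fun=> p.[z])); last exact: tends_cst.
exists (size p) => n pn; rewrite (horner_coef_wide _ pn).
by apply: eq_bigr => i _; rewrite hpolyE.
Qed.

Lemma rn_hpoly p N : (size p <= N)%N -> rn (hpoly p) ^+ 2 = \sum_(i < N) rn p`_i ^+ 2.
Proof.
move=> pN; apply: complexI; rewrite -dotxx.
apply: (tends_uniq (dot_tends (hpoly p) (hpoly p))).
apply: (tends_near (u := fun=> (\sum_(i < N) rn p`_i ^+ 2)%:C%C)); last exact: tends_cst.
exists N => n Nn; rewrite sumsq; congr (_%:C%C).
rewrite -(subnKC Nn) [RHS]big_split_ord /= [X in _ + X]big1 ?addr0.
  by apply: eq_bigr => i _; rewrite hpolyE.
move=> i _; rewrite hpolyE nth_default ?rn0 ?expr0n//.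
by rewrite (leq_trans pN)// leq_addr.
Qed.

(** Sampling at the roots of unity of a large order, where the norm is a mean of
    squared values, makes multiplication by a bounded factor visibly bounded. *)
Lemma hpoly_mul_le p q (M : R) : (forall z, rn z <= 1 -> rn p.[z] <= M) ->
  rn (hpoly (p * q)) <= M * rn (hpoly q).
Proof.
move=> hM; have M0 : 0 <= M by rewrite (le_trans (rn_ge0 _) (hM 0 _))// rn0.
pose N := (size p + size q).+1.
have s1 : (size (p * q)%R <= N)%N.
  by rewrite (leq_trans (size_polyMleq _ _))// /N (leq_trans (leq_pred _)).
have s2 : (size q <= N)%N by rewrite /N leqW// leq_addl.
have [w wN] := @root_of_unity_exists N isT.
have w1 : rn w = 1 by exact: rn_unity_root (prim_expr_order wN).
rewrite -(ler_pXn2r (n := 2)) ?nnegrE ?mulr_ge0 ?rn_ge0// exprMn.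
rewrite (rn_hpoly s1) (rn_hpoly s2).
have N0 : 0 < N%:R :> R by rewrite ltr0n.
rewrite -(ler_pM2l N0) mulrCA -!(parseval_unity _ wN)// mulr_sumr.
apply: ler_sum => j _; rewrite hornerM rnM exprMn ler_wpM2r ?sqr_ge0//.
by rewrite ler_pXn2r ?nnegrE ?rn_ge0// hM// rnX w1 expr1n.
Qed.

(** * Multipliers of H^2 *)
(** Stated through the values on the disc, so that it asserts the existence of
    the product in H^2, on which the definition of [mulop] by choice depends. *)
Definition mult (phi : C -> C) (M : R) := forall f, exists h,
  rn h <= M * rn f /\ forall z, rn z < 1 -> psum h z = phi z * psum f z.

Lemma mult_ext phi psi M : (forall z, rn z < 1 -> phi z = psi z) ->
  mult phi M -> mult psi M.
Proof.
move=> E H f; have [h [h1 h2]] := H f; exists h; split=> // z z1.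
by rewrite h2// E.
Qed.

Lemma mult_weaken phi M M' : M <= M' -> mult phi M -> mult phi M'.
Proof.
move=> E H f; have [h [h1 h2]] := H f; exists h; split=> //.
by rewrite (le_trans h1)// ler_wpM2r ?rn_ge0.
Qed.

Lemma mult_limit (phi : nat -> C -> C) psi M : (forall n, mult (phi n) M) ->
  (forall z, rn z < 1 -> tends (fun n => phi n z) (psi z)) -> mult psi M.
Proof.
move=> H hl f; have /choice[h hh] := fun n => H n f.
have [|z z1|g g1 g2] := @hardy_limit _ h (fun z => psi z * psum f z) (M * rn f).
- by move=> n; have [] := hh n.
- apply: (tends_ext (u := fun n => phi n z * psum f z)).
    by move=> n; have [_ ->] := hh n.
  by apply: tendsM; [exact: hl|exact: tends_cst].
by exists g.
Qed.

Lemma mult_eps phi M : (forall e, 0 < e -> mult phi (M + e)) -> mult phi M.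
Proof.
move=> H f; have [h [h1 h2]] := H 1 ltr01 f; exists h; split=> //.
apply/ler_addgt0Pl => e e0.
have [g [g1 g2]] := H (e / (rn f + 1)) ltac:(by rewrite divr_gt0// ltr_pwDr// rn_ge0) f.
have <- : g = h by apply: psum_inj => z z1; rewrite h2 ?g2.
rewrite (le_trans g1)// mulrDl addrC lerD2r mulrAC ler_pdivrMr ?ltr_pwDr ?rn_ge0//.
by have := rn_ge0 f; nra.
Qed.

Lemma multM phi psi M N : 0 <= M -> mult phi M -> mult psi N ->
  mult (fun z => phi z * psi z) (M * N).
Proof.
move=> M0 H1 H2 f; have [g [g1 g2]] := H2 f; have [h [h1 h2]] := H1 g.
exists h; split=> [|z z1]; last by rewrite h2// g2// mulrA.
by rewrite (le_trans h1)// -mulrA ler_wpM2l.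
Qed.

Lemma mult_mulop phi M f : mult phi M ->
  rn (mulop phi f) <= M * rn f /\
  forall z, rn z < 1 -> psum (mulop phi f) z = phi z * psum f z.
Proof. by move=> /(_ f)[h [h1 h2]]; rewrite (mulopE h2). Qed.

Lemma mult_linear phi M : mult phi M -> linear (mulop phi : H2 -> H2).
Proof.
move=> H a f g; apply: mulopE => z z1.
rewrite !psumPr// (mult_mulop f H).2// (mult_mulop g H).2//; ring.
Qed.

Lemma mulop_comm phi psi M N f : mult phi M -> mult psi N ->
  mulop phi (mulop psi f) = mulop psi (mulop phi f).
Proof.
move=> H1 H2; apply: mulopE => z z1.
by rewrite (mult_mulop _ H2).2// (mult_mulop _ H1).2// (mult_mulop _ H2).2// mulrCA.
Qed.

Lemma trunc_tends f z : rn z < 1 ->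
  tends (fun N => (\poly_(i < N) f i).[z]) (psum f z).
Proof.
move=> z1; apply: tends_ext (psum_tends f z1) => N; rewrite horner_poly.
by [].
Qed.

Lemma mult_poly p (M : R) : (forall z, rn z <= 1 -> rn p.[z] <= M) ->
  mult (fun z => p.[z]) M.
Proof.
move=> hM f; have M0 : 0 <= M by rewrite (le_trans (rn_ge0 _) (hM 0 _))// rn0.
have [|z z1|g g1 g2] := @hardy_limit _ (fun N => hpoly (p * \poly_(i < N) f i))
    (fun z => p.[z] * psum f z) (M * rn f).
- move=> N; rewrite (le_trans (hpoly_mul_le _ hM))// ler_wpM2l//.
  rewrite -(ler_pXn2r (n := 2)) ?nnegrE ?rn_ge0// (rn_hpoly (size_poly _ _)).
  rewrite (le_trans _ (bessel f N))// ler_sum// => i _.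
  by rewrite coef_poly ltn_ord.
- apply: (tends_ext (u := fun N => p.[z] * (\poly_(i < N) f i).[z])).
    by move=> N; rewrite psum_hpoly// hornerM.
  by apply: tendsMl; exact: trunc_tends.
by exists g.
Qed.

(** * Division by z - w and dilations *)
Lemma coef_iter_bshift m f n : iter m (@bshift R) f n = f (m + n)%N.
Proof. by elim: m n => //= m IH n; rewrite bshiftE IH addSnnS. Qed.

(** The coefficients of the quotient are the values at [w] of the iterated
    backward shifts; their recursion contracts by |w| < 1, which makes them
    square summable. *)
Lemma hardy_divide f w : rn w < 1 -> exists q : H2, forall z, rn z < 1 ->
  psum f z = psum f w + (z - w) * psum q z.
Proof.
move=> w1; set r := rn w; have r0 : 0 <= r := rn_ge0 w.
pose a n := psum (iter n.+1 (@bshift R) f) w.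
have aS n : a n = f n.+1 + w * a n.+1.
  rewrite /a psum_bshift//=; congr (_ + _); by rewrite bshiftE coef_iter_bshift addn1.
have aK n : rn (a n) <= rn f * rn (kern w).
  by rewrite (le_trans (rn_psum _ w1))// ler_wpM2r ?rn_ge0// rn_iter_bshift.
set K := rn f * rn (kern w) in aK.
have K0 : 0 <= K by rewrite mulr_ge0// rn_ge0.
have step n : rn (a n) ^+ 2 <= rn (f n.+1) ^+ 2 / (1 - r) + r * rn (a n.+1) ^+ 2.
  have : rn (a n) <= rn (f n.+1) + r * rn (a n.+1) by rewrite {1}aS (le_trans (rnD _ _))// rnM.
  move: (rn (a n)) (rn (f n.+1)) (rn (a n.+1)) (rn_ge0 (a n)) (rn_ge0 (f n.+1)) (rn_ge0 (a n.+1)).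
  move=> x y t x0 y0 t0 h; apply: (@le_trans _ _ ((y + r * t) ^+ 2)); first by rewrite ler_pXn2r ?nnegrE// addr_ge0// mulr_ge0.
  rewrite -subr_ge0; have -> : y ^+ 2 / (1 - r) + r * t ^+ 2 - (y + r * t) ^+ 2
      = r / (1 - r) * (y - (1 - r) * t) ^+ 2 by field; lra.
  by rewrite mulr_ge0 ?sqr_ge0// divr_ge0//; lra.
have [q qa] : exists q : H2, forall n, q n = a n.
  apply: (@hardy_exists _ a ((rn f ^+ 2 / (1 - r) + r * K ^+ 2) / (1 - r))) => N.
  set S := \sum_(n < N) _.
  have S1 : \sum_(n < N) rn (a n.+1) ^+ 2 <= S + K ^+ 2.
    have E : rn (a 0%N) ^+ 2 + \sum_(n < N) rn (a n.+1) ^+ 2 = S + rn (a N) ^+ 2.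
      by rewrite /S; transitivity (\sum_(n < N.+1) rn (a n) ^+ 2); [rewrite big_ord_recl|rewrite big_ord_recr].
    have : rn (a N) ^+ 2 <= K ^+ 2 by rewrite ler_pXn2r ?nnegrE ?rn_ge0.
    by have := sqr_ge0 (rn (a 0%N)); lra.
  have S2 : S <= (\sum_(n < N) rn (f n.+1) ^+ 2) / (1 - r) + r * \sum_(n < N) rn (a n.+1) ^+ 2.
    by rewrite mulr_suml mulr_sumr -big_split /=; apply: ler_sum => n _; exact: step.
  have S3 : \sum_(n < N) rn (f n.+1) ^+ 2 <= rn f ^+ 2.
    by have := bessel f N.+1; rewrite big_ord_recl /=; have := sqr_ge0 (rn (f 0%N)); lra.
  have r1 : 0 < 1 - r by rewrite subr_gt0.
  have S4 : (\sum_(n < N) rn (f n.+1) ^+ 2) / (1 - r) <= rn f ^+ 2 / (1 - r).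
    by rewrite ler_pM2r ?invr_gt0.
  rewrite ler_pdivlMr//.
  move: S1 S2 S4; clear -r0; move: (\sum_(n < N) rn (a n.+1) ^+ 2) => T.
  move: (_ / (1 - r)) (_ / (1 - r)) => A B h1 h2 h3; nra.
exists q => z z1.
have E : f - psum f w *: kern 0 = fshift q - w *: q.
  apply: hardy_ext => -[|n]; rewrite 2!hcoefB 2!hcoefZ kernE ?rn0// fshiftE qa conjC0.
    by rewrite expr0 mulr1 sub0r {1}psum_bshift// -[psum (bshift f) w]/(a 0%N) opprD addNKr.
  by rewrite expr0n /= mulr0 subr0 qa aS addrK.
have := congr1 (fun h : H2 => psum h z) E.
rewrite !psumB// !psumZ// psum_kern ?rn0// conjC0 mul0r subr0 divr1 mulr1 psum_fshift//.
by move=> /eqP; rewrite subr_eq => /eqP ->; ring.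
Qed.

Lemma kern_mono w z : rn w <= rn z -> rn z < 1 -> rn (kern w) <= rn (kern z).
Proof.
move=> wz z1; have w1 := le_lt_trans wz z1; have w0 := rn_ge0 w.
rewrite -(ler_pXn2r (n := 2)) ?nnegrE ?rn_ge0// !rn_kern//.
by rewrite lef_pV2 ?posrE; nra.
Qed.

Definition dil_radius n : C := (1 - inv_succ R n)%:C%C.

Lemma rn_rad n : rn (dil_radius n) = 1 - inv_succ R n.
Proof. by rewrite rnr ger0_norm// subr_ge0 inv_succ_le1. Qed.

Lemma rad_lt1 n : rn (dil_radius n) < 1.
Proof. by rewrite rn_rad ltrBlDr ltrDl inv_succ_gt0. Qed.

Lemma rad_mul n z : rn (dil_radius n * z) <= rn z.
Proof. by rewrite rnM ler_piMl ?rn_ge0// ltW// rad_lt1. Qed.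

(** Dividing f - f(z) by the variable minus z gives a Lipschitz bound along the
    radius. *)
Lemma psum_radial f z : rn z < 1 -> tends (fun n => psum f (dil_radius n * z)) (psum f z).
Proof.
move=> z1; have [q hq] := hardy_divide f z1 => e e0.
have k0 := rn_ge0 (kern z); have q0 := rn_ge0 q.
have D0 : 0 < rn q * rn (kern z) + 1 by rewrite ltr_pwDr// mulr_ge0.
have [|N hN] := @inv_succ_small R (e / (rn q * rn (kern z) + 1)); first by rewrite divr_gt0.
exists N => n /hN; rewrite ltr_pdivlMr// => h.
have zn : rn (dil_radius n * z) < 1 by exact: le_lt_trans (rad_mul _ _) z1.
rewrite (hq _ zn) addrC addKr rnM (le_lt_trans _ h)//.
have -> : dil_radius n * z - z = - ((inv_succ R n)%:C%C * z) by rewrite /dil_radius rmorphB rmorph1; ring.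
rewrite rnN rnM rnr gtr0_norm ?inv_succ_gt0// -mulrA ler_wpM2l ?ltW ?inv_succ_gt0//.
have := rn_psum q zn; have := kern_mono (rad_mul n z) z1; have := rn_ge0 z.
have := rn_ge0 (kern (dil_radius n * z)); have := rn_ge0 (psum q (dil_radius n * z)); nra.
Qed.

Lemma pow_small (r K e : R) : 0 <= r < 1 -> 0 < e -> exists N, forall n, (N <= n)%N -> r ^+ n * K <= e.
Proof.
move=> /andP[r0 r1] e0.
have := @cvg_expr R r; rewrite ger0_norm// => /(_ r1).
move=> /cvgrPdist_lt/(_ (e / (`|K| + 1))).
rewrite divr_gt0 ?ltr_pwDr// => /(_ isT)[N _ h]; exists N => n /h.
rewrite /= sub0r normrN ger0_norm ?exprn_ge0// ltr_pdivlMr ?ltr_pwDr// => hn.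
rewrite (le_trans _ (ltW hn))// ler_wpM2l ?exprn_ge0//.
by rewrite (le_trans (ler_norm _))// lerDl.
Qed.

(** Dilating and truncating the Taylor series produces polynomials whose
    supremum on the disc exceeds the bound by an arbitrarily small amount. *)
Lemma bounded_mult h (M : R) : (forall z, rn z < 1 -> rn (psum h z) <= M) ->
  mult (psum h) M.
Proof.
move=> hM; apply: mult_eps => e e0.
apply: (@mult_limit (fun n z => psum h (dil_radius n * z))) => [j|z z1]; last exact: psum_radial.
set K := rn h * rn (kern (dil_radius j)).
have [|N hN] := @pow_small (rn (dil_radius j)) K e _ e0; first by rewrite rn_ge0 rad_lt1.
apply: (@mult_limit (fun n z => (\poly_(i < N + n) (h i * dil_radius j ^+ i)).[z])) => [n|z z1].
  apply: mult_poly => z z1.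
  have rz : rn (dil_radius j * z) <= rn (dil_radius j) by rewrite rnM ler_piMr ?rn_ge0.
  have rz1 : rn (dil_radius j * z) < 1 by rewrite (le_lt_trans rz) ?rad_lt1.
  have -> : (\poly_(i < N + n) (h i * dil_radius j ^+ i)).[z] = psum h (dil_radius j * z)
      - (dil_radius j * z) ^+ (N + n) * psum (iter (N + n) (@bshift R) h) (dil_radius j * z).
    rewrite (psum_tail (N + n) h rz1) addrK horner_poly; apply: eq_bigr => i _.
    by rewrite exprMn mulrA.
  rewrite (le_trans (rnB _ _))// lerD ?hM// rnM rnX.
  apply: le_trans (hN (N + n)%N (leq_addr _ _)); apply: ler_pM.
  - by rewrite exprn_ge0 ?rn_ge0.
  - exact: rn_ge0.
  - by rewrite lerXn2r ?nnegrE ?rn_ge0.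
  - rewrite (le_trans (rn_psum _ rz1))// ler_pM ?rn_ge0// ?rn_iter_bshift//.
    by apply: kern_mono => //; exact: rad_lt1.
have rz1 : rn (dil_radius j * z) < 1 by rewrite (le_lt_trans (rad_mul _ _)).
move=> d /(psum_tends h rz1)[L hL]; exists L => n Ln.
have := hL (N + n)%N (leq_trans Ln (leq_addl _ _)); rewrite horner_poly.
by under [in X in _ -> X]eq_bigr do rewrite -mulrA -exprMn.
Qed.

Lemma rn_kern0 : rn (kern 0 : H2) = 1.
Proof.
apply/eqP; rewrite -(eqrXn2 (n := 2)) ?rn_ge0// rn_kern ?rn0//.
by rewrite expr0n subr0 invr1 expr1n.
Qed.

Lemma psum_kern0 z : rn z < 1 -> psum (kern 0 : H2) z = 1.
Proof. by move=> z1; rewrite psum_kern ?rn0// conjC0 mul0r subr0 divr1. Qed.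

Lemma mult_hardy phi M : mult phi M ->
  exists2 h : H2, rn h <= M & forall z, rn z < 1 -> psum h z = phi z.
Proof.
move=> /(_ (kern 0))[h [h1 h2]]; rewrite rn_kern0 mulr1 in h1.
by exists h => // z z1; rewrite h2// psum_kern0// mulr1.
Qed.

Lemma rn_le_sup h (M : R) : (forall z, rn z < 1 -> rn (psum h z) <= M) -> rn h <= M.
Proof.
move=> /bounded_mult/mult_hardy[g g1 g2].
by have <- : g = h by apply: psum_inj => z z1; rewrite g2.
Qed.

Lemma mult_sup phi M M' : mult phi M -> (forall z, rn z < 1 -> rn (phi z) <= M') ->
  mult phi M'.
Proof.
move=> /mult_hardy[h _ hE] b; apply: (mult_ext hE).
by apply: bounded_mult => z z1; rewrite hE// b.
Qed.

Lemma tendsC (u : nat -> C) l : series u @ \oo --> l ->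
  tends (fun N => \sum_(n < N) u n) l.
Proof.
move=> /(tendsP (V := C)); apply: tends_ext => N.
by rewrite /series /= big_mkord.
Qed.

Lemma tends_term (u : nat -> C) l : tends (fun N => \sum_(n < N) u n) l -> tends u 0.
Proof.
move=> h; rewrite -(subrr l); apply: tends_ext (tendsB (tends_S h) h) => n.
by rewrite big_ord_recr /= addrAC subrr add0r.
Qed.

(** Inside the disc a Taylor series converges geometrically, so its dilates
    belong to H^2 whatever the size of the function. *)
Lemma taylor_dilate (g : C -> C) c (r : R) : taylor_coefs g c -> 0 < r < 1 ->
  exists h : H2, forall z, rn z < 1 -> psum h z = g (r%:C%C * z).
Proof.
move=> tc /andP[r0 r1].
pose s : R := (1 + r) / 2.
have s1 : s < 1 by rewrite /s; lra.
have s0 : 0 < s by rewrite /s; lra.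
have rs : r < s by rewrite /s; lra.
clearbody s; have := tends_term (tendsC (tc s%:C%C _)).
rewrite lt1C rnr gtr0_norm// => /(_ s1)/tends_cauchy/cauchy_bounded[A A0 hA].
have q1 : (r / s) ^+ 2 < 1.
  by rewrite exprn_ilt1// ?divr_ge0 ?(ltW r0) ?(ltW s0)// ltr_pdivrMr// mul1r.
have [N|h hc] := @hardy_exists _ (fun n => c n * r%:C%C ^+ n) (A ^+ 2 / (1 - (r / s) ^+ 2)).
  apply: (@le_trans _ _ (\sum_(n < N) A ^+ 2 * ((r / s) ^+ 2) ^+ n)).
    apply: ler_sum => n _; have := hA n; rewrite !rnM !rnX !rnr !gtr0_norm// => h.
    have r0' := ltW r0; have s0' := ltW s0.
    rewrite exprAC -exprMn lerXn2r ?nnegrE ?mulr_ge0 ?exprn_ge0 ?rn_ge0 ?divr_ge0//.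
    by rewrite expr_div_n mulrA ler_pdivlMr ?exprn_gt0// mulrAC ler_wpM2r// exprn_ge0.
  rewrite -mulr_sumr ler_wpM2l ?sqr_ge0// -[leRHS]mul1r ler_pdivlMr ?subr_gt0//.
  by rewrite mulrC -opprB mulNr -subrX1 opprB gerBl exprn_ge0// sqr_ge0.
exists h => z z1; apply: (tends_uniq (psum_tends h z1)).
apply: tends_ext (tendsC (tc _ _)) => [n|]; last first.
  by rewrite lt1C rnM rnr gtr0_norm// mulr_ilt1 ?rn_ge0 ?(ltW r0).
by apply: eq_bigr => i _; rewrite hc exprMn mulrA.
Qed.

Lemma taylor_radial (g : C -> C) c z : taylor_coefs g c -> rn z < 1 ->
  tends (fun n => g (dil_radius n * z)) (g z).
Proof.
move=> tc z1.
have [r r1 zr] : exists2 r : R, 0 < r < 1 & rn z < r.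
  by exists ((1 + rn z) / 2); [apply/andP; split|]; have := rn_ge0 z; lra.
have [k hk] := taylor_dilate tc r1.
have /andP[r_gt0 r_lt1] := r1.
have zr1 : rn (z / r%:C%C) < 1.
  by rewrite rnM rnV rnr gtr0_norm// ltr_pdivrMr// mul1r.
have rC : (r%:C%C : C) != 0 by rewrite (inj_eq (@complexI R)) gt_eqF.
have -> : g z = psum k (z / r%:C%C) by rewrite hk// mulrC divfK.
apply: tends_ext (psum_radial k zr1) => n.
rewrite hk; last by rewrite (le_lt_trans (rad_mul _ _)).
by congr g; rewrite mulrCA [_ * (z / _)]mulrC divfK.
Qed.

Lemma rad01 n : 0 < 1 - inv_succ R n.+1 < 1.
Proof.
by rewrite ltrBlDr ltrDl inv_succ_gt0 andbT subr_gt0 /inv_succ invf_lt1 ?ltr0n// ltr1n.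
Qed.

(** The dilates have norms at most the supremum of [g] and converge pointwise to
    [g]. *)
Lemma hinf_hardy (g : C -> C) c (M : R) : taylor_coefs g c ->
  (forall z, rn z < 1 -> rn (g z) <= M) ->
  exists2 h : H2, rn h <= M & forall z, rn z < 1 -> psum h z = g z.
Proof.
move=> tc gM.
have /choice[h hh] n : exists h : H2, forall z, rn z < 1 -> psum h z = g (dil_radius n.+1 * z).
  exact: taylor_dilate tc (rad01 n).
apply: (@hardy_limit _ h g M) => [n|z z1].
  apply: rn_le_sup => z z1; rewrite hh// gM//.
  by rewrite (le_lt_trans (rad_mul _ _)).
by apply: tends_ext (tends_S (taylor_radial tc z1)) => n; rewrite hh.
Qed.

End Multipliers.

(** * Uniform approximation by polynomials *)
Section PolyApprox.
Variable R : realType.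
Local Notation C := R[i].
Local Notation H2 := (hardy R).
Implicit Types (z w : C) (p : {poly C}) (phi psi : C -> C).

(** Finite Blaschke products and the interpolating functions below are
    approximable in this sense, which is how estimates for polynomials apply to
    them. *)
Definition poly_approx phi := forall e : R, 0 < e ->
  exists p, forall z, rn z <= 1 -> rn (p.[z] - phi z) <= e.

Lemma poly_bounded p : exists2 M : R, 0 <= M & forall z, rn z <= 1 -> rn p.[z] <= M.
Proof.
exists (\sum_(i < size p) rn p`_i); first by rewrite sumr_ge0// => i _; exact: rn_ge0.
move=> z z1; rewrite horner_coef (le_trans (rn_sum _ _ _))//; apply: ler_sum => i _.
by rewrite rnM rnX ler_piMr ?rn_ge0// exprn_ile1 ?rn_ge0.
Qed.

Lemma poly_approx_bounded phi : poly_approx phi ->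
  exists2 M : R, 0 <= M & forall z, rn z <= 1 -> rn (phi z) <= M.
Proof.
move=> /(_ 1 ltr01)[p hp]; have [M M0 hM] := poly_bounded p.
exists (M + 1) => [|z z1]; first by rewrite addr_ge0.
have := hp z z1; have := hM z z1; rewrite rnBC; have := rn_subl (phi z) p.[z]; lra.
Qed.

Lemma poly_approx_poly p : poly_approx (fun z => p.[z]).
Proof. by move=> e e0; exists p => z _; rewrite subrr rn0 ltW. Qed.

Lemma poly_approx_ext phi psi : (forall z, rn z <= 1 -> phi z = psi z) -> poly_approx phi -> poly_approx psi.
Proof. by move=> E H e /H[p hp]; exists p => z z1; rewrite -E// hp. Qed.

Lemma poly_approxD phi psi : poly_approx phi -> poly_approx psi -> poly_approx (fun z => phi z + psi z).
Proof.
move=> h1 h2 e e0; have [|p hp] := h1 (e / 2); first lra.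
have [|q hq] := h2 (e / 2); first lra.
exists (p + q) => z z1; rewrite hornerD opprD addrACA (le_trans (rnD _ _))//.
have := hp z z1; have := hq z z1; lra.
Qed.

Lemma poly_approxM phi psi : poly_approx phi -> poly_approx psi -> poly_approx (fun z => phi z * psi z).
Proof.
move=> h1 h2 e e0; have [M M0 hM] := poly_approx_bounded h1.
have [|q hq] := h2 (e / 2 / (M + 1)); first by rewrite !divr_gt0//; lra.
have [K K0 hK] := poly_bounded q.
have [|p hp] := h1 (e / 2 / (K + 1)); first by rewrite !divr_gt0//; lra.
exists (p * q) => z z1; rewrite hornerM.
have -> : p.[z] * q.[z] - phi z * psi z
    = (p.[z] - phi z) * q.[z] + phi z * (q.[z] - psi z) by ring.
rewrite (le_trans (rnD _ _))// !rnM [e]splitr; apply: lerD.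
  have := hp z z1; rewrite ler_pdivlMr; last lra.
  have := hK z z1; have := rn_ge0 (p.[z] - phi z); have := rn_ge0 q.[z]; nra.
have := hq z z1; rewrite ler_pdivlMr; last lra.
have := hM z z1; have := rn_ge0 (q.[z] - psi z); have := rn_ge0 (phi z); nra.
Qed.

Lemma poly_approx_cst (c : C) : poly_approx (fun=> c).
Proof. by apply: poly_approx_ext (poly_approx_poly c%:P) => z _; rewrite hornerC. Qed.

Lemma poly_approx_id : poly_approx (fun z => z).
Proof. by apply: poly_approx_ext (poly_approx_poly 'X) => z _; rewrite hornerX. Qed.

Lemma poly_approxZ (c : C) phi : poly_approx phi -> poly_approx (fun z => c * phi z).
Proof. by apply: poly_approxM; exact: poly_approx_cst. Qed.

Lemma poly_approx_sum (I : Type) (r : seq I) (P : pred I) (F : I -> C -> C) :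
  (forall i, P i -> poly_approx (F i)) -> poly_approx (fun z => \sum_(i <- r | P i) F i z).
Proof.
move=> h; elim: r => [|i r IH].
  by apply: poly_approx_ext (poly_approx_cst 0) => z _; rewrite big_nil.
case Pi: (P i).
  by apply: poly_approx_ext (poly_approxD (h i Pi) IH) => z _; rewrite big_cons Pi.
by apply: poly_approx_ext IH => z _; rewrite big_cons Pi.
Qed.

Lemma poly_approx_prod (I : Type) (r : seq I) (P : pred I) (F : I -> C -> C) :
  (forall i, P i -> poly_approx (F i)) -> poly_approx (fun z => \prod_(i <- r | P i) F i z).
Proof.
move=> h; elim: r => [|i r IH].
  by apply: poly_approx_ext (poly_approx_cst 1) => z _; rewrite big_nil.
case Pi: (P i).
  by apply: poly_approx_ext (poly_approxM (h i Pi) IH) => z _; rewrite big_cons Pi.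
by apply: poly_approx_ext IH => z _; rewrite big_cons Pi.
Qed.

Lemma sub1_neq0 w z : rn w < 1 -> rn z <= 1 -> 1 - w * z != 0.
Proof.
move=> w1 z1; rewrite subr_eq0; apply/eqP => /(congr1 (@rn R C)).
rewrite rn1 rnM => h; have := rn_ge0 w; have := rn_ge0 z; nra.
Qed.

Lemma poly_approx_geom w : rn w < 1 -> poly_approx (fun z => (1 - w * z)^-1).
Proof.
move=> w1 e e0; have w0 := rn_ge0 w.
have [|N /(_ N (leqnn _)) hN] := @pow_small R (rn w) (1 - rn w)^-1 e _ e0; first by rewrite w0 w1.
exists (\poly_(i < N) w ^+ i) => z z1; apply: le_trans hN.
have nz := sub1_neq0 w1 z1.
have -> : (\poly_(i < N) w ^+ i).[z] - (1 - w * z)^-1 = - (w * z) ^+ N / (1 - w * z).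
  apply: (mulIf nz); rewrite mulrBl mulVf// divfK// horner_poly.
  have -> : \sum_(i < N) w ^+ i * z ^+ i = \sum_(i < N) (w * z) ^+ i.
    by apply: eq_bigr => i _; rewrite exprMn.
  have := subrX1 (w * z) N; set S := \sum_(i < N) _ => h.
  have -> : S * (1 - w * z) = - ((w * z - 1) * S) by ring.
  rewrite -h; ring.
rewrite rnM rnN rnV rnX rnM.
have d0 : 0 < 1 - rn w by lra.
have d1 : 1 - rn w <= rn (1 - w * z).
  have := rn_subl (1 : C) (w * z); rewrite rn1 rnM; have := rn_ge0 z; nra.
apply: ler_pM; rewrite ?exprn_ge0 ?mulr_ge0 ?invr_ge0 ?rn_ge0//.
  by rewrite lerXn2r ?nnegrE ?mulr_ge0 ?rn_ge0// ler_piMr ?rn_ge0.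
by rewrite lef_pV2 ?posrE// (lt_le_trans d0).
Qed.

Lemma poly_approx_mult phi (M : R) : 0 <= M -> poly_approx phi ->
  (forall z, rn z <= 1 -> rn (phi z) <= M) -> mult phi M.
Proof.
move=> M0 h hM; apply: mult_eps => e e0.
have /choice[p hp] n : exists p, forall z, rn z <= 1 -> rn (p.[z] - phi z) <= Num.min e (inv_succ R n).
  by apply: h; rewrite lt_min e0 inv_succ_gt0.
apply: (@mult_limit _ (fun n z => (p n).[z])) => [n|z z1].
  apply: mult_poly => z z1; have := hp n z z1; rewrite le_min => /andP[h1 _].
  have := hM z z1; have := rn_subl (p n).[z] (phi z); lra.
move=> d /inv_succ_small[N hN]; exists N => n /hN; apply: le_lt_trans.
by have := hp n z (ltW z1); rewrite le_min => /andP[].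
Qed.

End PolyApprox.

(** * Sums over a geometric scale *)
Section GeometricSum.
Variable R : realType.
Variables (a : nat -> R) (q : R).
Hypotheses (a0 : forall n, 0 < a n) (q01 : 0 <= q < 1)
  (aq : forall n, a n.+1 <= q * a n).

(** The sequence meets the scale [s] in boundedly many terms, and the terms
    decay geometrically away from it. *)
Lemma geom_sum (s : R) N : 0 < s ->
  \sum_(n < N) Num.min (a n / s) (s / a n) <= 2 / (1 - q).
Proof.
move=> s0; case/andP: q01 => q0 q1.
have d0 : 0 < 1 - q by lra.
(* psi (t N) bounds (1 - q) times the sum of the terms up to N, where t is the
   ratio of a N to the scale: as long as t >= 1 the sum is comparable with its
   last term 1 / t, and afterwards 2 - q t leaves room for the terms to come,
   which contribute at most q t. *)
pose psi (t : R) : R := if 1 <= t then t^-1 else 2 - q * t.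
pose t n := a n / s.
have t0 n : 0 < t n by rewrite divr_gt0.
have tq n : t n.+1 <= q * t n by rewrite /t mulrA ler_pM2r ?invr_gt0.
have psi2 (x : R) : 0 < x -> psi x <= 2.
  rewrite /psi; case: ifP => [x1 x0|_ x0]; last nra.
  by rewrite (@le_trans _ _ 1) ?invf_le1//; lra.
have E n : Num.min (a n / s) (s / a n) = Num.min (t n) (t n)^-1 by rewrite /t invf_div.
case: N => [|N]; first by rewrite big_ord0 divr_ge0//; lra.
suff : \sum_(n < N.+1) Num.min (a n / s) (s / a n) <= psi (t N) / (1 - q).
  by move/le_trans; apply; rewrite ler_pM2r ?invr_gt0// psi2.
have minl (x y : R) : Num.min x y <= x by rewrite ge_min lexx.
have minr (x y : R) : Num.min x y <= y by rewrite ge_min lexx orbT.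
rewrite ler_pdivlMr//.
elim: N => [|N IH].
  rewrite big_ord_recl big_ord0 addr0 E -[t ord0]/(t 0%N) /psi.
  have h1 := minl (t 0%N) (t 0%N)^-1; have h2 := minr (t 0%N) (t 0%N)^-1.
  move: h1 h2 (t0 0%N); move: (Num.min (t 0%N) (t 0%N)^-1) (t 0%N) => m u h1 h2 u0.
  case: ifPn => [h|]; last by rewrite -ltNge => h; nra.
  have : 0 < u^-1 by rewrite invr_gt0.
  nra.
rewrite big_ord_recr /= mulrDl E.
have h1 := minl (t N.+1) (t N.+1)^-1; have h2 := minr (t N.+1) (t N.+1)^-1.
have := IH; have := tq N; have := t0 N; have := t0 N.+1.
move: h1 h2; move: (\sum_(n < N.+1) _) => S.
move: (Num.min (t N.+1) (t N.+1)^-1) => m; move: (t N) (t N.+1) => u v.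
rewrite /psi => h1 h2 v0 u0 uv.
case: ifPn => [u1|]; last rewrite -ltNge => u1; (case: ifPn => [v1|]; last rewrite -ltNge => v1) => h.
- have : u^-1 <= q * v^-1.
    by rewrite -[u^-1]mul1r ler_pdivrMr// mulrAC ler_pdivlMr// mul1r.
  nra.
- have : u^-1 <= 1 by rewrite invf_le1.
  nra.
- nra.
- nra.
Qed.

Lemma geom_total N : \sum_(n < N) a n <= a 0%N / (1 - q).
Proof.
case/andP: q01 => q0 q1; have d0 : 0 < 1 - q by lra.
rewrite ler_pdivlMr//.
suff : (\sum_(n < N) a n) * (1 - q) <= a 0%N - q * a N.-1 * (0 < N)%:R.
  by move/le_trans; apply; rewrite gerBl mulr_ge0// mulr_ge0// ltW.
case: N => [|N]; first by rewrite big_ord0 mul0r mulr0 subr0 ltW.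
rewrite mulr1 /=; elim: N => [|N IH]; first by rewrite big_ord_recl big_ord0; nra.
by rewrite big_ord_recr /= mulrDl; have := aq N; nra.
Qed.

End GeometricSum.

(** * Blaschke factors with a real zero *)
Section Blaschke.
Variable R : realType.
Local Notation C := R[i].
Local Notation H2 := (hardy R).
Implicit Types (f h : H2) (z w : C) (b : R).

Definition bfactor (b : R) z : C := (b%:C%C - z) / (1 - b%:C%C * z).

Lemma blaschke_factorE b z : 0 < b -> blaschke_factor b%:C%C z = bfactor b z.
Proof.
move=> b0; rewrite /blaschke_factor /bfactor conj_re ger0_norm ?divff ?mul1r//.
  by rewrite (inj_eq (@complexI R)) gt_eqF.
by rewrite -[0]/(0%:C%C) lecR ltW.
Qed.

Lemma rn_affine (a b : R) z :
  rn (a%:C%C - b%:C%C * z) ^+ 2 = a ^+ 2 - 2 * a * b * Re z + b ^+ 2 * rn z ^+ 2.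
Proof. by rewrite !rn_sqr; case: z => x y; rewrite /= ; ring. Qed.

Lemma rn_one_minus b z : rn (1 - b%:C%C * z) ^+ 2 = 1 - 2 * b * Re z + b ^+ 2 * rn z ^+ 2.
Proof. by rewrite -[1]/(1%:C%C) rn_affine expr1n mulr1. Qed.

Lemma rn_minus b z : rn (b%:C%C - z) ^+ 2 = b ^+ 2 - 2 * b * Re z + rn z ^+ 2.
Proof. by rewrite -[z in LHS]mul1r -[1]/(1%:C%C) rn_affine expr1n mul1r mulr1. Qed.

Section factor.
Variable b : R.
Hypothesis b01 : 0 < b < 1.

Lemma b_real : rn (b%:C%C : C) = b.
Proof. by case/andP: b01 => b0 _; rewrite rnr gtr0_norm. Qed.

Lemma bden_neq0 z : rn z <= 1 -> 1 - b%:C%C * z != 0.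
Proof. by move=> z1; apply: sub1_neq0 => //; rewrite b_real; case/andP: b01. Qed.

(** The identity |1 - b z|^2 - |b - z|^2 = (1 - b^2) (1 - |z|^2). *)
Lemma bfactor_defect z : rn z <= 1 -> 1 - rn (bfactor b z) ^+ 2
  = (1 - b ^+ 2) * (1 - rn z ^+ 2) / rn (1 - b%:C%C * z) ^+ 2.
Proof.
move=> z1; have d0 : rn (1 - b%:C%C * z) != 0 by rewrite gt_eqF// rn_gt0// bden_neq0.
rewrite /bfactor rnM rnV expr_div_n rn_minus.
have := rn_one_minus b z; move: (rn (1 - _)) d0 => d d0 dE.
apply: (mulIf (expf_neq0 2 d0)); rewrite divfK ?expf_neq0// mulrBl divfK ?expf_neq0//.
by rewrite dE; ring.
Qed.

Lemma bfactor_le1 z : rn z <= 1 -> rn (bfactor b z) <= 1.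
Proof.
move=> z1; have := bfactor_defect z1; case/andP: b01 => b0 b1.
have : 0 <= (1 - b ^+ 2) * (1 - rn z ^+ 2) / rn (1 - b%:C%C * z) ^+ 2.
  by rewrite divr_ge0 ?sqr_ge0// mulr_ge0//; have := rn_ge0 z; nra.
by have := rn_ge0 (bfactor b z); nra.
Qed.

Lemma poly_approx_bfactor : poly_approx (bfactor b).
Proof.
apply: poly_approxM; last by apply: poly_approx_geom; rewrite b_real; case/andP: b01.
by apply: poly_approx_ext (poly_approxD (poly_approx_cst b%:C%C) (poly_approxZ (-1) (@poly_approx_id R))) => z _; rewrite mulN1r.
Qed.

Lemma bfactor_near1 z : rn z < 1 -> rn (bfactor b z - 1) <= (1 - b) * (2 / (1 - rn z)).
Proof.
move=> z1; case/andP: b01 => b0 b1; have d0 := bden_neq0 (ltW z1).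
have -> : bfactor b z - 1 = - ((1 - b)%:C%C * ((1 + z) / (1 - b%:C%C * z))).
  by rewrite /bfactor rmorphB rmorph1 /=; field.
rewrite rnN !rnM rnr gtr0_norm ?subr_gt0// ler_wpM2l ?subr_ge0 ?(ltW b1)// rnV.
have z0 := rn_ge0 z.
have h1 : rn (1 + z) <= 2 by have := rnD (1 : C) z; rewrite rn1; lra.
have h2 : 1 - rn z <= rn (1 - b%:C%C * z).
  have := rn_subl (1 : C) (b%:C%C * z); rewrite rn1 rnM b_real; nra.
apply: ler_pM; rewrite ?invr_ge0 ?rn_ge0// lef_pV2 ?posrE ?subr_gt0//.
by rewrite (lt_le_trans _ h2)// subr_gt0.
Qed.

(** With f = (z - b) q the quotient is (b z - 1) q, and for real b the norms of
    (z - b) q and (b z - 1) q agree because multiplication by z is isometric. *)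
Lemma bfactor_divide f : psum f b%:C%C = 0 ->
  exists h, rn h = rn f /\ forall z, rn z < 1 -> psum f z = bfactor b z * psum h z.
Proof.
case/andP: b01 => b0 b1.
have bl : rn (b%:C%C : C) < 1 by rewrite b_real.
move=> fb; have [q hq] := hardy_divide f bl.
have fE : f = fshift q - b%:C%C *: q.
  apply: psum_inj => z z1; rewrite psumB// psumZ// psum_fshift// hq// fb add0r; ring.
exists (b%:C%C *: fshift q - q); split.
  apply/eqP; rewrite -(eqrXn2 (n := 2)) ?rn_ge0// fE !rnB_sq !rnZ !rn_fshift.
  rewrite dotZl dotZr conj_re !b_real.
  by apply/eqP; ring.
move=> z z1; rewrite psumB// psumZ// psum_fshift// hq// fb add0r /bfactor.
have d0 := bden_neq0 (ltW z1).
apply: (mulIf d0); rewrite -[RHS]mulrA [X in _ = _ * X]mulrC mulrA divfK//; ring.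
Qed.

End factor.

(** * Blaschke products with real zeros *)
Section product.
Variables (b : nat -> R) (q : R).
Hypotheses (b01 : forall n, 0 < b n < 1) (b_incr : forall n, b n < b n.+1)
  (q01 : 0 <= q < 1) (bq : forall n, 1 - b n.+1 <= q * (1 - b n)).

Let a0 n : 0 < 1 - b n.
Proof. by rewrite subr_gt0; case/andP: (b01 n). Qed.

Lemma b_inj m n : b m = b n -> m = n.
Proof.
have h i j : (i < j)%N -> b i < b j by exact: (homo_ltn lt_trans b_incr).
by case: (ltngtP m n) => // /h; rewrite lt_neqAle => /andP[/eqP + _] => // + /esym.
Qed.

Definition bprod (P : pred nat) N z : C := \prod_(k < N | P k) bfactor (b k) z.

Lemma bprodS P N z : bprod P N.+1 z = bprod P N z * (if P N then bfactor (b N) z else 1).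
Proof. by rewrite /bprod big_mkcond big_ord_recr /= -big_mkcond. Qed.

Lemma bprod_le1 P N z : rn z <= 1 -> rn (bprod P N z) <= 1.
Proof.
move=> z1; rewrite /bprod rn_prod; suff /andP[] : 0 <= \prod_(k < N | P k) rn (bfactor (b k) z) <= 1 by [].
apply: (big_ind (fun x : R => 0 <= x <= 1)) => [|x y /andP[x0 x1] /andP[y0 y1]|k _].
- by rewrite ler01 lexx.
- by rewrite mulr_ge0// mulr_ile1.
- by rewrite rn_ge0 bfactor_le1.
Qed.

Lemma poly_approx_bprod P N : poly_approx (bprod P N).
Proof. by apply: poly_approx_prod => k _; exact: poly_approx_bfactor. Qed.

Lemma mult_bprod P N : mult (bprod P N) 1.
Proof. by apply: poly_approx_mult => //; [exact: poly_approx_bprod|move=> z; exact: bprod_le1]. Qed.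

Lemma bprod_tends P z : rn z < 1 ->
  tends (fun N => bprod P N z) (limn (fun N => bprod P N z)).
Proof.
move=> z1; suff /C_complete[l hl] : cauchyseq (fun N => bprod P N z).
  by rewrite (tends_lim hl).
have k0 : 0 <= 2 / (1 - rn z) by rewrite divr_ge0// subr_ge0 ltW.
apply: (@cauchy_summable _ _ _ (fun n => (1 - b n) * (2 / (1 - rn z)))
    ((1 - b 0%N) / (1 - q) * (2 / (1 - rn z)))) => [n|N].
  rewrite bprodS -[X in _ - X]mulr1 -mulrBr rnM.
  apply: (@le_trans _ _ (1 * rn ((if P n then bfactor (b n) z else 1) - 1))).
    by rewrite ler_wpM2r ?rn_ge0// bprod_le1// ltW.
  rewrite mul1r; case: ifP => _; first exact: bfactor_near1.
  by rewrite subrr rn0 mulr_ge0// ltW.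
by rewrite -mulr_suml ler_wpM2r//; exact: (geom_total a0).
Qed.

Definition blim P z : C := limn (fun N => bprod P N z).

Lemma blim_tends P z : rn z < 1 -> tends (fun N => bprod P N z) (blim P z).
Proof. exact: bprod_tends. Qed.

Lemma mult_blim P : mult (blim P) 1.
Proof. by apply: (mult_limit (mult_bprod P)) => z; exact: blim_tends. Qed.

Lemma blim_zero (P : pred nat) k : P k -> blim P (b k)%:C%C = 0.
Proof.
move=> Pk; have bk1 : rn ((b k)%:C%C : C) < 1 by rewrite b_real//; case/andP: (b01 k).
apply: (tends_uniq (blim_tends P bk1)).
apply: (tends_near (u := fun=> 0)); last exact: tends_cst.
exists k.+1 => n kn; rewrite /bprod (bigD1 (Ordinal kn))//=.
by rewrite {1}/bfactor subrr !mul0r.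
Qed.

Lemma bprod_rn_anti P N m z : rn z <= 1 -> rn (bprod P (N + m) z) <= rn (bprod P N z).
Proof.
move=> z1; elim: m => [|m IH]; first by rewrite addn0.
rewrite addnS bprodS rnM (le_trans _ IH)// ler_piMr ?rn_ge0//.
by case: ifP => _; [exact: bfactor_le1|rewrite rn1].
Qed.

(** Divide by one factor at a time without changing the norm. The successive
    quotients differ at each point by a summable amount, so they converge
    pointwise, and their limit is in H^2. *)
Lemma blaschke_divide f : (forall n, psum f (b n)%:C%C = 0) ->
  exists h, forall z, rn z < 1 -> psum f z = blim xpredT z * psum h z.
Proof.
move=> fb.
have bk1 n : rn ((b n)%:C%C : C) < 1 by rewrite b_real//; case/andP: (b01 n).
have /choice[d hd] : forall p : nat * H2, exists h, psum p.2 (b p.1)%:C%C = 0 ->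
    rn h = rn p.2 /\ forall z, rn z < 1 -> psum p.2 z = bfactor (b p.1) z * psum h z.
  move=> [n g] /=; have [g0|ng] := pselect (psum g (b n)%:C%C = 0).
    by have [h hh] := bfactor_divide (b01 n) g0; exists h.
  by exists 0.
pose u := fix u n := if n is m.+1 then d (m, u m) else f.
have uz n : rn (u n) = rn f /\ forall m, (n <= m)%N -> psum (u n) (b m)%:C%C = 0.
  elim: n => [|n [IH1 IH2]]; first by split=> // m _; exact: fb.
  have [h1 h2] := hd (n, u n) (IH2 n (leqnn _)).
  split=> [|m nm]; first by rewrite -IH1 -h1.
  have := h2 _ (bk1 m); rewrite IH2 1?ltnW// => /esym/eqP; rewrite mulf_eq0 => /orP[|/eqP//].
  rewrite /bfactor mulf_eq0 invr_eq0 (negPf (bden_neq0 (b01 n) (ltW (bk1 m)))) orbF.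
  rewrite subr_eq0 => /eqP/(@complexI R)/b_inj mn.
  by rewrite /= in mn; rewrite mn ltnn in nm.
have uE n z : rn z < 1 -> psum (u n) z = bfactor (b n) z * psum (u n.+1) z.
  by move=> z1; have [_ ->] := hd (n, u n) ((uz n).2 n (leqnn _)).
have fE n z : rn z < 1 -> psum f z = bprod xpredT n z * psum (u n) z.
  move=> z1; elim: n => [|n IH]; first by rewrite /bprod big_ord0 mul1r.
  by rewrite bprodS IH uE// mulrA.
have cz z : rn z < 1 -> cauchyseq (fun n => psum (u n) z).
  move=> z1; set K := rn f * rn (kern z).
  have K0 : 0 <= K by rewrite mulr_ge0 ?rn_ge0.
  have k0 : 0 <= 2 / (1 - rn z) by rewrite divr_ge0// subr_ge0 ltW.
  apply: (@cauchy_summable _ _ _ (fun n => (1 - b n) * (2 / (1 - rn z) * K))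
    ((1 - b 0%N) / (1 - q) * (2 / (1 - rn z) * K))) => [n|N].
    have -> : psum (u n.+1) z - psum (u n) z = - ((bfactor (b n) z - 1) * psum (u n.+1) z).
      by rewrite [X in _ - X]uE//; ring.
    rewrite rnN rnM mulrA; apply: ler_pM; rewrite ?rn_ge0// ?bfactor_near1//.
    by rewrite (le_trans (rn_psum _ z1))// (uz n.+1).1.
  have kK : 0 <= 2 / (1 - rn z) * K by exact: mulr_ge0.
  rewrite -mulr_suml; apply: ler_wpM2r => //; exact: (geom_total a0).
have [|z z1|h _ hE] := @hardy_limit _ u (fun z => limn (fun n => psum (u n) z)) (rn f).
- by move=> n; rewrite (uz n).1.
- by have [l hl] := C_complete (cz z z1); rewrite (tends_lim hl).
exists h => z z1; apply: (tends_uniq (u := fun=> psum f z)); first exact: tends_cst.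
apply: (tends_ext (u := fun n => bprod xpredT n z * psum (u n) z)).
  by move=> n; rewrite -fE.
apply: tendsM; first exact: blim_tends.
by rewrite hE//; have [l hl] := C_complete (cz z z1); rewrite (tends_lim hl).
Qed.

End product.
End Blaschke.

(** * The Carleson condition on a real sequence *)
Section Carleson.
Variable R : realType.
Local Notation C := R[i].
Local Notation H2 := (hardy R).
Implicit Types (f h : H2) (z w : C) (b : nat -> R).

Lemma tends_rn_ge (V : normedZmodType C) (u : nat -> V) l (c : R) : tends u l ->
  (forall n, c <= rn (u n)) -> c <= rn l.
Proof.
move=> h hc; apply/ler_addgt0Pl => e e0; have [N hN] := h e e0.
have h1 := hN N (leqnn _); have h2 := hc N.
have := rn_subl (u N) l; lra.
Qed.

Lemma limn_neq0 (u : nat -> C) : limn u != 0 -> tends u (limn u).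
Proof.
move=> h; apply/(tendsP (V := C)); have [//|/dvgP d] := pselect (cvgn u).
by move: h; rewrite d eqxx.
Qed.

(** A single factor of the n.+1-st product separates b n from b n.+1 in the
    pseudohyperbolic metric, and for real points this says that the distance to
    1 shrinks by a fixed ratio. *)
Lemma carleson_facts (lam : nat -> C) : (forall n, 0 < lam n < 1) ->
  (forall n, lam n < lam n.+1) -> carleson lam ->
  exists (b : nat -> R) (q delta : R),
    ([/\ forall n, lam n = (b n)%:C%C, forall n, 0 < b n < 1, forall n, b n < b n.+1 &
      0 <= q < 1] /\
    [/\ forall n, 1 - b n.+1 <= q * (1 - b n), 0 < delta,
      forall n N, delta <= rn (bprod b (fun k => k != n) N (b n)%:C%C) &
      forall z, blaschke lam z = blim b xpredT z]).
Proof.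
move=> l01 lincr [_ /gt0C[d d0 ->] dB].
pose b n := Re (lam n).
have lE n : lam n = (b n)%:C%C by rewrite ReK// ltW//; case/andP: (l01 n).
have b01 n : 0 < b n < 1.
  by have := l01 n; rewrite lE -[0]/(0%:C%C) -[1]/(1%:C%C) !ltcR.
have b_incr n : b n < b n.+1 by have := lincr n; rewrite !lE ltcR.
have fE n z : blaschke_factor (lam n) z = bfactor (b n) z.
  by rewrite lE blaschke_factorE//; case/andP: (b01 n).
have BoE n z : blaschke_omit lam n z = limn (fun N => bprod b (fun k => k != n) N z).
  congr (limn _); apply/funext => N; apply: eq_bigr => k _; exact: fE.
have bk1 n : rn ((b n)%:C%C : C) <= 1 by rewrite b_real// ltW//; case/andP: (b01 n).
have dl n N : d <= rn (bprod b (fun k => k != n) N (b n)%:C%C).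
  have := dB n; rewrite BoE rnE lE lecR => h.
  have T := @limn_neq0 (fun N => bprod b (fun k => k != n) N (b n)%:C%C).
  have : tends (fun N => bprod b (fun k => k != n) N (b n)%:C%C)
     (limn (fun N => bprod b (fun k => k != n) N (b n)%:C%C)).
    by apply: T; apply/eqP => E; move: h; rewrite E rn0; lra.
  move=> /tends_rn_le_near h1; apply: (le_trans h).
  by apply: (h1 _ N) => m Nm; rewrite -(subnKC Nm) (bprod_rn_anti b01).
have sep n : d <= rn (bfactor (b n) (b n.+1)%:C%C).
  have := dl n.+1 n.+1; rewrite bprodS neq_ltn ltnSn /= rnM => /le_trans; apply.
  by rewrite ler_piMl ?rn_ge0// (bprod_le1 b01).
have d1 : d <= 1 by rewrite (le_trans (sep 0%N))// bfactor_le1.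
(* d (1 - b n * b n.+1) <= b n.+1 - b n implies 1 - b n.+1 <= (1 - d) (1 - b n).
   *)
exists b, (1 - d), d; split; split=> //; first by apply/andP; split; lra.
  move=> n; case/andP: (b01 n) => x0 x1; case/andP: (b01 n.+1) => y0 y1.
  have := sep n; rewrite /bfactor -rmorphB -rmorphM -[1]/(1%:C%C) -rmorphB -fmorphV -rmorphM.
  have bb : 0 < 1 - b n * b n.+1 by nra.
  have bi := b_incr n.
  rewrite rnr ltr0_norm; last by rewrite pmulr_llt0 ?invr_gt0// subr_lt0.
  rewrite -[- (_ / _)]mulNr opprB ler_pdivlMr//.
  have : 0 <= d * (b n * (1 - b n.+1)) by rewrite !mulr_ge0 ?subr_ge0 ?(ltW d0) ?(ltW x0) ?(ltW y1).
  move: (b n) (b n.+1) => u v; nra.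
move=> z; congr (limn _); apply/funext => N; apply: eq_bigr => k _; exact: fE.
Qed.

Section estimates.
Variables (b : nat -> R) (q : R).
Hypotheses (b01 : forall n, 0 < b n < 1) (q01 : 0 <= q < 1)
  (bq : forall n, 1 - b n.+1 <= q * (1 - b n)).

Let a0 n : 0 < 1 - b n.
Proof. by rewrite subr_gt0; case/andP: (b01 n). Qed.

Lemma one_minus_rn z : 1 - rn z <= rn (1 - z).
Proof. by have := rn_subl (1 : C) z; rewrite rn1. Qed.

Lemma min_ineq (a w x : R) : 0 < a -> 0 < w -> x * w <= a -> x * a <= w ->
  x <= Num.min (a / w) (w / a).
Proof. by move=> a_gt0 w0 h1 h2; rewrite le_min !ler_pdivlMr// h1 h2. Qed.

(** Both the numerator of the defect and its denominator compare with 1 - b n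
    and |1 - z|. *)
Lemma bfactor_defect_le n z : rn z < 1 ->
  1 - rn (bfactor (b n) z) ^+ 2 <= 16 * Num.min ((1 - b n) / rn (1 - z)) (rn (1 - z) / (1 - b n)).
Proof.
move=> z1; have a_gt0 := a0 n; case/andP: (b01 n) => b0 b1.
set w := rn (1 - z); set a := 1 - b n in a_gt0 *.
have z0 := rn_ge0 z.
have zw : 1 - rn z <= w := one_minus_rn z.
have w0 : 0 < w by lra.
rewrite bfactor_defect ?(ltW z1)//; set D := rn (1 - _).
have bz : rn ((b n)%:C%C * z) = b n * rn z by rewrite rnM b_real.
have aD : a <= D by have := rn_subl (1 : C) ((b n)%:C%C * z); rewrite rn1 bz -/D /a; nra.
have wD : w <= 2 * D.
  have := rn_tri ((b n)%:C%C * z) 1 z; rewrite -/w -/D.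
  have -> : (b n)%:C%C * z - z = - ((1 - b n)%:C%C * z) by rewrite rmorphB rmorph1; ring.
  rewrite rnN rnM rnr gtr0_norm// -/a; nra.
have D0 : 0 < D by lra.
rewrite -ler_pdivrMl//; apply: min_ineq => //.
  rewrite mulrC mulrA mulrA ler_pdivrMr ?exprn_gt0//.
  have h1 : (1 - b n ^+ 2) <= 2 * a by rewrite /a; nra.
  have h2 : 0 <= 1 - b n ^+ 2 by nra.
  have h3 : (1 - rn z ^+ 2) <= 2 * w by nra.
  have h4 : 0 <= 1 - rn z ^+ 2 by nra.
  have h5 : (1 - b n ^+ 2) * (1 - rn z ^+ 2) <= 2 * a * (2 * w) by apply: ler_pM.
  have h6 : w ^+ 2 <= 4 * D ^+ 2 by nra.
  move: h5 h6; move: (_ * _) (D ^+ 2) => X Y h5 h6; nra.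
rewrite mulrC mulrA mulrA ler_pdivrMr ?exprn_gt0//.
have h1 : (1 - b n ^+ 2) <= 2 * a by rewrite /a; nra.
have h2 : 0 <= 1 - b n ^+ 2 by nra.
have h3 : (1 - rn z ^+ 2) <= 2 * w by nra.
have h4 : 0 <= 1 - rn z ^+ 2 by nra.
have h5 : (1 - b n ^+ 2) * (1 - rn z ^+ 2) <= 2 * a * (2 * w) by apply: ler_pM.
have h6 : a ^+ 2 <= D ^+ 2 by nra.
move: h5 h6; move: (_ * _) (D ^+ 2) => X Y h5 h6; nra.
Qed.

(** The defects of the factors have a bounded sum, and t^2 >= exp (- (1 - t^2) /
    t^2) turns a bounded sum of defects into a lower bound for the product. *)
Lemma blim_lower (rho : R) : 0 < rho -> exists2 eta : R, 0 < eta &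
  forall z, rn z < 1 -> (forall n, rho <= rn (bfactor (b n) z)) -> eta <= rn (blim b xpredT z).
Proof.
move=> r0; case/andP: (q01) => q0 q1; have d0 : 0 < 1 - q by lra.
(* 32 is 16, from [bfactor_defect_le], times 2, from [geom_sum]. *)
exists (expR (- (32 / (1 - q) / rho ^+ 2))); first exact: expR_gt0.
move=> z z1 hz; apply: (tends_rn_ge (blim_tends b01 q01 bq xpredT z1)) => N.
have z0 := rn_ge0 z; have w0 : 0 < rn (1 - z) by have := one_minus_rn z; lra.
pose x n := 1 - rn (bfactor (b n) z) ^+ 2.
have x_ge0 n : 0 <= x n.
  by have := bfactor_le1 (b01 n) (ltW z1); have := rn_ge0 (bfactor (b n) z); rewrite /x; nra.
have hx n : expR (- (x n / rho ^+ 2)) <= rn (bfactor (b n) z).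
  set t := rn (bfactor (b n) z).
  have t0 : 0 < t by rewrite (lt_le_trans r0)// hz.
  have t1 : t <= 1 by rewrite bfactor_le1// ltW.
  apply: (@le_trans _ _ (expR (- (x n / t ^+ 2)))).
    rewrite ler_expR lerN2 ler_wpM2l// lef_pV2 ?posrE ?exprn_gt0//.
    by rewrite lerXn2r ?nnegrE ?(ltW r0) ?(ltW t0)// hz.
  apply: (@le_trans _ _ (t ^+ 2)); last by nra.
  rewrite expRN invf_ple ?posrE ?expR_gt0 ?exprn_gt0//.
  have := expR_ge1Dx (x n / t ^+ 2); apply: le_trans.
  by rewrite /x mulrBl divff ?expf_neq0 ?gt_eqF// mul1r -/t addrC subrK.
rewrite /bprod rn_prod.
apply: (@le_trans _ _ (\prod_(k < N) expR (- (x k / rho ^+ 2)))).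
  rewrite -expR_sum ler_expR sumrN lerN2 -mulr_suml ler_wpM2r ?invr_ge0 ?sqr_ge0//.
  apply: (@le_trans _ _ (\sum_(k < N) 16 * Num.min ((1 - b k) / rn (1 - z)) (rn (1 - z) / (1 - b k)))).
    by apply: ler_sum => k _; exact: bfactor_defect_le.
  rewrite -mulr_sumr; have := geom_sum a0 q01 bq N w0; set S := \sum_(_ < _) _.
  by move=> h; rewrite (_ : 32 / (1 - q) = 16 * (2 / (1 - q))) ?ler_pM2l//; field; lra.
by apply: ler_prod => k _; rewrite hx expR_ge0.
Qed.

(** * Bounded interpolation *)
(** A function with value 1 at b n whose size at z is at most 4 min(s, 1/s),
    where s is the ratio of 1 - b n to |1 - z|. *)
Definition peak n z : C := 4 * (1 - b n)%:C%C * ((1 - z) * ((2 - b n)%:C%C - z)^-1 ^+ 2).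

Lemma peak1 n : peak n (b n)%:C%C = 1.
Proof.
have a_gt0 := a0 n.
have aC : ((1 - b n)%:C%C : C) != 0 by rewrite (inj_eq (@complexI R)) gt_eqF.
have E1 : 1 - (b n)%:C%C = (1 - b n)%:C%C :> C by rewrite rmorphB.
have E2 : (2 - b n)%:C%C - (b n)%:C%C = 2 * (1 - b n)%:C%C :> C.
  by rewrite !rmorphB /= rmorph_nat rmorph1; ring.
by rewrite /peak E1 E2; move: (_%:C%C) aC => A aC; field.
Qed.

Lemma poly_approx_peak n : poly_approx (peak n).
Proof.
have a_gt0 := a0 n; have c0 : 0 < 2 - b n by lra.
apply: poly_approxZ; apply: poly_approxM.
  by apply: poly_approx_ext (poly_approxD (poly_approx_cst 1) (poly_approxZ (-1) (@poly_approx_id R))) => z _; rewrite mulN1r.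
have cC : ((2 - b n)%:C%C : C) != 0 by rewrite (inj_eq (@complexI R)) gt_eqF.
have h : poly_approx (fun z => ((2 - b n)%:C%C - z)^-1).
  apply: poly_approx_ext (poly_approxZ ((2 - b n)%:C%C^-1) (@poly_approx_geom R ((2 - b n)%:C%C^-1) _)) => [z _|].
    by rewrite -invfM mulrBr mulr1 mulrA divff// mul1r.
  by rewrite rnV rnr gtr0_norm// invf_lt1//; lra.
by apply: poly_approx_ext (poly_approxM h h) => z _; rewrite expr2.
Qed.

Lemma peak_le n z : rn z <= 1 -> 0 < rn (1 - z) ->
  rn (peak n z) <= 4 * Num.min ((1 - b n) / rn (1 - z)) (rn (1 - z) / (1 - b n)).
Proof.
move=> z1 w0; have a_gt0 := a0 n.
rewrite /peak rnM rnM rnM rnX rnV rnr gtr0_norm//.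
have -> : rn (4 : C) = 4 by rewrite -[4]/(4%:R) /rn ger0_norm ?ler0n//.
set a := 1 - b n in a_gt0 *; set w := rn (1 - z); set D := rn (_ - z).
have DE : a ^+ 2 + w ^+ 2 <= D ^+ 2.
  rewrite /D /w !rn_sqr /= !raddfB /= /a.
  have x1 : 0 <= 1 - Re z.
    by rewrite subr_ge0 (le_trans _ z1)// (le_trans (ler_norm _))// Re_le_rn.
  have := mulr_ge0 (ltW a_gt0) x1; rewrite /a; move: (Re z) (Im z) => u v; nra.
have D0 : 0 < D.
  by rewrite lt_def rn_ge0 andbT; apply/eqP => E; rewrite E in DE; nra.
rewrite -mulrA ler_pM2l// mulrA exprVn; apply: min_ineq => //.
  by rewrite mulrAC ler_pdivrMr ?exprn_gt0//; move: DE; move: (D ^+ 2) => Y DE; nra.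
by rewrite mulrAC ler_pdivrMr ?exprn_gt0//; move: DE; move: (D ^+ 2) => Y DE; nra.
Qed.

(** Blaschke products omitting one node, divided by their values there, are
    bounded by the Carleson condition; the peaks multiplying them have a bounded
    sum at every point, whatever the number of nodes. *)
Lemma interpolation (delta : R) : 0 < delta ->
  (forall n N, delta <= rn (bprod b (fun k => k != n) N (b n)%:C%C)) ->
  exists2 K : R, 0 <= K & forall N (eps : nat -> C), (forall n, rn (eps n) <= 1) ->
    exists phi : C -> C, [/\ poly_approx phi, forall z, rn z <= 1 -> rn (phi z) <= K &
      forall n, (n < N)%N -> phi (b n)%:C%C = eps n].
Proof.
move=> d0 hd; case/andP: (q01) => q0 q1; have dq : 0 < 1 - q by lra.
exists (delta^-1 * (4 * (2 / (1 - q)))).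
  by rewrite !mulr_ge0 ?invr_ge0 ?(ltW d0)//; lra.
move=> N eps eps1.
pose B n := bprod b (fun k => k != n) N.
have Bn0 n : B n (b n)%:C%C != 0.
  by apply/eqP => E; have := hd n N; rewrite -/(B n) E rn0; lra.
have iB n : rn (B n (b n)%:C%C)^-1 <= delta^-1.
  by rewrite rnV lef_pV2 ?posrE ?rn_gt0// hd.
exists (fun z => \sum_(n < N) eps n / B n (b n)%:C%C * (B n z * peak n z)); split.
- apply: poly_approx_sum => n _; apply: poly_approxZ; apply: poly_approxM; last exact: poly_approx_peak.
  exact: poly_approx_bprod.
- move=> z z1; have [zw|w0] := eqVneq (rn (1 - z)) 0.
    rewrite big1 ?rn0 ?mulr_ge0 ?invr_ge0 ?(ltW d0) ?(ltW dq)// => n _.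
    by rewrite /peak (rn0_eq zw) mul0r !mulr0.
  have {}w0 : 0 < rn (1 - z) by rewrite lt_def w0 rn_ge0.
  rewrite (le_trans (rn_sum _ _ _))//.
  apply: (@le_trans _ _ (\sum_(n < N) delta^-1 *
    (4 * Num.min ((1 - b n) / rn (1 - z)) (rn (1 - z) / (1 - b n))))).
    apply: ler_sum => n _; rewrite rnM.
    apply: ler_pM; rewrite ?rn_ge0//.
      by rewrite rnM -[leRHS]mul1r; apply: ler_pM; rewrite ?rn_ge0.
    rewrite rnM -[leRHS]mul1r; apply: ler_pM; rewrite ?rn_ge0//.
      exact: bprod_le1.
    exact: peak_le.
  rewrite -mulr_sumr -mulr_sumr ler_pM2l ?invr_gt0// ler_pM2l//.
  exact: (geom_sum a0 q01 bq).
move=> m mN; rewrite (bigD1 (Ordinal mN))//= [X in _ + X]big1 ?addr0.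
  by rewrite peak1 mulr1 divfK.
move=> n nm; suff -> : B n (b m)%:C%C = 0 by rewrite mul0r mulr0.
have mn : (Ordinal mN : nat) != n :> nat by rewrite eq_sym.
by rewrite /B /bprod (bigD1 (Ordinal mN))//= {1}/bfactor subrr !mul0r.
Qed.

End estimates.
End Carleson.

(** * The complex exponential *)
Section ComplexExp.
Variable R : realType.
Local Notation C := R[i].
Implicit Types (x y : R) (a b z : C).

Lemma sin_mvt y : 0 <= y -> exists2 c, 0 <= c <= y & sin y = cos c * y.
Proof.
move=> y0; have [|c] := @MVT_segment R sin cos 0 y y0 (fun x _ => is_derive_sin x).
  by apply: continuous_subspaceT => x; exact: continuous_sin.
by rewrite in_itv /= sin0 !subr0 => cy E; exists c.
Qed.

Lemma sin_le_abs y : `|sin y| <= `|y|.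
Proof.
wlog y0 : y / 0 <= y => [H|].
  have [/H//|/ltW y0] := leP 0 y.
  by have := H (- y); rewrite sinN !normrN oppr_ge0; exact.
have [c _ ->] := sin_mvt y0.
by rewrite normrM ler_piMl// cos_max.
Qed.

Lemma one_minus_cos y : 0 <= 1 - cos y <= y ^+ 2 / 2.
Proof.
have -> : cos y = 1 - 2 * sin (y / 2) ^+ 2.
  rewrite {1}[y](_ : _ = (y / 2) *+ 2); last by rewrite -mulr_natr divfK ?pnatr_eq0.
  by rewrite cos_mulr2n cos2sin2; ring.
have h : sin (y / 2) ^+ 2 <= (y / 2) ^+ 2.
  rewrite -(real_normK (num_real (sin _))) -[leRHS](real_normK (num_real _)).
  by rewrite lerXn2r ?nnegrE ?normr_ge0// sin_le_abs.
have hs := sqr_ge0 (sin (y / 2)); apply/andP; split; nra.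
Qed.

Lemma sin_near y : `|sin y - y| <= `|y| ^+ 3 / 2.
Proof.
wlog y0 : y / 0 <= y => [H|].
  have [/H//|/ltW y0] := leP 0 y.
  have := H (- y); rewrite sinN opprK -opprB normrN addrC normrN oppr_ge0.
  by rewrite addrC; exact.
have [c /andP[c0 cy] ->] := sin_mvt y0.
rewrite -[X in _ - X]mul1r -mulrBl normrM (ger0_norm y0) -normrN opprB.
have /andP[h1 h2] := one_minus_cos c; rewrite (ger0_norm h1) exprSr mulrAC ler_wpM2r//.
by rewrite (le_trans h2)// ler_pM2r// lerXn2r ?nnegrE.
Qed.

Lemma expR_near x : x <= 2^-1 -> 0 <= expR x - 1 - x <= 2 * x ^+ 2.
Proof.
move=> xh; have h1 := expR_ge1Dx x; apply/andP; split; first lra.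
have h2 := expR_ge1Dx (- x); rewrite expRN in h2.
have d0 : 0 < 1 - x by lra.
have h3 : expR x <= (1 - x)^-1.
  by rewrite -[expR x]invrK lef_pV2 ?posrE ?invr_gt0 ?expR_gt0.
have h4 : (1 - x)^-1 <= 1 + x + 2 * x ^+ 2.
  by rewrite -[leLHS]mul1r ler_pdivrMr//; have := sqr_ge0 x; nra.
lra.
Qed.

Lemma cexpD a b : cexp (a + b) = cexp a * cexp b.
Proof.
rewrite /cexp; case: a b => [a a'] [b b'] /=; rewrite expRD cosD sinD.
apply/eqP; rewrite eq_complex /=; apply/andP; split; apply/eqP; ring.
Qed.

Lemma cexp0 : cexp 0 = 1 :> C.
Proof. by rewrite /cexp /= expR0 cos0 sin0; apply/eqP; rewrite eq_complex /= !mul1r !mul0r subr0 addr0 !eqxx. Qed.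

Lemma cexpX a n : cexp (a *+ n) = cexp a ^+ n.
Proof. by elim: n => [|n IH]; rewrite ?mulr0n ?expr0 ?cexp0// mulrS exprS cexpD IH. Qed.

Lemma rn_cexp a : rn (cexp a) = expR (Re a).
Proof.
rewrite /cexp rnM rnr gtr0_norm ?expR_gt0// -[RHS]mulr1; congr (_ * _).
apply/eqP; rewrite -(eqrXn2 (n := 2)) ?rn_ge0// rn_sqr /= cos2Dsin2 expr1n.
by [].
Qed.

Lemma cexp_near b : rn b <= 2^-1 -> rn (cexp b - 1 - b) <= 8 * rn b ^+ 2.
Proof.
move=> bh; have := Re_le_rn b; have := Im_le_rn b.
case: b bh => x y bh /= yh xh; move: bh yh xh; set r := rn _ => bh yh xh.
have r0 : 0 <= r := rn_ge0 _.
rewrite (le_trans (rn_le_ReIm _))// /cexp /= !mul0r subr0 addr0.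
have /andP[c0 c1] := one_minus_cos y; have s1 := sin_near y; have s2 := sin_le_abs y.
have x1 : x <= 2^-1 by have := ler_norm x; lra.
have /andP[e0 e1] := expR_near x1.
have X2 : x ^+ 2 <= r ^+ 2 by rewrite -(real_normK (num_real x)) lerXn2r ?nnegrE.
have Y2 : y ^+ 2 <= r ^+ 2 by rewrite -(real_normK (num_real y)) lerXn2r ?nnegrE.
have Y3 : `|y| ^+ 3 <= r ^+ 2.
  by rewrite exprS real_normK ?num_real//; have := normr_ge0 y; have := sqr_ge0 y; nra.
have E2 : 0 < expR x <= 2.
  by rewrite expR_gt0; have := ler_norm x; nra.
case/andP: E2 => E0 E2.
have h1 : `|expR x * cos y - 1 - x| <= 4 * r ^+ 2.
  have -> : expR x * cos y - 1 - x = (expR x - 1 - x) - expR x * (1 - cos y) by ring.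
  rewrite ler_norml; apply/andP; split; nra.
have h2 : `|expR x * sin y - y| <= 4 * r ^+ 2.
  have -> : expR x * sin y - y = (expR x - 1) * sin y + (sin y - y) by ring.
  rewrite (le_trans (ler_normD _ _))// normrM.
  have e2 : `|expR x - 1| <= 2 * r.
    by rewrite ler_norml; move: xh; rewrite ler_norml => /andP[xl xr]; apply/andP; split; nra.
  have : `|expR x - 1| * `|sin y| <= 2 * r * r.
    by apply: ler_pM; rewrite ?normr_ge0// (le_trans s2).
  lra.
by rewrite !oppr0 !addr0 -?addrA; move: h1 h2; rewrite -!addrA; lra.
Qed.

Lemma pow_sub_le (a b : C) (r : R) n : rn a <= r -> rn b <= r ->
  rn (a ^+ n - b ^+ n) <= n%:R * r ^+ n.-1 * rn (a - b).
Proof.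
move=> ar br; have r0 : 0 <= r by rewrite (le_trans (rn_ge0 a)).
elim: n => [|n IH]; first by rewrite !expr0 subrr rn0 !mul0r.
have -> : a ^+ n.+1 - b ^+ n.+1 = a * (a ^+ n - b ^+ n) + (a - b) * b ^+ n.
  by rewrite !exprS; ring.
rewrite (le_trans (rnD _ _))// !rnM rnX -[n.+1]addn1 natrD mulrDl mulrDl addn1 /=.
apply: lerD; last first.
  by rewrite mul1r mulrC ler_wpM2r ?rn_ge0// lerXn2r ?nnegrE ?rn_ge0.
have h : rn a * rn (a ^+ n - b ^+ n) <= r * (n%:R * r ^+ n.-1 * rn (a - b)).
  by apply: ler_pM; rewrite ?rn_ge0.
rewrite (le_trans h)//; case: n {IH h} => [|n]; first by rewrite !mul0r mulr0.
by rewrite /= exprS; apply/eqP/eqP; lra.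
Qed.

(** Compare 1 + a / n with exp (a / n), which differ by O(1 / n^2), and take
    n-th powers. *)
Lemma cexp_tends a : tends (fun m => (1 + (inv_succ R m)%:C%C * a) ^+ m.+1) (cexp a).
Proof.
set A := rn a; have A0 : 0 <= A := rn_ge0 a.
move=> e e0; pose K := expR A * (8 * A ^+ 2) + 1.
have K0 : 0 < K by rewrite /K ltr_pwDr// mulr_ge0 ?expR_ge0// mulr_ge0// sqr_ge0.
have [|N hN] := @inv_succ_small R (e / K); first by rewrite divr_gt0.
have [|M hM] := @inv_succ_small R (2^-1 / (A + 1)); first by rewrite divr_gt0//; lra.
exists (N + M)%N => m Nm.
have {}hN := hN m (leq_trans (leq_addr _ _) Nm).
have {}hM := hM m (leq_trans (leq_addl _ _) Nm).
have v0 := @inv_succ_gt0 R m; set v := inv_succ R m in hN hM v0 *.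
have vn : m.+1%:R * v = 1 by rewrite /v /inv_succ mulfV ?pnatr_eq0.
have rv : rn (v%:C%C * a) = v * A by rewrite rnM rnr gtr0_norm.
have vA : v * A <= 2^-1.
  by move: hM; rewrite ltr_pdivlMr; [nra|lra].
have E : cexp a = cexp (v%:C%C * a) ^+ m.+1.
  rewrite -cexpX -mulr_natl mulrA -(rmorph_nat (real_complex R)) -rmorphM /= vn.
  by rewrite rmorph1 mul1r.
have b1 : rn (1 + v%:C%C * a) <= expR (v * A).
  by rewrite (le_trans (rnD _ _))// rn1 rv expR_ge1Dx.
have b2 : rn (cexp (v%:C%C * a)) <= expR (v * A).
  by rewrite rn_cexp ler_expR -rv (le_trans (ler_norm _))// Re_le_rn.
rewrite E; apply: le_lt_trans (pow_sub_le m.+1 b1 b2) _.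
have h1 : rn (1 + v%:C%C * a - cexp (v%:C%C * a)) <= 8 * (v * A) ^+ 2.
  by rewrite rnBC opprD addrA -rv cexp_near// rv.
have h2 : expR (v * A) ^+ m <= expR A.
  rewrite -expRM_natl ler_expR mulrA -[leRHS]mul1r ler_wpM2r//.
  have : (m%:R : R) <= m.+1%:R by rewrite ler_nat.
  by move: vn v0; move: (m.+1%:R) (m%:R : R) => p q; nra.
rewrite ltr_pdivlMr// in hN; apply: le_lt_trans hN.
rewrite /=.
have h3 : expR (v * A) ^+ m * rn (1 + v%:C%C * a - cexp (v%:C%C * a)) <= expR A * (8 * (v * A) ^+ 2).
  by apply: ler_pM; rewrite ?rn_ge0 ?exprn_ge0 ?expR_ge0.
rewrite -mulrA; apply: (@le_trans _ _ (m.+1%:R * (expR A * (8 * (v * A) ^+ 2)))).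
  by rewrite ler_wpM2l ?ler0n.
have -> : m.+1%:R * (expR A * (8 * (v * A) ^+ 2)) = (m.+1%:R * v) * (v * (expR A * (8 * A ^+ 2))) by ring.
by rewrite vn mul1r ler_wpM2l ?(ltW v0)// /K lerDl.
Qed.

(** * Exponentials of analytic functions *)
Lemma taylor_dilate_bounded (F : C -> C) c (r : R) : taylor_coefs F c -> 0 < r < 1 ->
  exists2 A : R, 0 <= A & forall z, rn z < 1 -> rn (F (r%:C%C * z)) <= A.
Proof.
move=> tc /andP[r0 r1].
pose s : R := (1 + r) / 2.
have s1 : s < 1 by rewrite /s; lra.
have s0 : 0 < s by rewrite /s; lra.
have rs : r < s by rewrite /s; lra.
clearbody s; have [|h hE] := @taylor_dilate R F c s tc; first by rewrite s0 s1.
have q1 : rn ((r / s)%:C%C : C) < 1.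
  by rewrite rnr gtr0_norm ?divr_gt0// ltr_pdivrMr// mul1r.
exists (rn h * rn (kern (r / s)%:C%C)); first by rewrite mulr_ge0 ?rn_ge0.
move=> z z1; have zz : rn ((r / s)%:C%C * z) <= rn ((r / s)%:C%C : C).
  by rewrite rnM ler_piMr ?rn_ge0// ltW.
have zz1 := le_lt_trans zz q1.
have -> : F (r%:C%C * z) = psum h ((r / s)%:C%C * z).
  rewrite hE//; congr F; rewrite mulrA -rmorphM /= mulrCA divff ?mulr1//.
  by rewrite gt_eqF.
by rewrite (le_trans (rn_psum _ zz1))// ler_wpM2l ?rn_ge0// kern_mono.
Qed.

Lemma mult_cst (a : C) : mult (fun=> a) (rn a).
Proof. by move=> f; exists (a *: f); rewrite rnZ; split=> // z z1; rewrite psumZ. Qed.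

Lemma multX (phi : C -> C) (M : R) n : 0 <= M -> mult phi M -> mult (fun z => phi z ^+ n) (M ^+ n).
Proof.
move=> M0 H; elim: n => [|n IH].
  by apply: (mult_ext (phi := fun=> 1)) => //; rewrite expr0 -(rn1 R); exact: mult_cst.
rewrite exprS; apply: (mult_ext (phi := fun z => phi z * phi z ^+ n)).
  by move=> z z1; rewrite exprS.
exact: multM.
Qed.

Lemma psum_mult (h : hardy R) (phi : C -> C) (M : R) :
  (forall z, rn z < 1 -> psum h z = phi z) ->
  (forall z, rn z < 1 -> rn (phi z) <= M) -> mult phi M.
Proof.
move=> E hM; apply: (mult_ext E); apply: bounded_mult => z z1.
by rewrite E// hM.
Qed.

(** The dilates of F are bounded, hence the powers (1 + F / m)^m of a dilate are
    multipliers with a common bound, and so is their limit. Its supremum is at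
    most exp M, a bound that does not depend on the dilation. *)
Lemma mult_cexp (F : C -> C) c (M : R) : taylor_coefs F c ->
  (forall z, rn z < 1 -> Re (F z) <= M) -> mult (fun z => cexp (F z)) (expR M).
Proof.
move=> tc FM.
have cont z (u : nat -> C) : tends u z -> tends (fun n => cexp (u n)) (cexp z).
  move=> h; apply: (tends_ext (u := fun n => cexp z * cexp (u n - z))).
    by move=> n; rewrite -cexpD addrC subrK.
  rewrite -[X in tends _ X]mulr1; apply: tendsMl => e e0.
  have [|N hN] := h (Num.min 2^-1 (e / 6)).
    by rewrite lt_min divr_gt0// invr_gt0 ltr0n.
  exists N => n /hN; rewrite lt_min => /andP[h1 h2].
  have := cexp_near (ltW h1).
  have := rn_tri (u n - z + 1) (cexp (u n - z)) 1.
  rewrite addrK opprD addrA [_ - (u n - z) - 1]addrAC.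
  have := rn_ge0 (u n - z); move: (rn (u n - z)) h1 h2 => t h1 h2 t0; nra.
apply: (@mult_limit R (fun n z => cexp (F (dil_radius R n.+1 * z)))) => [j|z z1]; last first.
  by apply: cont; exact: tends_S (taylor_radial tc z1).
have [h hE] := taylor_dilate tc (@rad01 R j).
have [A A0 hA] := taylor_dilate_bounded tc (@rad01 R j).
have mF : mult (fun z => F (dil_radius R j.+1 * z)) A.
  by apply: (psum_mult hE) => z z1; exact: hA.
apply: (@mult_sup R _ (expR A)); last first.
  move=> z z1; rewrite rn_cexp ler_expR FM//.
  by rewrite (le_lt_trans (rad_mul _ _)).
apply: (@mult_limit R (fun m z => (1 + (inv_succ R m)%:C%C * F (dil_radius R j.+1 * z)) ^+ m.+1) (fun z => cexp (F (dil_radius R j.+1 * z))) (expR A)) => [m|z z1]; last exact: cexp_tends.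
apply: (@mult_weaken R _ ((1 + inv_succ R m * A) ^+ m.+1)).
  have v0 := @inv_succ_gt0 R m.
  apply: (@le_trans _ _ (expR (inv_succ R m * A) ^+ m.+1)).
    by rewrite lerXn2r ?nnegrE ?expR_ge0 ?expR_ge1Dx// addr_ge0// mulr_ge0// ltW.
  by rewrite -expRM_natl ler_expR mulrA /inv_succ mulfV ?pnatr_eq0// mul1r.
apply: multX; first by rewrite addr_ge0// mulr_ge0// ltW// inv_succ_gt0.
apply: (@psum_mult (kern 0 + (inv_succ R m)%:C%C *: h)) => z z1.
  by rewrite psumD// psum_kern0// psumZ// hE.
rewrite (le_trans (rnD _ _))// rn1 lerD2l rnM rnr gtr0_norm ?inv_succ_gt0//.
by rewrite ler_wpM2l ?hA// ltW// inv_succ_gt0.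
Qed.

End ComplexExp.

(** * Herglotz integrals *)
Section Herglotz.
Variable R : realType.
Local Notation C := R[i].
Local Notation mu := (@lebesgue_measure R).
Local Notation circ := (`[0, 2 * pi]%classic : set R).
Implicit Types (t x y : R) (a b z u : C) (k : R -> R) (F G : R -> C).

Definition L1 k := mu.-integrable circ (EFin \o k).

Definition circle_mean k : R := (2 * pi)^-1 * \int[mu]_(t in circ) k t.

(** The Herglotz integral is the case where [F] is the Herglotz kernel; complex
    values are integrated componentwise. *)
Definition cint k F : C :=
  (circle_mean (fun t => Re (F t) * k t) +i* circle_mean (fun t => Im (F t) * k t))%C.

Lemma herglotzE k z : herglotz k z = cint k (herglotz_kernel z).
Proof. by []. Qed.

(** Componentwise measurability, as the integrals are taken componentwise. *)
Definition bdd_meas F (A : R) := [/\ measurable_fun setT (fun t => Re (F t)),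
  measurable_fun setT (fun t => Im (F t)) & forall t, rn (F t) <= A].

Lemma mcirc : measurable (circ : set (measurableTypeR R)).
Proof. exact: measurable_itv. Qed.

Lemma L1_mul k (phi : R -> R) (A : R) : L1 k -> measurable_fun setT phi ->
  (forall t, `|phi t| <= A) -> L1 (fun t => phi t * k t).
Proof.
move=> ik mphi bphi.
have iA : mu.-integrable circ (fun t => (A%:E * (k t)%:E)%E).
  exact: (integrableZl mcirc A ik).
apply: (le_integrable mcirc _ _ iA) => [|t _].
  apply/measurable_EFinP; apply: measurable_funM.
    exact: measurable_funTS.
  by apply/measurable_EFinP; case/integrableP: ik.
have A0 : 0 <= A := le_trans (normr_ge0 _) (bphi 0).
by rewrite /= lee_fin !normrM (ger0_norm A0) ler_wpM2r.
Qed.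

Lemma circle_meanD k1 k2 : L1 k1 -> L1 k2 ->
  circle_mean (fun t => k1 t + k2 t) = circle_mean k1 + circle_mean k2.
Proof. by move=> h1 h2; rewrite /circle_mean (RintegralD mcirc h1 h2) mulrDr. Qed.

Lemma circle_meanZ k (c : R) : L1 k -> circle_mean (fun t => c * k t) = c * circle_mean k.
Proof. by move=> h; rewrite /circle_mean (RintegralZl c mcirc h) mulrCA. Qed.

Lemma circle_mean_eq k1 k2 : k1 =1 k2 -> circle_mean k1 = circle_mean k2.
Proof. by move=> h; congr circle_mean; exact/funext. Qed.

Lemma pi2_gt0 : 0 < 2 * pi :> R.
Proof. by rewrite mulr_gt0// pi_gt0. Qed.

Lemma circle_mean_le0 k : L1 k -> (forall t, k t <= 0) -> circle_mean k <= 0.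
Proof.
move=> ik h; have := circle_meanZ (-1) ik; rewrite mulN1r => E.
rewrite -oppr_ge0 -E /circle_mean mulr_ge0 ?invr_ge0 ?(ltW pi2_gt0)//.
by apply: Rintegral_ge0 => t _; rewrite mulN1r oppr_ge0.
Qed.

Lemma circle_mean_abs k (phi : R -> R) (A : R) : L1 k -> measurable_fun setT phi ->
  (forall t, `|phi t| <= A) ->
  `|circle_mean (fun t => phi t * k t)| <= A * circle_mean (fun t => `|k t|).
Proof.
move=> ik mphi bphi; have i1 := L1_mul ik mphi bphi.
have ia : L1 (fun t => `|k t|) by exact: integrable_norm.
have p0 : 0 <= (2 * pi)^-1 :> R by rewrite invr_ge0 ltW// pi2_gt0.
rewrite /circle_mean normrM (ger0_norm p0) mulrCA ler_wpM2l//.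
apply: (le_trans (le_normr_Rintegral mcirc i1)).
rewrite -(RintegralZl A mcirc ia).
apply: le_Rintegral.
- exact: mcirc.
- exact: (integrable_norm i1).
- exact: (integrableZl mcirc A ia).
- by move=> t _; rewrite normrM ler_wpM2r.
Qed.

Section cint.
Variable k : R -> R.
Hypothesis ik : L1 k.

Lemma bdd_meas_re F A : bdd_meas F A -> L1 (fun t => Re (F t) * k t).
Proof.
by move=> [h _ b]; apply: (L1_mul (A := A)) => // t; exact: le_trans (Re_le_rn _) (b t).
Qed.

Lemma bdd_meas_im F A : bdd_meas F A -> L1 (fun t => Im (F t) * k t).
Proof.
by move=> [_ h b]; apply: (L1_mul (A := A)) => // t; exact: le_trans (Im_le_rn _) (b t).
Qed.

Lemma cintD F G A B : bdd_meas F A -> bdd_meas G B -> cint k (fun t => F t + G t) = cint k F + cint k G.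
Proof.
move=> hF hG; apply/eqP; rewrite eq_complex /=; apply/andP; split; apply/eqP.
  rewrite -(circle_meanD (bdd_meas_re hF) (bdd_meas_re hG)); apply: circle_mean_eq => t.
  by rewrite raddfD mulrDl.
rewrite -(circle_meanD (bdd_meas_im hF) (bdd_meas_im hG)); apply: circle_mean_eq => t.
by rewrite raddfD mulrDl.
Qed.

Lemma cintZ a F A : bdd_meas F A -> cint k (fun t => a * F t) = a * cint k F.
Proof.
move=> hF; case: a => x y; apply/eqP; rewrite eq_complex /=; apply/andP; split; apply/eqP.
  rewrite -mulNr -(circle_meanZ x (bdd_meas_re hF)) -(circle_meanZ (- y) (bdd_meas_im hF)).
  rewrite -circle_meanD; last 2 first.
  - exact: (integrableZl mcirc x (bdd_meas_re hF)).
  - exact: (integrableZl mcirc (- y) (bdd_meas_im hF)).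
  by apply: circle_mean_eq => t; case: (F t) => u v /=; ring.
rewrite -(circle_meanZ y (bdd_meas_re hF)) -(circle_meanZ x (bdd_meas_im hF)).
rewrite addrC -circle_meanD; last 2 first.
- exact: (integrableZl mcirc y (bdd_meas_re hF)).
- exact: (integrableZl mcirc x (bdd_meas_im hF)).
by apply: circle_mean_eq => t; case: (F t) => u v /=; ring.
Qed.

Lemma cint_le F A : bdd_meas F A -> rn (cint k F) <= 2 * (A * circle_mean (fun t => `|k t|)).
Proof.
move=> [h1 h2 b]; rewrite (le_trans (rn_le_ReIm _))//=.
have e1 := circle_mean_abs ik h1 (fun t => le_trans (Re_le_rn _) (b t)).
have e2 := circle_mean_abs ik h2 (fun t => le_trans (Im_le_rn _) (b t)).
by rewrite mulrDl !mul1r; exact: lerD.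
Qed.
End cint.

Lemma bdd_meas_ext F G A : (forall t, F t = G t) -> bdd_meas F A -> bdd_meas G A.
Proof. by move=> h; rewrite (_ : F = G)//; exact/funext. Qed.

Lemma bdd_measD F G A B : bdd_meas F A -> bdd_meas G B -> bdd_meas (fun t => F t + G t) (A + B).
Proof.
move=> [h1 h2 h3] [g1 g2 g3]; split.
- rewrite (_ : (fun t => _) = (fun t => Re (F t) + Re (G t))); first exact: measurable_funD.
  by apply/funext => t; rewrite raddfD.
- rewrite (_ : (fun t => _) = (fun t => Im (F t) + Im (G t))); first exact: measurable_funD.
  by apply/funext => t; rewrite raddfD.
- by move=> t; rewrite (le_trans (rnD _ _))// lerD.
Qed.

Lemma bdd_measM F G A B : bdd_meas F A -> bdd_meas G B -> bdd_meas (fun t => F t * G t) (A * B).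
Proof.
move=> [h1 h2 h3] [g1 g2 g3]; split.
- rewrite (_ : (fun t => _) = (fun t => Re (F t) * Re (G t) - Im (F t) * Im (G t))).
    by apply: measurable_funB; apply: measurable_funM.
  by apply/funext => t; case: (F t); case: (G t).
- rewrite (_ : (fun t => _) = (fun t => Re (F t) * Im (G t) + Im (F t) * Re (G t))).
    by apply: measurable_funD; apply: measurable_funM.
  by apply/funext => t; case: (F t); case: (G t).
- by move=> t; rewrite rnM ler_pM ?rn_ge0.
Qed.

Lemma bdd_meas_cst a : bdd_meas (fun=> a) (rn a).
Proof. by split=> //; exact: measurable_cst. Qed.

Definition expNi t : C := (cos t -i* sin t)%C.

Lemma rn_expNi t : rn (expNi t) = 1.
Proof.
apply/eqP; rewrite -(eqrXn2 (n := 2)) ?rn_ge0// rn_sqr /= sqrrN cos2Dsin2 expr1n.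
by [].
Qed.

Lemma bdd_meas_expNi : bdd_meas expNi 1.
Proof.
split=> [||t]; last by rewrite rn_expNi.
- by apply: continuous_measurable_fun => t; exact: continuous_cos.
- rewrite /=; apply: measurableT_comp; first exact: oppr_measurable.
  by apply: continuous_measurable_fun => t; exact: continuous_sin.
Qed.

Lemma bdd_measX F n : bdd_meas F 1 -> bdd_meas (fun t => F t ^+ n) 1.
Proof.
move=> h; elim: n => [|n IH].
  by rewrite -(rn1 R); apply: bdd_meas_ext (bdd_meas_cst 1) => t; rewrite expr0.
by rewrite -(mulr1 1); apply: bdd_meas_ext (bdd_measM h IH) => t; rewrite exprS.
Qed.

Lemma expNiX t n : expNi t ^+ n = (cos (n%:R * t) -i* sin (n%:R * t))%C.
Proof.
elim: n => [|n IH]; first by rewrite expr0 mul0r cos0 sin0 oppr0.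
rewrite exprS IH -natr1 mulrDl mul1r cosD sinD.
by apply/eqP; rewrite eq_complex /=; apply/andP; split; apply/eqP; ring.
Qed.

Lemma kernelE z t : rn z < 1 -> herglotz_kernel z t = (1 + z * expNi t) / (1 - z * expNi t).
Proof.
move=> z1; rewrite /herglotz_kernel /=.
have -> : (cos t +i* sin t)%C = (expNi t)^-1.
  have w0 : expNi t != 0.
    by apply/eqP => E; have := rn_expNi t; rewrite E rn0 => /esym/eqP; rewrite oner_eq0.
  apply: (mulIf w0); rewrite mulVf// /expNi; apply/eqP; rewrite eq_complex /=.
  by rewrite mulrN opprK -!expr2 cos2Dsin2 eqxx mulrN mulrC addNr eqxx.
have w0 : expNi t != 0.
  by apply/eqP => E; have := rn_expNi t; rewrite E rn0 => /esym/eqP; rewrite oner_eq0.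
have -> : (expNi t)^-1 + z = (expNi t)^-1 * (1 + z * expNi t).
  by rewrite mulrDr mulr1 mulrCA mulVf// mulr1.
have -> : (expNi t)^-1 - z = (expNi t)^-1 * (1 - z * expNi t).
  by rewrite mulrBr mulr1 mulrCA mulVf// mulr1.
by rewrite -mulf_div divff ?invr_eq0// mul1r.
Qed.

(** The Herglotz kernel is 1 + 2 sum_(n > 0) z^n exp(- i n t). *)
Definition coefk n t : C := (if n is 0 then 1 else 2) * expNi t ^+ n.

Lemma rn2 : rn (2 : C) = 2.
Proof. by rewrite -[2]/(2%:R) /rn ger0_norm ?ler0n. Qed.

Lemma bdd_meas_coefk n : bdd_meas (coefk n) 2.
Proof.
have [h1 h2 h3] := bdd_measM (bdd_meas_cst (if n is 0 then 1 else 2)) (bdd_measX n bdd_meas_expNi).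
split=> // t; rewrite (le_trans (h3 t))// mulr1.
by case: n {h1 h2 h3} => [|n]; rewrite ?rn1 ?rn2 ?ler1n.
Qed.

Lemma kernel_series z t N : rn z < 1 ->
  herglotz_kernel z t - \sum_(n < N.+1) z ^+ n * coefk n t
  = 2 * (z * expNi t) ^+ N.+1 / (1 - z * expNi t).
Proof.
move=> z1; have d0 : 1 - z * expNi t != 0 by apply: sub1_neq0 => //; rewrite rn_expNi.
elim: N => [|N IH].
  rewrite big_ord_recl big_ord0 addr0 /coefk /= !expr0 mulr1 kernelE// expr1.
  by field.
rewrite big_ord_recr /= opprD addrA IH /coefk mulrCA -exprMn.
by rewrite [in RHS]exprS; field.
Qed.

Lemma kernel_series_le z t N : rn z < 1 ->
  rn (herglotz_kernel z t - \sum_(n < N.+1) z ^+ n * coefk n t)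
  <= rn z ^+ N.+1 * (2 / (1 - rn z)).
Proof.
move=> z1; rewrite kernel_series// rnM rnM rn2 rnV rnX rnM rn_expNi mulr1.
rewrite mulrAC mulrC ler_wpM2l ?exprn_ge0 ?rn_ge0//.
have h : 1 - rn z <= rn (1 - z * expNi t).
  by have := rn_subl (1 : C) (z * expNi t); rewrite rn1 rnM rn_expNi mulr1.
by rewrite ler_wpM2l// lef_pV2 ?posrE ?subr_gt0// (lt_le_trans _ h)// subr_gt0.
Qed.

Lemma bdd_meas_kernel z : rn z < 1 -> exists A, bdd_meas (herglotz_kernel z) A.
Proof.
move=> z1.
pose n2 t : R := (cos t - Re z) ^+ 2 + (sin t - Im z) ^+ 2.
have rw t : rn (cos t +i* sin t : C)%C = 1.
  by apply/eqP; rewrite -(eqrXn2 (n := 2)) ?rn_ge0// rn_sqr /= cos2Dsin2 expr1n.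
have n20 t : n2 t != 0.
  have : n2 t = rn ((cos t +i* sin t)%C - z) ^+ 2 by rewrite rn_sqr /n2; case: (z).
  move=> ->; rewrite sqrf_eq0 gt_eqF// rn_gt0// subr_eq0; apply/eqP => E.
  by have := rw t; rewrite E => h; rewrite h ltxx in z1.
have cc : continuous (cos : R -> R) by exact: continuous_cos.
have cs : continuous (sin : R -> R) by exact: continuous_sin.
have mc : measurable_fun setT (cos : R -> R) by exact: continuous_measurable_fun.
have ms : measurable_fun setT (sin : R -> R) by exact: continuous_measurable_fun.
have c1 (a : R) (f : R -> R) : continuous f -> continuous (fun t => (f t - a) ^+ 2).
  move=> cf t; rewrite (_ : (fun t => (f t - a) ^+ 2) = (fun t => (f t - a) * (f t - a))).
    by apply: cvgM; apply: cvgB; [exact: cf|exact: cvg_cst|exact: cf|exact: cvg_cst].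
  by apply/funext => s; rewrite expr2.
have cn : continuous n2.
  by move=> t; apply: cvgD; [exact: (c1 (Re z) cos cc)|exact: (c1 (Im z) sin cs)].
have mn : measurable_fun setT (fun t => (n2 t)^-1).
  apply: continuous_measurable_fun => t; apply: cvgV; first exact: n20.
  exact: cn.
have mcst (a : R) : measurable_fun setT (fun _ : R => a) by exact: measurable_cst.
exists ((1 + rn z) / (1 - rn z)); split.
- rewrite (_ : (fun t => _) = (fun t => (cos t + Re z) * ((cos t - Re z) * (n2 t)^-1)
     + (sin t + Im z) * ((sin t - Im z) * (n2 t)^-1))).
    by apply: measurable_funD; (apply: measurable_funM; [exact: measurable_funD|apply: measurable_funM; [exact: measurable_funB|exact: mn]]).
  apply/funext => t; rewrite /herglotz_kernel /n2; case: (z) => x y /=.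
  by rewrite mulrN opprK.
- rewrite (_ : (fun t => _) = (fun t => (sin t + Im z) * ((cos t - Re z) * (n2 t)^-1)
     - (cos t + Re z) * ((sin t - Im z) * (n2 t)^-1))).
    by apply: measurable_funB; (apply: measurable_funM; [exact: measurable_funD|apply: measurable_funM; [exact: measurable_funB|exact: mn]]).
  apply/funext => t; rewrite /herglotz_kernel /n2; case: (z) => x y /=.
  by rewrite mulrN addrC.
move=> t; rewrite kernelE// rnM rnV; apply: ler_pM; rewrite ?invr_ge0 ?rn_ge0//.
  by rewrite (le_trans (rnD _ _))// rn1 rnM rn_expNi mulr1.
have h : 1 - rn z <= rn (1 - z * expNi t).
  by have := rn_subl (1 : C) (z * expNi t); rewrite rn1 rnM rn_expNi mulr1.
by rewrite lef_pV2 ?posrE ?subr_gt0// (lt_le_trans _ h)// subr_gt0.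
Qed.

(** The kernel k is the Cayley transform of a point u of the disc, so k - 1 = u
    (k + 1) and |k - 1| <= |k + 1|. *)
Lemma Re_kernel_ge0 z t : rn z < 1 -> 0 <= Re (herglotz_kernel z t).
Proof.
move=> z1; have d0 : 1 - z * expNi t != 0 by apply: sub1_neq0 => //; rewrite rn_expNi.
have u1 : rn (z * expNi t) < 1 by rewrite rnM rn_expNi mulr1.
rewrite kernelE//; set u := z * expNi t in d0 u1 *; set k := _ / _.
have E : k - 1 = u * (k + 1) by rewrite /k; field.
have h : rn (k - 1) ^+ 2 <= rn (k + 1) ^+ 2.
  by rewrite lerXn2r ?nnegrE ?rn_ge0// E rnM ler_piMl ?rn_ge0// ltW.
move: h; rewrite !rn_sqr; case: (k) => x y /=; nra.
Qed.

(** The expansion of the kernel in powers of z has a remainder that is small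
    uniformly in t, so it can be integrated term by term. *)
Lemma herglotz_taylor k : L1 k -> taylor_coefs (herglotz k) (fun n => cint k (coefk n)).
Proof.
move=> ik z; rewrite lt1C => z1.
have [A hA] := bdd_meas_kernel z1.
have H N : cint k (fun t => herglotz_kernel z t - \sum_(n < N) z ^+ n * coefk n t)
    = herglotz k z - \sum_(n < N) cint k (coefk n) * z ^+ n /\
    exists B, bdd_meas (fun t => herglotz_kernel z t - \sum_(n < N) z ^+ n * coefk n t) B.
  elim: N => [|N [IH [B hB]]].
    have e t : herglotz_kernel z t = herglotz_kernel z t - \sum_(n < 0) z ^+ n * coefk n t.
      by rewrite big_ord0 subr0.
    split; last by exists A; apply: bdd_meas_ext hA.
    rewrite big_ord0 subr0 herglotzE; congr (cint k _); apply/funext => t.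
    by rewrite -e.
  have bN := bdd_measM (bdd_meas_cst (- z ^+ N)) (bdd_meas_coefk N).
  have e t : (herglotz_kernel z t - \sum_(n < N) z ^+ n * coefk n t) + (- z ^+ N) * coefk N t
      = herglotz_kernel z t - \sum_(n < N.+1) z ^+ n * coefk n t.
    by rewrite big_ord_recr /= opprD addrA mulNr.
  split; last by eexists; apply: bdd_meas_ext (bdd_measD hB bN).
  rewrite -(funext e) (cintD ik hB bN) IH (cintZ ik _ (bdd_meas_coefk N)).
  by rewrite big_ord_recr /= opprD addrA mulNr [_ * z ^+ N]mulrC.
rewrite (_ : series _ = fun N => \sum_(n < N) cint k (coefk n) * z ^+ n); last first.
  by apply/funext => N; rewrite /series /= big_mkord.
apply/(tendsP (V := C)).
set L := circle_mean (fun t => `|k t|).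
move=> e e0.
have [|N hN] := @pow_small R (rn z) (2 * ((2 / (1 - rn z)) * L)) (e / 2) _ ltac:(lra).
  by rewrite rn_ge0.
exists N.+1 => -[//|n] Nn; rewrite rnBC -(H n.+1).1.
have [_ [B [h1 h2 _]]] := H n.+1.
have hb : bdd_meas (fun t => herglotz_kernel z t - \sum_(i < n.+1) z ^+ i * coefk i t)
    (rn z ^+ n.+1 * (2 / (1 - rn z))).
  by split=> // t; exact: kernel_series_le.
rewrite (le_lt_trans (cint_le ik hb))// -/L.
have := hN n.+1 (leqW Nn); rewrite -!mulrA mulrCA; lra.
Qed.

Lemma herglotzD k1 k2 z : L1 k1 -> L1 k2 -> rn z < 1 ->
  herglotz (fun t => k1 t + k2 t) z = herglotz k1 z + herglotz k2 z.
Proof.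
move=> i1 i2 /bdd_meas_kernel[A hA]; rewrite !herglotzE.
apply/eqP; rewrite eq_complex /=; apply/andP; split; apply/eqP.
  rewrite -(circle_meanD (bdd_meas_re i1 hA) (bdd_meas_re i2 hA)).
  by apply: circle_mean_eq => t; rewrite mulrDr.
rewrite -(circle_meanD (bdd_meas_im i1 hA) (bdd_meas_im i2 hA)).
by apply: circle_mean_eq => t; rewrite mulrDr.
Qed.

Lemma herglotz_le0 k z : L1 k -> (forall t, k t <= 0) -> rn z < 1 ->
  Re (herglotz k z) <= 0.
Proof.
move=> ik k0 z1; have [A hA] := bdd_meas_kernel z1.
rewrite herglotzE /=; apply: circle_mean_le0; first exact: bdd_meas_re hA.
by move=> t; rewrite mulr_ge0_le0// Re_kernel_ge0.
Qed.

Lemma herglotz_at0 k : herglotz k 0 = (circle_mean k)%:C%C.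
Proof.
have e t : herglotz_kernel 0 t = 1.
  by rewrite kernelE ?rn0// !mul0r addr0 subr0 divr1.
rewrite herglotzE (_ : herglotz_kernel 0 = fun=> 1); last exact/funext.
apply/eqP; rewrite eq_complex /=; apply/andP; split; apply/eqP.
  by apply: circle_mean_eq => t; rewrite mul1r.
rewrite (circle_mean_eq (k2 := fun=> 0)); last by move=> t; rewrite mul0r.
by rewrite /circle_mean Rintegral_cst ?mul0r ?mulr0//; exact: mcirc.
Qed.

Lemma mu_circ : mu circ = (2 * pi)%:E.
Proof.
have := lebesgue_measure_itv `[0 : R, 2 * pi].
by rewrite /= lte_fin pi2_gt0 oppr0 adde0.
Qed.

Lemma circle_mean_cst (a : R) : circle_mean (fun=> a) = a.
Proof.
rewrite /circle_mean Rintegral_cst; last exact: mcirc.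
rewrite [fine _](_ : _ = 2 * pi); last by exact: (congr1 fine mu_circ).
by rewrite mulrCA mulVf ?mulr1// gt_eqF// pi2_gt0.
Qed.

Lemma L1_cst (a : R) : L1 (fun=> a).
Proof.
apply: measurable_bounded_integrable; first exact: mcirc.
- have h : (mu circ < +oo)%E by rewrite mu_circ ltry.
  exact: h.
- exact: measurable_cst.
- by exists `|a|; split => // x ax t _; exact: ltW.
Qed.

Lemma expNi2pi n : expNi (2 * pi) ^+ n = 1.
Proof.
have -> : expNi (2 * pi) = 1.
  by rewrite /expNi mulr_natl cos2pi sin2pi; apply/eqP; rewrite eq_complex /= oppr0 !eqxx.
by rewrite expr1n.
Qed.

(** The fundamental theorem of calculus for a periodic primitive. *)
Lemma circle_mean_deriv (F f : R -> R) : (forall t, is_derive t (1 : R) F (f t)) ->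
  continuous f -> F (2 * pi) = F 0 -> circle_mean f = 0.
Proof.
move=> dF cf E.
have cF : continuous F.
  move=> t; apply: differentiable_continuous; apply/derivable1_diffP.
  by have [] := dF t.
rewrite /circle_mean /Rintegral (@continuous_FTC2 _ f F).
- by rewrite E subee// mulr0.
- exact: pi2_gt0.
- exact: continuous_subspaceT.
- split; [by move=> t _; have [] := dF t|..].
  + by apply: cvg_at_right_filter; exact: cF.
  + by apply: cvg_at_left_filter; exact: cF.
- by move=> t _; rewrite derive1E; have [_ ->] := dF t.
Qed.

Lemma circle_mean_cos n : circle_mean (fun t => cos (n.+1%:R * t)) = 0.
Proof.
have n0 : n.+1%:R != 0 :> R by rewrite pnatr_eq0.
apply: (@circle_mean_deriv (n.+1%:R^-1 \*: (sin \o (n.+1%:R \*: @id R)))).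
- move=> t; apply: is_derive_eq; rewrite /GRing.scale /= mulr1.
  by rewrite mulrCA mulVf// mulr1.
- by move=> t; apply: continuous_comp; [exact: mulrl_continuous|exact: continuous_cos].
- have := expNiX (2 * pi) n.+1; rewrite expNi2pi => /(congr1 (@Im R)) /= /esym/eqP.
  by rewrite oppr_eq0 /GRing.scale /= => /eqP ->; rewrite !mulr0 sin0 mulr0.
Qed.

Lemma circle_mean_sin n : circle_mean (fun t => sin (n.+1%:R * t)) = 0.
Proof.
have n0 : n.+1%:R != 0 :> R by rewrite pnatr_eq0.
apply: (@circle_mean_deriv ((- n.+1%:R^-1) \*: (cos \o (n.+1%:R \*: @id R)))).
- move=> t; apply: is_derive_eq; rewrite /GRing.scale /= mulr1.
  by rewrite mulNr mulNr mulrN opprK mulrCA mulVf// mulr1.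
- by move=> t; apply: continuous_comp; [exact: mulrl_continuous|exact: continuous_sin].
- have := expNiX (2 * pi) n.+1; rewrite expNi2pi => /(congr1 (@Re R)) /= <-.
  by rewrite /GRing.scale /= mulr0 cos0.
Qed.

(** All the coefficients of the kernel but the one of order 0 are trigonometric
    monomials, of mean 0. *)
Lemma herglotz_cst (a : R) z : rn z < 1 -> herglotz (fun=> a) z = a%:C%C.
Proof.
move=> z1; have zz : `|z| < 1 by rewrite lt1C.
have h := tendsC (herglotz_taylor (L1_cst a) zz).
apply: (tends_uniq h); apply: (tends_near (u := fun=> a%:C%C)); last exact: tends_cst.
exists 1%N => -[//|n] _; rewrite big_ord_recl /= expr0 mulr1 [X in _ + X]big1 ?addr0.
  rewrite (_ : coefk 0 = fun=> 1); last by apply/funext => t; rewrite /coefk expr0 mulr1.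
  apply/eqP; rewrite eq_complex /=; apply/andP; split; apply/eqP.
    by rewrite circle_mean_cst mul1r.
  by rewrite circle_mean_cst mul0r.
move=> i _; suff -> : cint (fun=> a) (coefk (lift ord0 i)) = 0 by rewrite mul0r.
have L1c m : L1 (fun t => cos (m%:R * t)).
  have h1 : measurable_fun setT (fun t : R => cos (m%:R * t)).
    by apply: continuous_measurable_fun => t; apply: continuous_comp; [exact: mulrl_continuous|exact: continuous_cos].
  have := L1_mul (L1_cst 1) h1 (fun t => cos_max _).
  by congr (L1 _); apply/funext => t; rewrite mulr1.
have L1s m : L1 (fun t => sin (m%:R * t)).
  have h1 : measurable_fun setT (fun t : R => sin (m%:R * t)).
    by apply: continuous_measurable_fun => t; apply: continuous_comp; [exact: mulrl_continuous|exact: continuous_sin].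
  have := L1_mul (L1_cst 1) h1 (fun t => sin_max _).
  by congr (L1 _); apply/funext => t; rewrite mulr1.
apply/eqP; rewrite eq_complex; apply/andP; split; apply/eqP; rewrite [RHS]/= [LHS]/=.
  rewrite (circle_mean_eq (k2 := fun t => (2 * a) * cos (i.+1%:R * t))).
    by rewrite circle_meanZ// circle_mean_cos mulr0.
  by move=> t; rewrite /coefk expNiX -[2 in LHS](rmorph_nat (real_complex R)) /=; ring.
rewrite (circle_mean_eq (k2 := fun t => (- (2 * a)) * sin (i.+1%:R * t))).
  by rewrite circle_meanZ// circle_mean_sin mulr0.
by move=> t; rewrite /coefk expNiX -[2 in LHS](rmorph_nat (real_complex R)) /=; ring.
Qed.

End Herglotz.

(** * Reflection in the real axis *)
Section Outer.
Variable R : realType.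
Local Notation C := R[i].
Local Notation H2 := (hardy R).
Local Notation mu := (@lebesgue_measure R).
Local Notation circ := (`[0, 2 * pi]%classic : set R).
Implicit Types (t : R) (z : C) (k : R -> R) (f h : H2).

Lemma hconj_ex f : exists g : H2, forall n, g n = (f n)^*.
Proof.
apply: (@hardy_exists R (fun n => (f n)^* ) (rn f ^+ 2)) => N.
by under eq_bigr do rewrite rn_conj; exact: bessel.
Qed.

Definition hconj f : H2 := sval (cid (hconj_ex f)).

Lemma hconjE f n : hconj f n = (f n)^*.
Proof. exact: svalP (cid (hconj_ex f)) n. Qed.

Lemma rn_hconj f : rn (hconj f) <= rn f.
Proof.
apply: hardy_rn_le; first exact: rn_ge0.
by move=> N; under eq_bigr do rewrite hconjE rn_conj; exact: bessel.
Qed.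

Lemma psum_hconj f z : rn z < 1 -> psum (hconj f) z = (psum f z^* )^*.
Proof.
move=> z1; have z1' : rn z^* < 1 by rewrite rn_conj.
apply: (tends_uniq (psum_tends (hconj f) z1)).
apply: tends_ext (tends_conj (psum_tends f z1')) => N.
rewrite rmorph_sum /=; apply: eq_bigr => n _.
by rewrite hconjE rmorphM rmorphXn /= conjCK.
Qed.

(** Conjugating the coefficients conjugates both the values and the variable. *)
Lemma mult_gstar (phi : C -> C) (M : R) : 0 <= M -> mult phi M -> mult (gstar phi) M.
Proof.
move=> M0 H f; have [h [h1 h2]] := H (hconj f).
exists (hconj h); split.
  by rewrite (le_trans (rn_hconj _))// (le_trans h1)// ler_wpM2l// rn_hconj.
move=> z z1; have z1' : rn z^* < 1 by rewrite rn_conj.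
by rewrite psum_hconj// h2// psum_hconj// rmorphM /= conjCK conjCK.
Qed.

(** * Truncations of an integrable weight *)
Lemma L1_cut k (c : R) : L1 k -> L1 (fun t => Num.min c (- k t)).
Proof.
move=> ik.
have i1 : L1 (fun t => `|c| + `|k t|).
  have := integrableD (@mcirc R) (L1_cst `|c|) (integrable_norm ik).
  by apply: eq_integrable => // t _.
apply: (le_integrable (@mcirc R) _ _ i1) => [|t _].
  apply/measurable_EFinP; apply: measurable_minr => //.
  apply: measurableT_comp; first exact: oppr_measurable.
  by apply/measurable_EFinP; case/integrableP: ik.
rewrite /= lee_fin [leRHS]ger0_norm ?addr_ge0//.
have h1 := ler_norm c; have h2 := ler_norm (- c); have h3 := ler_norm (k t).
have h4 := ler_norm (- k t); rewrite !normrN in h2 h4.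
by rewrite /Num.min; case: ifP => _; rewrite ler_norml; apply/andP; split; lra.
Qed.

Lemma cut_le0 (a b : R) : a + Num.min b (- a) <= 0.
Proof. by rewrite -lerBrDl sub0r ge_min lexx orbT. Qed.

Lemma cut_abs (a b : R) : 0 <= b -> `|a + Num.min b (- a)| <= `|a|.
Proof.
move=> b0; rewrite /Num.min; case: ifP => [h|_]; last by rewrite subrr normr0.
by rewrite ler0_norm ?ler0_norm//; lra.
Qed.

(** Dominated convergence: the truncated weight is 0 at t as soon as n >= |k t|.
    *)
Lemma cut_mean_tends k : L1 k ->
  (fun n : nat => circle_mean (fun t => k t + Num.min n%:R (- k t))) @ \oo --> (0 : R).
Proof.
move=> ik; pose fn (n : nat) (t : R) : R := k t + Num.min n%:R (- k t).
have ifn n : L1 (fn n).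
  have := integrableD (@mcirc R) ik (L1_cut n%:R ik).
  by apply: eq_integrable => // t _.
have [] := @dominated_convergence _ _ _ mu circ (@mcirc R) (fun n t => (fn n t)%:E)
   (fun=> 0%E) (fun t => `|k t|%:E).
- by move=> n; case/integrableP: (ifn n).
- exact: measurable_cst.
- apply: aeW => t _; apply: cvg_near_cst.
  exists (Num.truncn `|k t|).+1 => // n /= hn.
  rewrite /fn /Num.min ifF ?subrr//; apply/negbTE; rewrite -leNgt.
  have h1 := ler_norm (- k t); rewrite normrN in h1; rewrite (le_trans h1)//.
  by rewrite (le_trans (ltW (truncnS_gt _)))// ler_nat.
- exact: integrable_norm.
- by apply: aeW => t n _; rewrite lee_fin cut_abs// ler0n.
move=> _ _; rewrite integral0 => h.
have h2 : (fun n => \int[mu]_(t in circ) fn n t) @ \oo --> (0 : R).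
  by have /fine_cvgP[_] := h.
have := @cvgM _ _ _ _ _ _ _ _ (@cvg_cst _ ((2 * pi)^-1 : R) _ \oo _) h2.
by rewrite mulr0; exact.
Qed.

(** * Cyclicity of outer functions *)
Lemma dot_iter_fshift m f h : dot (iter m (@fshift R) f) h = dot f (iter m (@bshift R) h).
Proof. by elim: m f h => // m IH f h; rewrite iterS dot_fshift IH -iterSr. Qed.

(** Let g = c exp(H k), with H the Herglotz integral. The functions f_n = c^-1
    exp(H (min n (- k))) are bounded, and g f_n = exp(H (k + min n (- k))) has
    modulus at most 1, as its weight is nonpositive, and tends to 1 at the
    origin, as its weight tends to 0 in mean. A sequence of contractions whose
    values at the origin tend to 1 tends to 1 in H^2. So the m-th Taylor
    coefficient of a function orthogonal to all the z^m g f_n is 0. The same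
    holds for g_*, by reflection in the real axis. *)
Lemma outer_dense (g : C -> C) (M : R) : 0 <= M -> outer g -> mult g M ->
  forall (v : H2) (e : R), 0 < e -> exists f, rn (v - mulop (gstar g) f) < e.
Proof.
move=> M0 [c [k [c1 ik gE]]] mg v e e0.
have {}ik : L1 k by [].
have rc : rn c = 1 by apply: complexI; rewrite -rnE c1.
have c0 : c != 0 by apply/eqP => E; move: rc; rewrite E rn0 => /esym/eqP; rewrite oner_eq0.
have mgs := mult_gstar M0 mg.
pose kn (n : nat) t : R := Num.min n%:R (- k t).
have ikn n : L1 (kn n) := L1_cut n%:R ik.
pose fn n z : C := c^-1 * cexp (herglotz (kn n) z).
have mfn n : mult (fn n) (rn c^-1 * expR n%:R).
  apply: multM; [exact: rn_ge0|exact: mult_cst|].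
  apply: (mult_cexp (herglotz_taylor (ikn n))) => z z1.
  have i2 : L1 (fun t => kn n t - n%:R).
    have := integrableD (@mcirc R) (ikn n) (L1_cst (- n%:R)).
    by apply: eq_integrable => // t _.
  have -> : kn n = (fun t => (kn n t - n%:R) + n%:R) by apply/funext => t; rewrite subrK.
  rewrite herglotzD//; last exact: L1_cst.
  rewrite herglotz_cst// raddfD /= -[leRHS]add0r lerD2r.
  by apply: herglotz_le0 => // t; rewrite subr_le0 /kn ge_min lexx.
pose th n z : C := cexp (herglotz (fun t => k t + kn n t) z).
have isum n : L1 (fun t => k t + kn n t).
  have := integrableD (@mcirc R) ik (ikn n).
  by apply: eq_integrable => // t _.
have mth n : mult (th n) 1.
  rewrite -expR0; apply: (mult_cexp (herglotz_taylor (isum n))) => z z1.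
  by apply: herglotz_le0 => // t; exact: cut_le0.
have thE n z : rn z < 1 -> th n z = g z * fn n z.
  move=> z1; rewrite gE ?lt1C// /th /fn herglotzD// cexpD.
  by rewrite [RHS]mulrACA divff// mul1r.
have /choice[u hu] n : exists h : H2, rn h <= 1 /\ forall z, rn z < 1 -> psum h z = gstar (th n) z.
  by have [h h1 h2] := mult_hardy (mult_gstar ler01 (mth n)); exists h.
have /choice[w hw] n : exists h : H2, forall z, rn z < 1 -> psum h z = gstar (fn n) z.
  have M1 : 0 <= rn c^-1 * expR n%:R by rewrite mulr_ge0 ?rn_ge0 ?expR_ge0.
  by have [h _ h2] := mult_hardy (mult_gstar M1 (mfn n)); exists h.
have uw n : mulop (gstar g) (w n) = u n.
  apply: mulopE => z z1; have z1' : rn z^* < 1 by rewrite rn_conj.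
  by rewrite (hu n).2// hw// /gstar thE// rmorphM.
have u0 n : u n 0%N = (expR (circle_mean (fun t => k t + kn n t)))%:C%C.
  rewrite -psum_at0 (hu n).2 ?rn0// /gstar conjC0 /th herglotz_at0.
  by rewrite /cexp /= cos0 sin0 mulr1 conj_re.
have ut : tends u (kern 0).
  move=> d d0.
  have : (fun n => expR (circle_mean (fun t => k t + kn n t))) @ \oo --> (1 : R).
    rewrite -expR0; apply: continuous_cvg; first exact: continuous_expR.
    exact: cut_mean_tends.
  move=> /cvgrPdist_lt/(_ (d ^+ 2 / 2)).
  rewrite divr_gt0 ?exprn_gt0// => /(_ isT)[N _ hN]; exists N => n Nn.
  have := hN n Nn; rewrite /= ltr_norml => /andP[h1 h2].
  rewrite -(ltr_pXn2r (n := 2)) ?nnegrE ?rn_ge0 ?(ltW d0)// rnB_sq -psum_dot ?rn0//.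
  rewrite psum_at0 u0 /= rn_kern0 expr1n.
  have : rn (u n) ^+ 2 <= 1 by rewrite -(expr1n _ 2) lerXn2r ?nnegrE ?rn_ge0 ?ler01 ?(hu n).1.
  lra.
pose D : set H2 := [set mulop (gstar g) f | f in setT].
have lin := mult_linear mgs.
have [||a x y [x' _ <-] [y' _ <-]||d [f _ <-] hf] := @dense_of_orth R H2 D _ _ _ _ v e e0; last by exists f.
- exact: hardy_complete.
- by exists 0 => //; rewrite (lin0 lin).
- by exists (a *: x' + y') => //; exact: lin.
move=> x hx; apply: hardy_ext => m.
have shm (f f' : H2) : mulop (gstar g) f = f' -> mulop (gstar g) (fshift f) = fshift f'.
  move=> <-; apply: mulopE => z z1.
  by rewrite !psum_fshift// (mult_mulop f mgs).2// mulrCA.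
have it n : mulop (gstar g) (iter m (@fshift R) (w n)) = iter m (@fshift R) (u n).
  by elim: (m) => [|j IH]; [exact: uw|rewrite !iterS; exact: shm].
have dz n : dot (u n) (iter m (@bshift R) x) = 0.
  rewrite -dot_iter_fshift dotC hx ?conjC0//.
  by exists (iter m (@fshift R) (w n)) => //; exact: it.
have := tends_uniq (tends_dotl (iter m (@bshift R) x) ut) (tends_ext (v := fun n => dot (u n) (iter m (@bshift R) x)) (fun n => esym (dz n)) (tends_cst (0 : C))).
rewrite dotC -psum_dot ?rn0// psum_at0 coef_iter_bshift addn0 => /eqP.
by rewrite conjC_eq0 => /eqP.
Qed.

End Outer.

(** * Spans of sequences *)
Section Spans.
Variable R : realType.
Local Notation C := R[i].

Section normed.
Variable V : normedModType C.
Implicit Types (x y : nat -> V) (v w : V).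

Definition comb x n (a : nat -> C) : V := \sum_(k < n) a k *: x k.

Definition in_span x N v := exists a, v = comb x N a.

Lemma comb_eq x n (a b : nat -> C) : (forall k, (k < n)%N -> a k = b k) ->
  comb x n a = comb x n b.
Proof. by move=> h; apply: eq_bigr => k _; rewrite h. Qed.

Lemma comb_widen x n m (a : nat -> C) : (n <= m)%N ->
  comb x n a = comb x m (fun k => if (k < n)%N then a k else 0).
Proof.
move=> nm; rewrite /comb -(subnKC nm) big_split_ord /= [X in _ + X]big1 ?addr0.
  by apply: eq_bigr => k _; rewrite ltn_ord.
by move=> k _; rewrite ltnNge leq_addr scale0r.
Qed.

Lemma combP x n (c : C) (a b : nat -> C) :
  c *: comb x n a + comb x n b = comb x n (fun k => c * a k + b k).
Proof.
rewrite /comb scaler_sumr -big_split /=; apply: eq_bigr => k _.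
by rewrite scalerDl scalerA.
Qed.

Lemma combS x n (a : nat -> C) : comb x n.+1 a = comb x n a + a n *: x n.
Proof. by rewrite /comb big_ord_recr. Qed.

Lemma comb1 x n : comb x n.+1 (fun k => (k == n)%:R) = x n.
Proof.
rewrite combS eqxx scale1r (_ : comb x n _ = 0) ?add0r// /comb big1// => k _.
by rewrite (ltn_eqF (ltn_ord k)) scale0r.
Qed.

Lemma in_span_widen x N M v : (N <= M)%N -> in_span x N v -> in_span x M v.
Proof. by move=> NM [a ->]; eexists; exact: comb_widen. Qed.

Lemma in_spanP x N (c : C) v w : in_span x N v -> in_span x N w -> in_span x N (c *: v + w).
Proof. by move=> [a ->] [b ->]; eexists; exact: combP. Qed.

Lemma in_span0 x N : in_span x N 0.
Proof. by exists (fun=> 0); rewrite /comb big1// => k _; rewrite scale0r. Qed.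

Lemma in_span_sum x N n (a : nat -> C) (f : nat -> V) :
  (forall k, (k < n)%N -> in_span x N (f k)) -> in_span x N (\sum_(k < n) a k *: f k).
Proof.
elim: n => [|n IH] h; first by rewrite big_ord0; exact: in_span0.
rewrite big_ord_recr /= addrC; apply: in_spanP; first exact: h.
by apply: IH => k kn; apply: h; exact: ltnW.
Qed.

Lemma in_span_gen x k N : (k < N)%N -> in_span x N (x k).
Proof. by move=> kN; apply: (@in_span_widen x k.+1) => //; exists (fun j => (j == k)%:R); rewrite comb1. Qed.

Definition dense_span x := forall v (e : R), 0 < e ->
  exists N, exists a, rn (v - comb x N a) < e.

Lemma closed_spanE x : closed_span x = setT <-> dense_span x.
Proof.
split=> [h v e e0|h].
  have : closed_span x v by rewrite h.
  move=> /(_ (ball v e%:C%C)) [|w [[n [a wE]] hb]].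
    by apply: nbhsx_ballx; rewrite -[0]/(0%:C%C) ltcR.
  by exists n, a; move: hb; rewrite wE -ball_normE /= rnE ltcR.
apply/seteqP; split=> // v _ B /nbhs_ballP[_ /gt0C[e e0 ->] hB].
have [n [a ha]] := h v e e0; exists (comb x n a); split; first by exists n, a.
by apply: hB; rewrite -ball_normE /= rnE ltcR.
Qed.

Lemma dense_eq (W : normedModType C) x (A B : V -> W) : dense_span x ->
  bounded_op A -> bounded_op B -> (forall n, A (x n) = B (x n)) -> forall v, A v = B v.
Proof.
move=> dx bA bB AB v.
have lA := bA.1; have lB := bB.1.
have /choice[p hp] n : exists p : nat * (nat -> C), rn (v - comb x p.1 p.2) < inv_succ R n.
  by have [N [a ha]] := dx v _ (@inv_succ_gt0 R n); exists (N, a).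
have t : tends (fun n => comb x (p n).1 (p n).2) v.
  move=> e /inv_succ_small[N hN]; exists N => n /hN; apply: lt_trans.
  by rewrite rnBC.
apply: (tends_uniq (tends_op bA t)); apply: tends_ext (tends_op bB t) => n.
rewrite /comb !lin_sum//; apply: eq_bigr => k _.
by rewrite (linZ lA) (linZ lB) AB.
Qed.

End normed.

(** The closure of the graph on finite combinations is the graph of a map, by
    the bound, and this map is defined everywhere, by density and completeness.
    *)
Lemma ext_op (V W : normedModType C) (x : nat -> V) (y : nat -> W) (M : R) :
  completeV W -> dense_span x -> 0 <= M ->
  (forall N (a : nat -> C), rn (comb y N a) <= M * rn (comb x N a)) ->
  exists A : V -> W, bounded_op A /\ forall n, A (x n) = y n.
Proof.
move=> cW dx M0 hM.
pose G v w := forall e : R, 0 < e ->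
  exists N, exists a, rn (v - comb x N a) < e /\ rn (w - comb y N a) < e.
have GP c v w v' w' : G v w -> G v' w' -> G (c *: v + v') (c *: w + w').
  move=> h h' e e0; have c0 := rn_ge0 c.
  have [|N [a [a1 a2]]] := h (e / 2 / (rn c + 1)); first by rewrite !divr_gt0//; lra.
  have [|N' [a' [a1' a2']]] := h' (e / 2); first lra.
  exists (maxn N N'), (fun k => c * (if (k < N)%N then a k else 0) + (if (k < N')%N then a' k else 0)).
  rewrite -!combP.
  rewrite -(comb_widen _ _ (leq_maxl N N')) -(comb_widen _ _ (leq_maxr N N')).
  rewrite -(comb_widen _ _ (leq_maxl N N')) -(comb_widen _ _ (leq_maxr N N')).
  have key (U : normedModType C) (s s' t t' : U) : rn (s - s') < e / 2 / (rn c + 1) ->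
      rn (t - t') < e / 2 -> rn (c *: s + t - (c *: s' + t')) < e.
    rewrite ltr_pdivlMr; last lra.
    rewrite opprD addrACA -scalerBr => h1 h2; rewrite (le_lt_trans (rnD _ _))// rnZ.
    by have := rn_ge0 (s - s'); nra.
  by split; apply: key.
have Gb v w : G v w -> rn w <= M * rn v.
  move=> h; apply/ler_addgt0Pl => e e0.
  have [|N [a [a1 a2]]] := h (e / (M + 1)); first by rewrite divr_gt0//; lra.
  rewrite ltr_pdivlMr in a1; last lra.
  rewrite ltr_pdivlMr in a2; last lra.
  have h1 := hM N a; have := rn_subl w (comb y N a).
  have h2 : rn (comb x N a) <= rn v + rn (v - comb x N a).
    by have := rn_subl (comb x N a) v; rewrite rnBC; lra.
  have : M * rn (comb x N a) <= M * (rn v + rn (v - comb x N a)) by rewrite ler_wpM2l.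
  move: (rn_ge0 (v - comb x N a)) (rn_ge0 (w - comb y N a)) a1 a2 h1.
  move: (rn (v - comb x N a)) (rn (w - comb y N a)) (rn (comb y N a)) (M * rn (comb x N a)) => r1 r2 r3 r4.
  by nra.
have Gex v : exists w, G v w.
  have /choice[p hp] n : exists p : nat * (nat -> C), rn (v - comb x p.1 p.2) < inv_succ R n.
    by have [N [a ha]] := dx v _ (@inv_succ_gt0 R n); exists (N, a).
  have cy : cauchyseq (fun n => comb y (p n).1 (p n).2).
    move=> e e0; have [|N hN] := @inv_succ_small R (e / 2 / (M + 1)).
      by rewrite !divr_gt0//; lra.
    exists N => m n hm hn.
    have E (U : normedModType C) (z : nat -> U) : comb z (p m).1 (p m).2 - comb z (p n).1 (p n).2
       = comb z (maxn (p m).1 (p n).1) (fun k => (-1) * (if (k < (p n).1)%N then (p n).2 k else 0)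
           + (if (k < (p m).1)%N then (p m).2 k else 0)).
      rewrite -combP -(comb_widen _ _ (leq_maxl _ _)) -(comb_widen _ _ (leq_maxr _ _)).
      by rewrite scaleN1r addrC.
    rewrite E (le_lt_trans (hM _ _))// -E.
    have h1 := lt_trans (hp m) (hN m hm); have h2 := lt_trans (hp n) (hN n hn).
    rewrite ltr_pdivlMr in h1; last lra.
    rewrite ltr_pdivlMr in h2; last lra.
    have h3 := rn_tri v (comb x (p m).1 (p m).2) (comb x (p n).1 (p n).2).
    rewrite (rnBC _ v) in h3.
    have := rn_ge0 (comb x (p m).1 (p m).2 - comb x (p n).1 (p n).2).
    move: h1 h2 h3 (rn_ge0 (v - comb x (p m).1 (p m).2)) (rn_ge0 (v - comb x (p n).1 (p n).2)).
    by move: (rn _) (rn _) (rn _) => r1 r2 r3; nra.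
  have [w hw] := cW _ cy; exists w => e e0.
  have [N hN] := hw e e0; have [N' hN'] := inv_succ_small e0.
  exists (p (N + N')%N).1, (p (N + N')%N).2; split.
    by rewrite (lt_trans (hp _))// hN'// leq_addl.
  by rewrite rnBC hN// leq_addr.
have Guniq v w w' : G v w -> G v w' -> w = w'.
  move=> h h'; apply/eqP; rewrite -subr_eq0; apply/eqP/rn0_eq/eqP.
  rewrite eq_le rn_ge0 andbT; have := Gb _ _ (GP (-1) _ _ _ _ h' h).
  by rewrite !scaleN1r addNr rn0 mulr0 addrC.
have /choice[A hA] := Gex.
exists A; split.
  apply/bounded_opP; split; last by exists M => // v; exact: Gb.
  by move=> a v w; apply: Guniq (hA _) _; exact: GP.
move=> n; apply: Guniq (hA _) _ => e e0; exists n.+1, (fun k => (k == n)%:R).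
by rewrite !comb1 !subrr !rn0.
Qed.

Section inner.
Variable V : innerProductType C.
Implicit Types (x e : nat -> V).

Lemma rn_comb_orthonormal e N (a : nat -> C) :
  (forall m n, (m < N)%N -> (n < N)%N -> dot (e m) (e n) = (m == n)%:R) ->
  rn (comb e N a) ^+ 2 = \sum_(k < N) rn (a k) ^+ 2.
Proof.
elim: N => [|N IH] h; first by rewrite /comb !big_ord0 rn0 expr0n.
rewrite combS rnD_sq big_ord_recr /= IH; last by move=> m n mN nN; rewrite h// leqW.
have -> : dot (comb e N a) (a N *: e N) = 0.
  rewrite /comb dot_suml big1// => k _; rewrite dotZl dotZr h//; last exact: leqW (ltn_ord k).
  by rewrite (ltn_eqF (ltn_ord k)) !mulr0.
have en : rn (e N) = 1.
  have : dot (e N) (e N) = 1 by rewrite h// eqxx.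
  by rewrite dotxx => /(@complexI R)/eqP; rewrite pexpr_eq1 ?rn_ge0// => /eqP.
by rewrite rnZ en mulr1 /= mulr0 addr0.
Qed.

(** * Gram-Schmidt and Riesz bases *)
Section gram_schmidt.
Variable x : nat -> V.
Hypothesis x_indep : finitely_independent x.

Definition gs_residue (s : seq V) (v : V) : V := v - \sum_(u <- s) dot v u *: u.

(** The list of the vectors already constructed, which makes the recursion
    structural. *)
Fixpoint gs_list n : seq V :=
  if n is m.+1 then
    let v := gs_residue (gs_list m) (x m) in rcons (gs_list m) ((rn v)^-1%:C%C *: v)
  else [::].

Definition gs n : V := let v := gs_residue (gs_list n) (x n) in (rn v)^-1%:C%C *: v.

Lemma gs_sum (f : V -> V) n : \sum_(u <- gs_list n) f u = \sum_(k < n) f (gs k).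
Proof.
elim: n => [|n IH]; first by rewrite big_nil big_ord0.
by rewrite /= big_rcons /= big_ord_recr /= IH addrC.
Qed.

Lemma gs_residueE n : gs_residue (gs_list n) (x n) = x n - \sum_(k < n) dot (x n) (gs k) *: gs k.
Proof. by rewrite /gs_residue gs_sum. Qed.

Lemma gs_in_span n : in_span x n.+1 (gs n).
Proof.
elim/ltn_ind: n => n IH; rewrite /gs gs_residueE.
rewrite -[_ *: _]addr0; apply: in_spanP; last exact: in_span0.
rewrite addrC -scaleN1r; apply: in_spanP; last exact: in_span_gen.
by apply: (@in_span_sum _ x n.+1 n (fun k => dot (x n) (gs k)) gs) => k kn; apply: in_span_widen (IH k kn); exact: ltnW.
Qed.

Lemma gs_residue_neq0 n : gs_residue (gs_list n) (x n) != 0.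
Proof.
apply/eqP; rewrite gs_residueE => /eqP; rewrite subr_eq0 => /eqP E.
have : in_span x n (x n).
  rewrite [X in in_span _ _ X]E.
  by apply: (@in_span_sum _ x n n (fun k => dot (x n) (gs k)) gs) => k kn; apply: in_span_widen (gs_in_span k).
move=> [a aE].
have := @x_indep (iota 0 n.+1) (fun k => if k == n then -1 else a k) (iota_uniq _ _).
have iE : iota 0 n.+1 = index_iota 0 n.+1 by rewrite /index_iota subn0.
rewrite iE big_mkord big_ord_recr /= eqxx scaleN1r.
under eq_bigr => k _ do rewrite (ltn_eqF (ltn_ord k)).
rewrite -[X in X - _]/(comb x n a) -aE subrr => /(_ erefl n).
rewrite mem_index_iota ltnSn eqxx => /(_ isT)/eqP.
by rewrite oppr_eq0 oner_eq0.
Qed.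

Lemma gs_orthonormal m n : dot (gs m) (gs n) = (m == n)%:R.
Proof.
have norm1 k : dot (gs k) (gs k) = 1.
  have r0 := rn_gt0 (gs_residue_neq0 k).
  rewrite dotxx /gs rnZ rnr ger0_norm ?invr_ge0 ?(ltW r0)// mulVf ?gt_eqF//.
  by rewrite expr1n.
have lt k j : (j < k)%N -> dot (gs k) (gs j) = 0.
  elim/ltn_ind: k j => k IH j jk; rewrite {1}/gs dotZl; set r := (_^-1)%:C%C.
  rewrite gs_residueE dotBl dot_suml.
  rewrite (bigD1 (Ordinal jk))//= dotZl norm1 mulr1 big1 ?addr0 ?subrr ?mulr0//.
  move=> i ij; rewrite dotZl; have := ltn_ord i; move: ij; rewrite -val_eqE /= => ij ik.
  have [ji|] := ltnP j i; first by rewrite IH// mulr0.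
  rewrite leq_eqVlt (negbTE ij) /= => {}ij.
  by rewrite [dot (gs i) _]dotC IH// conjC0 mulr0.
have [->|] := eqVneq m n; first exact: norm1.
rewrite neq_ltn => /orP[mn|nm]; last exact: lt.
by rewrite dotC lt// conjC0.
Qed.

Lemma gs_dense : dense_span x -> dense_span gs.
Proof.
move=> dx v e e0; have [N [a ha]] := dx v e e0.
have [b hb] : in_span gs N (comb x N a).
  apply: (@in_span_sum _ gs N N a x) => k kN.
  have r0 := rn_gt0 (gs_residue_neq0 k).
  have -> : x k = (rn (gs_residue (gs_list k) (x k)))%:C%C *: gs k
      + \sum_(j < k) dot (x k) (gs j) *: gs j.
    rewrite /gs scalerA -rmorphM /= divff ?gt_eqF// rmorph1 scale1r -/(gs _).
    by rewrite gs_residueE subrK.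
  apply: in_spanP; first exact: in_span_gen.
  by apply: (@in_span_sum _ gs N k (fun j => dot (x k) (gs j)) gs) => j jk; apply: in_span_gen; exact: ltn_trans kN.
by exists N, b; rewrite -hb.
Qed.

End gram_schmidt.

(** For an orthonormal basis, here the one of the Gram-Schmidt process, the norm
    of a combination is the root of the sum of the squares, so the bounds say
    that the basis vectors are mapped to the [x n] by a bounded map with a
    bounded inverse. *)
Lemma riesz_basis_of_bounds x (c1 c2 : R) : completeV V -> finitely_independent x ->
  closed_span x = setT -> 0 < c1 -> 0 <= c2 ->
  (forall N (a : nat -> C), c1 * \sum_(k < N) rn (a k) ^+ 2 <= rn (comb x N a) ^+ 2) ->
  (forall N (a : nat -> C), rn (comb x N a) ^+ 2 <= c2 * \sum_(k < N) rn (a k) ^+ 2) ->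
  riesz_basis x.
Proof.
move=> cV xi /closed_spanE dx c10 c20 lo hi.
have on := gs_orthonormal xi; have de := gs_dense xi dx.
have eE N a : rn (comb (gs x) N a) ^+ 2 = \sum_(k < N) rn (a k) ^+ 2.
  by apply: rn_comb_orthonormal => m n _ _.
have sq (c s t : R) : 0 <= c -> 0 <= s -> 0 <= t -> s ^+ 2 <= c * t ^+ 2 -> s <= (c + 1) * t.
  move=> c0 s0 t0 h; rewrite -(ler_pXn2r (n := 2)) ?nnegrE ?mulr_ge0 ?addr_ge0//.
  by rewrite (le_trans h)// exprMn ler_wpM2r ?sqr_ge0//; nra.
have [N a|A [bA Ax]] := @ext_op V V (gs x) x (c2 + 1) cV de (addr_ge0 c20 ler01).
  by apply: sq; rewrite ?rn_ge0// eE hi.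
have ic : 0 <= c1^-1 by rewrite invr_ge0 ltW.
have [N a|B [bB Bx]] := @ext_op V V x (gs x) (c1^-1 + 1) cV dx (addr_ge0 ic ler01).
  by apply: sq; rewrite ?rn_ge0// eE ler_pdivlMl.
exists (gs x), A, B; split=> //; first by split=> //; apply/closed_spanE.
have bAB (S T : V -> V) : bounded_op S -> bounded_op T -> bounded_op (fun v => S (T v)).
  move=> /bounded_opP[lS [M M0 hM]] /bounded_opP[lT [M' M0' hM']]; apply/bounded_opP.
  split; first by move=> a u v; rewrite lT lS.
  exists (M * M'); first exact: mulr_ge0.
  by move=> v; rewrite (le_trans (hM _))// -mulrA ler_wpM2l.
have bid : bounded_op (fun v : V => v).
  by apply/bounded_opP; split=> //; exists 1 => // v; rewrite mul1r.
split=> v.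
  by apply: (dense_eq de (bAB _ _ bB bA) bid) => n; rewrite Ax Bx.
by apply: (dense_eq dx (bAB _ _ bA bB) bid) => n; rewrite Bx Ax.
Qed.

(** Choosing each sign according to the sign of the inner product of the new
    term with the sum of the previous ones makes all the cross terms
    nonnegative, or all nonpositive. *)
Lemma sign_choice x N (a : nat -> C) : (exists eps : nat -> R,
    (forall k, eps k ^+ 2 = 1) /\
    \sum_(k < N) rn (a k *: x k) ^+ 2 <= rn (comb x N (fun k => (eps k)%:C%C * a k)) ^+ 2) /\
  (exists eps : nat -> R, (forall k, eps k ^+ 2 = 1) /\
    rn (comb x N (fun k => (eps k)%:C%C * a k)) ^+ 2 <= \sum_(k < N) rn (a k *: x k) ^+ 2).
Proof.
elim: N => [|N [[e1 [s1 h1]] [e2 [s2 h2]]]].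
  by split; exists (fun=> 1); split=> [_|]; rewrite ?expr1n// /comb !big_ord0 rn0 expr0n.
have flip (e : nat -> R) (s : R) : (forall k, e k ^+ 2 = 1) -> s ^+ 2 = 1 ->
    let e' := fun k => if (k < N)%N then e k else s in
    (forall k, e' k ^+ 2 = 1) /\ rn (comb x N.+1 (fun k => (e' k)%:C%C * a k)) ^+ 2
      = rn (comb x N (fun k => (e k)%:C%C * a k)) ^+ 2 + rn (a N *: x N) ^+ 2
        + 2 * (s * Re (dot (comb x N (fun k => (e k)%:C%C * a k)) (a N *: x N))).
  move=> he hs e'; split; first by move=> k; rewrite /e'; case: ifP.
  rewrite combS (@comb_eq _ _ _ _ (fun k => (e k)%:C%C * a k)); last first.
    by move=> k kN; rewrite /e' kN.
  rewrite /e' ltnn -scalerA rnD_sq; congr (_ + _ + 2 * _).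
    by rewrite rnZ exprMn rnr real_normK ?num_real// hs mul1r.
  by rewrite dotZr conj_re; case: (dot _ _) => u v /=; rewrite mul0r subr0.
split.
  set d := Re (dot (comb x N (fun k => (e1 k)%:C%C * a k)) (a N *: x N)).
  have [s hs sd] : exists2 s : R, s ^+ 2 = 1 & 0 <= s * d.
    have [d0|/ltW d0] := leP 0 d; first by exists 1; rewrite ?expr1n ?mul1r.
    by exists (-1); rewrite ?sqrrN ?expr1n ?mulN1r ?oppr_ge0.
  have [f1 f2] := flip e1 s s1 hs; eexists; split; first exact: f1.
  by rewrite f2 big_ord_recr /= -/d; lra.
set d := Re (dot (comb x N (fun k => (e2 k)%:C%C * a k)) (a N *: x N)).
have [s hs sd] : exists2 s : R, s ^+ 2 = 1 & s * d <= 0.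
  have [d0|/ltW d0] := leP 0 d; last by exists 1; rewrite ?expr1n ?mul1r.
  by exists (-1); rewrite ?sqrrN ?expr1n ?mulN1r ?oppr_le0.
have [f1 f2] := flip e2 s s2 hs; eexists; split; first exact: f1.
by rewrite f2 big_ord_recr /= -/d; lra.
Qed.

(** A change of signs costs a factor [L], so [sign_choice] compares the squared
    norm of a combination with the sum of the squared norms of its terms in both
    directions. *)
Lemma riesz_of_unconditional x (m M L : R) : completeV V -> finitely_independent x ->
  closed_span x = setT -> 0 < m -> (forall n, m <= rn (x n)) -> (forall n, rn (x n) <= M) ->
  0 < L ->
  (forall N (a : nat -> C) (eps : nat -> R), (forall k, eps k ^+ 2 = 1) ->
    rn (comb x N (fun k => (eps k)%:C%C * a k)) <= L * rn (comb x N a)) ->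
  riesz_basis x.
Proof.
move=> cV xi xs m0 hm hM L0 hL.
have L2 : 0 < L ^+ 2 by rewrite exprn_gt0.
apply: (@riesz_basis_of_bounds x (m ^+ 2 / L ^+ 2) (L ^+ 2 * M ^+ 2)) => //.
- by rewrite divr_gt0// exprn_gt0.
- by rewrite mulr_ge0// ?sqr_ge0// ltW.
- move=> N a; have [[eps [he h]] _] := sign_choice x N a.
  rewrite mulrAC ler_pdivrMr// mulr_sumr.
  apply: (@le_trans _ _ (\sum_(k < N) rn (a k *: x k) ^+ 2)).
    apply: ler_sum => k _; rewrite rnZ exprMn mulrC ler_wpM2l ?sqr_ge0//.
    by rewrite lerXn2r ?nnegrE ?rn_ge0 ?(ltW m0).
  rewrite (le_trans h)// mulrC -exprMn lerXn2r ?nnegrE ?rn_ge0 ?mulr_ge0 ?rn_ge0 ?(ltW L0)//.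
  exact: hL.
move=> N a; have [_ [eps [he h]]] := sign_choice x N a.
have E : comb x N a = comb x N (fun k => (eps k)%:C%C * ((eps k)%:C%C * a k)).
  by apply: comb_eq => k _; rewrite mulrA -rmorphM -expr2 he rmorph1 mul1r.
apply: (@le_trans _ _ (L ^+ 2 * rn (comb x N (fun k => (eps k)%:C%C * a k)) ^+ 2)).
  rewrite {1}E -exprMn lerXn2r ?nnegrE ?rn_ge0 ?mulr_ge0 ?rn_ge0 ?(ltW L0)//.
  exact: hL.
rewrite -mulrA ler_pM2l// (le_trans h)// mulr_sumr; apply: ler_sum => k _.
rewrite rnZ exprMn mulrC ler_wpM2r ?sqr_ge0// lerXn2r ?nnegrE ?rn_ge0//.
exact: le_trans (rn_ge0 _) (hM 0%N).
Qed.

End inner.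
End Spans.

(** * The model space *)
Section Dense.
Variable R : realType.
Local Notation C := R[i].
Variable V : innerProductType C.
Implicit Types (f y v : V).

Lemma rn_pyth f y : dot f y = 0 -> rn (f + y) ^+ 2 = rn f ^+ 2 + rn y ^+ 2.
Proof. by move=> h; rewrite rnD_sq h /= mulr0 addr0. Qed.

Lemma dot_comb0 (a : C) f y v : dot f v = 0 -> dot y v = 0 -> dot (a *: f + y) v = 0.
Proof. by move=> fv yv; rewrite dotDl dotZl fv yv mulr0 addr0. Qed.

(** Test on combinations approaching [v] itself. *)
Lemma dual_dense (x : nat -> V) v (E : R) : dense_span x -> 0 <= E ->
  (forall N a, rn (dot (comb x N a) v) <= E * rn (comb x N a)) -> rn v <= E.
Proof.
move=> dx E0 h; have [->|v0] := eqVneq v 0; first by rewrite rn0.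
have vp := rn_gt0 v0; apply/ler_addgt0Pl => e e0.
pose d := e * rn v / (rn v + E + 1).
have d0 : 0 < d by rewrite divr_gt0 ?mulr_gt0//; lra.
have [N [a ha]] := dx v d d0; have := h N a.
have h1 : rn v ^+ 2 <= rn (dot (v - comb x N a) v) + rn (dot (comb x N a) v).
  by rewrite (le_trans _ (rnD _ _))// -dotDl subrK dotxx rnr ler_norm.
have h2 := dot_CS (v - comb x N a) v.
have h3 : rn (comb x N a) <= rn v + rn (v - comb x N a).
  by have := rn_subl (comb x N a) v; rewrite rnBC; lra.
have dE : d * (rn v + E + 1) = e * rn v by rewrite /d divfK// gt_eqF//; lra.
move: h1 h2 h3 ha vp d0 dE (rn_ge0 (v - comb x N a)); clearbody d; clear h dx v0.
move: (comb x N a) => c.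
move: (rn (dot (v - c) v)) (rn (dot c v)) (rn (v - c)) (rn c) (rn v).
move=> r1 r2 r3 r4 r5 h1 h2 h3 h4 h5 h6 h7 h8 h9.
have : E * r4 <= E * (r5 + r3) by rewrite ler_wpM2l.
nra.
Qed.

Lemma dot_dense (x : nat -> V) v : dense_span x -> (forall n, dot (x n) v = 0) -> v = 0.
Proof.
move=> dx h; apply: rn0_eq; apply/eqP; rewrite eq_le rn_ge0 andbT.
apply: (dual_dense dx) => // N a; rewrite mul0r /comb dot_suml big1 ?rn0// => k _.
by rewrite dotZl h mulr0.
Qed.

End Dense.

Section SubspaceGeometry.
Variable R : realType.
Local Notation C := R[i].
Variables (V : innerProductType C) (M : submodClosed V).
Implicit Types (f y v : V).

Lemma complete_sub : completeV V ->
  (forall u l, (forall n, u n \in M) -> tends u l -> l \in M) -> completeV (sub_of M).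
Proof.
move=> cV cM u cu.
have [e e0|l hl] := cV (fun n => val (u n)).
  by have [N hN] := cu e e0; exists N => m n a c; have := hN m n a c; rewrite rn_sub.
have lM : l \in M by apply: cM hl => n; exact: valP.
exists (Sub l lM) => e /hl[N hN]; exists N => n Nn; rewrite rn_sub.
have -> : val (u n - Sub l lM : sub_of M) = val (u n) - l by [].
exact: hN.
Qed.

Lemma orthoproj_uniq f (p : sub_of M) :
  (forall y, y \in M -> dot (f - val p) y = 0) -> orthoproj M f = p.
Proof.
move=> hp; apply: xget_unique => // p' hp'; apply: val_inj.
apply/eqP; rewrite -subr_eq0; apply/eqP; apply: rn0_eq.
have pM : val p' - val p \in M.
  by rewrite -scaleN1r rpredD ?rpredZ//; exact: valP.
have key : dot (val p' - val p) (val p' - val p) = 0.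
  rewrite -[X in dot X _ = _](_ : (f - val p) - (f - val p') = _).
    by rewrite dotBl hp// hp'// subrr.
  by rewrite opprB addrC addrA subrK.
by move: key; rewrite dotxx => /(@complexI R)/eqP; rewrite sqrf_eq0 => /eqP.
Qed.

Lemma orthoproj_linear :
  (forall f y, y \in M -> dot (f - val (orthoproj M f)) y = 0) -> linear (orthoproj M).
Proof.
move=> orth a f h; apply: orthoproj_uniq => y yM.
have -> : val (a *: orthoproj M f + orthoproj M h)
  = a *: val (orthoproj M f) + val (orthoproj M h) by [].
have -> : a *: f + h - (a *: val (orthoproj M f) + val (orthoproj M h))
    = a *: (f - val (orthoproj M f)) + (h - val (orthoproj M h)).
  by rewrite scalerBr opprD addrACA.
exact: dot_comb0 (orth f y yM) (orth h y yM).
Qed.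

End SubspaceGeometry.

(** Real nodes whose distances to 1 decay geometrically, and the Blaschke
    product as the limit of finite products of [bfactor]; increasing sequences
    with the Carleson condition have this form by [carleson_facts]. *)
Definition blaschke_nodes (R : realType) (lam : nat -> R[i]) (b : nat -> R) (q : R) :=
  [/\ forall n, lam n = (b n)%:C%C, forall n, 0 < b n < 1, forall n, b n < b n.+1,
    0 <= q < 1 & (forall n, 1 - b n.+1 <= q * (1 - b n)) /\
    forall z, blaschke lam z = blim b xpredT z].

Section Model.
Variable R : realType.
Local Notation C := R[i].
Local Notation H2 := (hardy R).
Variables (lam : nat -> C) (b : nat -> R) (q : R).
Hypothesis nodes : blaschke_nodes lam b q.
Let lamE n : lam n = (b n)%:C%C. Proof. by case: nodes => h _ _ _ _. Qed.
Let b01 n : 0 < b n < 1. Proof. by case: nodes => _ h _ _ _. Qed.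
Let b_incr n : b n < b n.+1. Proof. by case: nodes => _ _ h _ _. Qed.
Let q01 : 0 <= q < 1. Proof. by case: nodes => _ _ _ h _. Qed.
Let bq n : 1 - b n.+1 <= q * (1 - b n). Proof. by case: nodes => _ _ _ _ [h _]. Qed.
Let BE z : blaschke lam z = blim b xpredT z. Proof. by case: nodes => _ _ _ _ [_ h]. Qed.
Local Notation M := (mul_range (blaschke lam)).
Local Notation u := (unit_kernel lam).
Local Notation PB := (@projBH2 R lam).
Local Notation PK := (@projKB R lam).
Implicit Types (f h y : H2) (z : C).

#[local] Opaque projBH2 projKB orthoproj mulop psum fshift kern.

Lemma rn_node n : rn ((b n)%:C%C : C) < 1.
Proof. by rewrite b_real//; case/andP: (b01 n). Qed.

(** Divisibility by B is a closed condition once it is expressed by the zeros.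
    *)
Lemma mem_BH2 f : f \in M <-> forall n, psum f (b n)%:C%C = 0.
Proof.
split=> [/asboolP[h hE] n|h].
  have n1 := rn_node n; rewrite hE ?lt1C// BE (blim_zero b01 q01 bq)//.
  by rewrite mul0r.
apply/asboolP; have [h' hE] := blaschke_divide b01 b_incr q01 bq h.
by exists h' => z z1; rewrite BE hE// -lt1C.
Qed.

Lemma BH2_closed (v : nat -> H2) l : (forall n, v n \in M) -> tends v l -> l \in M.
Proof.
move=> vM vl; apply/mem_BH2 => n; have n1 := rn_node n.
apply: (tends_uniq (tends_psum n1 vl)); apply: tends_ext (tends_cst 0) => m.
by move/mem_BH2: (vM m) => ->.
Qed.

Lemma BH2_mul (phi : C -> C) (K : R) f : mult phi K -> f \in M -> mulop phi f \in M.
Proof.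
move=> mphi /mem_BH2 fM; apply/mem_BH2 => n; have n1 := rn_node n.
by rewrite (mult_mulop f mphi).2// fM mulr0.
Qed.

Lemma BH2_fshift f : f \in M -> fshift f \in M.
Proof.
move=> /mem_BH2 fM; apply/mem_BH2 => n; have n1 := rn_node n.
by rewrite psum_fshift// fM mulr0.
Qed.

Lemma mem_KB f : f \in orthc M <-> forall y, y \in M -> dot f y = 0.
Proof. by split=> [/asboolP//|h]; apply/asboolP. Qed.

Lemma KB_closed (v : nat -> H2) l :
  (forall n, v n \in orthc M) -> tends v l -> l \in orthc M.
Proof.
move=> vM vl; apply/mem_KB => y yM; apply: (tends_uniq (tends_dotl y vl)).
by apply: tends_ext (tends_cst 0) => m; move/mem_KB: (vM m) => ->.
Qed.

(** The projections are defined by choice; the nearest-point argument provides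
    the points that they choose, BH^2 being closed. *)
Lemma PB_orth f y : y \in M -> dot (f - val (PB f)) y = 0.
Proof.
have [|a v w vM wM|p [[v [vM vp]] hp]] := @orth_decomp _ _ [set f | f \in M] (@hardy_complete R) _ _ f.
- exact: rpred0.
- by rewrite /= rpredD// rpredZ.
have pM : p \in M by apply: BH2_closed vp.
have -> : PB f = Sub p pM by apply: orthoproj_uniq => w wM; rewrite SubK; exact: hp.
by rewrite SubK; exact: hp.
Qed.

Lemma PB_uniq f (p : BH2 lam) :
  (forall y, y \in M -> dot (f - val p) y = 0) -> PB f = p.
Proof. exact: orthoproj_uniq. Qed.

Lemma PK_val f : val (PK f) = f - val (PB f).
Proof.
have kK : f - val (PB f) \in orthc M by apply/mem_KB => y; exact: PB_orth.
have -> : PK f = Sub (f - val (PB f)) kK; last by rewrite SubK.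
apply: orthoproj_uniq => y /mem_KB yK; rewrite SubK subKr.
by rewrite dotC yK ?conjC0//; exact: valP.
Qed.

Lemma proj_split f : f = val (PB f) + val (PK f).
Proof. by rewrite PK_val addrC subrK. Qed.

Lemma BK_orth (p : BH2 lam) (k : KB lam) : dot (val p) (val k) = 0.
Proof. by have /mem_KB h := valP k; rewrite dotC h ?conjC0//; exact: valP. Qed.

Lemma proj_of_sum (p : BH2 lam) (k : KB lam) :
  PB (val p + val k) = p /\ PK (val p + val k) = k.
Proof.
have e : PB (val p + val k) = p.
  apply: PB_uniq => y yM; rewrite addrC addKr.
  by have /mem_KB := valP k; exact.
by split=> //; apply: val_inj; rewrite PK_val e addrC addKr.
Qed.

Lemma rn_proj f : rn f ^+ 2 = rn (PB f) ^+ 2 + rn (PK f) ^+ 2.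
Proof. by rewrite {1}(proj_split f) rn_pyth ?BK_orth// -!rn_sub. Qed.

Lemma rn_PB f : rn (PB f) <= rn f.
Proof.
by rewrite -(ler_pXn2r (n := 2)) ?nnegrE ?rn_ge0// (rn_proj f) lerDl sqr_ge0.
Qed.

Lemma rn_PK f : rn (PK f) <= rn f.
Proof.
by rewrite -(ler_pXn2r (n := 2)) ?nnegrE ?rn_ge0// (rn_proj f) lerDr sqr_ge0.
Qed.

Lemma PB_linear : linear PB.
Proof. exact: orthoproj_linear PB_orth. Qed.

Lemma PK_orth f y : y \in orthc M -> dot (f - val (PK f)) y = 0.
Proof.
move=> /mem_KB yK; rewrite PK_val subKr dotC yK ?conjC0//; exact: valP.
Qed.

Lemma PK_linear : linear PK.
Proof. exact: orthoproj_linear PK_orth. Qed.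

Lemma PB_id (p : BH2 lam) : PB (val p) = p.
Proof. by apply: PB_uniq => y _; rewrite subrr dot0l. Qed.

Lemma dot_PB f (p : BH2 lam) : dot (PB f) p = dot f (val p).
Proof.
apply/eqP; rewrite eq_sym -subr_eq0 dot_sub -dotBl.
by apply/eqP; apply: PB_orth; exact: valP.
Qed.

Lemma dot_PK f (k : KB lam) : dot k (PK f) = dot (val k) f.
Proof.
rewrite dot_sub PK_val dotBr [dot (val k) (val _)]dotC BK_orth conjC0 subr0.
by [].
Qed.

(** * The normalized kernels *)
Definition ucoef n : C := sqrtC (1 - `|lam n| ^+ 2).

Lemma unit_val n : val (u n) = ucoef n *: kern (b n)%:C%C.
Proof.
have n1 := rn_node n.
have hK : ucoef n *: kern (b n)%:C%C \in orthc M.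
  by apply/mem_KB => y /mem_BH2 yM; rewrite dotZl dotC -psum_dot// yM conjC0 mulr0.
have sE : szego (lam n) = kern (b n)%:C%C :> H2 by rewrite lamE szegoE.
rewrite /unit_kernel sE -/(ucoef n).
by rewrite /insubd (insubT (fun f => f \in orthc M) hK).
Qed.

Lemma rn_ucoef n : rn (ucoef n) ^+ 2 = 1 - b n ^+ 2.
Proof.
rewrite -rnX /ucoef sqrtCK lamE rnE b_real// -rmorphXn -[1]/(1%:C%C) -rmorphB rnr.
by rewrite ger0_norm//; case/andP: (b01 n) => h1 h2; nra.
Qed.

Lemma ucoef_neq0 n : ucoef n != 0.
Proof.
apply/eqP => E; have := rn_ucoef n; rewrite E rn0 expr0n /=.
by case/andP: (b01 n) => h1 h2; nra.
Qed.

Lemma dot_unit n f : dot (val (u n)) f = ucoef n * (psum f (b n)%:C%C)^*.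
Proof. by rewrite unit_val dotZl dotC psum_dot// rn_node. Qed.

Lemma rn_unit n : rn (u n) = 1.
Proof.
apply/eqP; rewrite -(pexpr_eq1 (n := 2)) ?rn_ge0// rn_sub unit_val rnZ exprMn.
rewrite rn_ucoef rn_kern ?rn_node// b_real// mulfV// gt_eqF//.
by case/andP: (b01 n) => h1 h2; nra.
Qed.

Lemma KB_complete : completeV (KB lam).
Proof. by apply: complete_sub; [exact: hardy_complete|exact: KB_closed]. Qed.

(** A vector of K_B orthogonal to every [u n] vanishes at all the nodes, so it
    is also in BH^2, and it is 0. *)
Lemma unit_dense : dense_span u.
Proof.
move=> v e e0.
pose D : set (KB lam) := [set v | exists N, in_span u N v].
have [||a k k' [N h] [N' h']|k hk|d [N [a ->]] hd] := @dense_of_orth _ _ D _ _ _ _ v e e0; last by exists N, a.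
- exact: KB_complete.
- by exists 0%N; exact: in_span0.
- exists (maxn N N'); apply: in_spanP; [exact: in_span_widen (leq_maxl _ _) h|].
  exact: in_span_widen (leq_maxr _ _) h'.
apply: val_inj; rewrite [RHS]raddf0.
have kM : val k \in M.
  apply/mem_BH2 => n; have : dot (u n) k = 0.
    by rewrite dotC hk ?conjC0//; exists n.+1; exact: in_span_gen.
  rewrite dot_sub dot_unit => /eqP; rewrite mulf_eq0 (negPf (ucoef_neq0 n)) /=.
  by rewrite conjC_eq0 => /eqP.
have /mem_KB/(_ _ kM) := valP k; rewrite dotxx => /(@complexI R)/eqP.
by rewrite sqrf_eq0 => /eqP/rn0_eq.
Qed.

Lemma KB_test (k k' : KB lam) : (forall n, dot (u n) k = dot (u n) k') -> k = k'.
Proof.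
move=> h; apply/eqP; rewrite -subr_eq0; apply/eqP; apply: (dot_dense unit_dense) => n.
by rewrite dotBr h subrr.
Qed.

Lemma dot_unitPK n f : dot (u n) (PK f) = ucoef n * (psum f (b n)%:C%C)^*.
Proof. exact: etrans (dot_PK f (u n)) (dot_unit n f). Qed.

(** The kernels are eigenvectors of the adjoints of multiplication operators. *)
Lemma dot_unit_mul (phi : C -> C) (K : R) n f : mult phi K ->
  dot (u n) (PK (mulop phi f)) = (phi (b n)%:C%C)^* * dot (u n) (PK f).
Proof.
move=> mphi; apply: (etrans (dot_unitPK n (mulop phi f))).
apply: (etrans _ (esym (congr1 (fun t => (phi (b n)%:C%C)^* * t) (dot_unitPK n f)))).
rewrite ((mult_mulop f mphi).2 _ (rn_node n)).
move: (psum f _) (phi _) (ucoef n) => p r s.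
by rewrite rmorphM mulrCA.
Qed.

Lemma dot_unit_fshift n f : dot (u n) (PK (fshift f)) = lam n * dot (u n) (PK f).
Proof.
apply: (etrans (dot_unitPK n (fshift f))).
apply: (etrans _ (esym (congr1 (fun t => lam n * t) (dot_unitPK n f)))).
rewrite (psum_fshift _ (rn_node n)) lamE; move: (psum f _) (ucoef n) => p s.
by rewrite rmorphM /= conj_re mulrCA.
Qed.

Lemma restrE (A : H2 -> H2) (p : BH2 lam) : A (val p) \in M -> restr A p = PB (A (val p)).
Proof.
move=> h; have e : val (restr A p) = A (val p).
  by rewrite /restr /insubd (insubT (fun f => f \in M) h).
by apply/esym; apply: PB_uniq => y _; rewrite e subrr dot0l.
Qed.

End Model.

(** * Adjoints and Abel summation *)
Section Adjoints.
Variable R : realType.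
Local Notation C := R[i].

Section op.
Variables (V W : innerProductType C) (A : V -> W).
Hypotheses (cV : completeV V) (A_op : bounded_op A).

Lemma adjoint_dotr x y : dot (adjoint A y) x = dot y (A x).
Proof. by rewrite dotC -adjoint_dot// -dotC. Qed.

Lemma adjoint_linear : linear (adjoint A).
Proof.
move=> a y y'; apply: dot_inj => z.
by rewrite -adjoint_dot// dotDr dotZr dotDr dotZr -!adjoint_dot.
Qed.

Lemma rn_adjoint (M : R) : 0 <= M -> (forall x, rn (A x) <= M * rn x) ->
  forall y, rn (adjoint A y) <= M * rn y.
Proof.
move=> M0 hM y; apply: rn_dual => [|x]; first by rewrite mulr_ge0 ?rn_ge0.
rewrite adjoint_dotr (le_trans (dot_CS _ _))//.
by rewrite mulrAC mulrC ler_wpM2r ?rn_ge0.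
Qed.

End op.

End Adjoints.

Section Abel.
Variable R : realType.
Local Notation C := R[i].
Variables (V : normedModType C) (x : nat -> V).

Lemma projection_partial : bounded_basis_projections x ->
  exists P : nat -> V -> V, exists Mp : R, [/\ 0 <= Mp, forall n, bounded_op (P n),
    forall n v, rn (P n v) <= Mp * rn v &
    forall n N (a : nat -> C), (n < N)%N -> P n (comb x N a) = comb x n.+1 a].
Proof.
move=> [P [Pop PE [M hM]]]; exists P, `|Re M|; split => //.
  move=> n v; have := hM n v; rewrite !rnE; case: M {hM} => M1 M2.
  rewrite (_ : _ * _ = (M1 * rn v +i* (M2 * rn v))%C); last by simpc.
  rewrite lecE /= => /andP[_ h].
  by rewrite (le_trans h)// ler_wpM2r ?rn_ge0 ?ler_norm.
move=> n N a nN; rewrite /comb PE.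
by rewrite [RHS](big_ord_widen_cond N xpredT (fun k => a k *: x k)).
Qed.

(** Abel summation writes the left-hand side as mu N times the full sum minus a
    combination of partial sums with nonnegative weights mu k.+1 - mu k. *)
Lemma abel_bound (Mp : R) (mu : nat -> R) N (a : nat -> C) :
  (forall n, (n <= N)%N -> rn (comb x n a) <= Mp * rn (comb x N a)) ->
  (forall n, 0 <= mu n) -> (forall n, mu n <= mu n.+1) -> (forall n, mu n <= 1) ->
  0 <= Mp ->
  rn (comb x N (fun k => (mu k)%:C%C * a k)) <= 2 * Mp * rn (comb x N a).
Proof.
move=> hP mu0 mu_incr mu1 Mp0.
set r := rn (comb x N a); have r0 : 0 <= r := rn_ge0 _.
have Mr : 0 <= Mp * r by rewrite mulr_ge0.
suff h n : (n <= N)%N -> exists2 w, comb x n (fun k => (mu k)%:C%C * a k)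
    = (mu n)%:C%C *: comb x n a - w & rn w <= (mu n - mu 0%N) * (Mp * r).
  have [w -> hw] := h N (leqnn N).
  have h1 := rnB ((mu N)%:C%C *: comb x N a) w.
  have h2 : rn ((mu N)%:C%C *: comb x N a) <= mu N * (Mp * r).
    by rewrite rnZ rnr ger0_norm// ler_wpM2l// hP.
  have := mu1 N; have := mu0 0%N; nra.
elim: n => [_|n IH nN].
  by exists 0; rewrite /comb ?big_ord0 ?scaler0 ?subr0 ?rn0 ?subrr ?mul0r.
have [w wE hw] := IH (ltnW nN).
exists (w + (mu n.+1 - mu n)%:C%C *: comb x n.+1 a).
  rewrite [LHS]combS wE rmorphB /= scalerBl opprD opprB addrA addrAC.
  set d := (mu n.+1)%:C%C *: _; rewrite [d + _]addrC subrK combS.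
  by rewrite scalerDr scalerA addrAC.
have h1 := rnD w ((mu n.+1 - mu n)%:C%C *: comb x n.+1 a).
have h2 : rn ((mu n.+1 - mu n)%:C%C *: comb x n.+1 a) <= (mu n.+1 - mu n) * (Mp * r).
  by rewrite rnZ rnr ger0_norm ?subr_ge0// ler_wpM2l ?subr_ge0// hP.
by rewrite (le_trans h1)//; lra.
Qed.

End Abel.

(** * The operators T, X and Y *)
Section Transfer.
Variable R : realType.
Local Notation C := R[i].
Local Notation H2 := (hardy R).
Variables (lam : nat -> C) (b : nat -> R) (q : R).
Hypothesis nodes : blaschke_nodes lam b q.
Local Notation M := (mul_range (blaschke lam)).
Local Notation u := (unit_kernel lam).
Local Notation PB := (@projBH2 R lam).
Local Notation PK := (@projKB R lam).
Variables (H0 : hilbertType C) (x : nat -> H0) (x_dense : dense_span x).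
Variables (W : KB lam -> H0) (W_op : bounded_op W) (W_u : forall n, W (u n) = x n).
Variables (R0 : H0 -> H0) (R0_op : bounded_op R0) (R0_x : forall n, R0 (x n) = lam n *: x n).
Variables (g : C -> C) (Mg : R) (Mg0 : 0 <= Mg) (g_mult : mult g Mg).
Variables (Z : H0 -> KB lam) (Z_op : bounded_op Z)
  (Z_x : forall n, Z (x n) = g (lam n) *: u n).
Local Notation Wa := (adjoint W).
Local Notation R0a := (adjoint R0).
Local Notation Za := (adjoint Z).
Local Notation gst := (gstar g).
Local Notation T := (opT W R0).
Local Notation Y := (opY W).
Local Notation X := (opX g Z).
Implicit Types (f h : H2) (y : H0) (k : KB lam) (v : dsum (BH2 lam) H0).

#[local] Opaque projBH2 projKB orthoproj mulop psum fshift kern adjoint restr unit_kernel.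

Let PK_lin : linear PK := PK_linear nodes.
Let PB_lin : linear PB := PB_linear nodes.
Let K_complete : completeV (KB lam) := @KB_complete R lam.
Let H0_complete : completeV H0 := @hilbert_complete R H0.
Let gst_mult : mult gst Mg := mult_gstar Mg0 g_mult.

Lemma dot_u_Wa n y : dot (u n) (Wa y) = dot (x n) y.
Proof. by rewrite -(adjoint_dot K_complete W_op) W_u. Qed.

Lemma dot_x_R0a n y : dot (x n) (R0a y) = lam n * dot (x n) y.
Proof. by rewrite -(adjoint_dot H0_complete R0_op) R0_x dotZl. Qed.

Lemma dot_x_Za n k : dot (x n) (Za k) = g (lam n) * dot (u n) k.
Proof. by rewrite -(adjoint_dot H0_complete Z_op) Z_x dotZl. Qed.

Let test (k k' : KB lam) : (forall n, dot (u n) k = dot (u n) k') -> k = k'.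
Proof. exact (@KB_test R lam b q nodes k k'). Qed.

Let test0 (y y' : H0) : (forall n, dot (x n) y = dot (x n) y') -> y = y'.
Proof.
move=> h; apply/eqP; rewrite -subr_eq0; apply/eqP; apply: (dot_dense x_dense) => n.
by rewrite dotBr h subrr.
Qed.

(** W* intertwines R0* with the compression of the shift to K_B. Both sides have
    the same inner product with each [u n]. *)
Lemma PK_fshift f y : PK f = Wa y -> PK (fshift f) = Wa (R0a y).
Proof.
move=> fy; apply: test => n; rewrite dot_u_Wa dot_x_R0a -dot_u_Wa -fy.
exact: dot_unit_fshift nodes n f.
Qed.

Lemma gst_node n : (gst (b n)%:C%C)^* = g (lam n).
Proof. rewrite /gstar conjCK conj_re; by case: nodes => ->. Qed.

(** W* Z* is the compression of g_*(S) to K_B. *)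
Lemma PK_mul f : PK (mulop gst f) = Wa (Za (PK f)).
Proof.
apply: test => n; rewrite dot_u_Wa dot_x_Za -gst_node.
exact (@dot_unit_mul R lam b q nodes gst Mg n f gst_mult).
Qed.

(** Z* intertwines the compression of the shift with R0*. *)
Lemma Za_fshift f : Za (PK (fshift f)) = R0a (Za (PK f)).
Proof.
apply: test0 => n; rewrite dot_x_R0a.
have h1 := dot_x_Za n (PK f); have h2 := dot_x_Za n (PK (fshift f)).
have h3 := dot_unit_fshift nodes n f.
apply: (etrans h2); apply: (etrans (congr1 (fun t => g (lam n) * t) h3)).
apply: (etrans _ (esym (congr1 (fun t => lam n * t) h1))).
by rewrite mulrCA.
Qed.

Lemma PB_Y v : PB (Y v) = v.1.
Proof. exact: (proj_of_sum nodes v.1 (Wa v.2)).1. Qed.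

Lemma PK_Y v : PK (Y v) = Wa v.2.
Proof. exact: (proj_of_sum nodes v.1 (Wa v.2)).2. Qed.

(** Collecting the first row of the matrix of T into a single projection reduces
    the powers of T to those of the shift. *)
Lemma T_E v : T v = (PB (fshift (Y v)), R0a v.2).
Proof.
rewrite /opT ushiftE; congr pair.
have -> : restr (@ushift R) v.1 = PB (fshift (val v.1)).
  have h : ushift (val v.1) \in M.
    by rewrite ushiftE; apply: (BH2_fshift nodes); exact: valP.
  by rewrite -ushiftE; exact (@restrE R lam (@ushift R) v.1 h).
rewrite -(linD PB_lin) -(linD (@fshift_linear R)).
by [].
Qed.

Lemma X_E f : X f = (PB (mulop gst f), Za (PK f)).
Proof.
rewrite /opX; congr pair.
have -> : restr (mulop gst) (PB f) = PB (mulop gst (val (PB f))).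
  have h : mulop gst (val (PB f)) \in M.
    by apply: (BH2_mul nodes gst_mult); exact: valP.
  exact (@restrE R lam (mulop gst) (PB f) h).
rewrite -(linD PB_lin) -(linD (mult_linear gst_mult)).
by rewrite -(proj_split nodes f).
Qed.

Lemma YE v : Y v = val v.1 + val (Wa v.2). Proof. by []. Qed.

Lemma Y_of_proj f y : PK f = Wa y -> Y (PB f, y) = f.
Proof.
move=> fy; rewrite YE /= -fy; exact/esym/(proj_split nodes f).
Qed.

Lemma YT v : Y (T v) = fshift (Y v).
Proof. by rewrite T_E Y_of_proj//; apply: PK_fshift; exact: PK_Y. Qed.

Lemma YX f : Y (X f) = mulop gst f.
Proof. by rewrite X_E Y_of_proj//; exact: PK_mul. Qed.

Lemma dsum_ext (p p' : dsum (BH2 lam) H0) : p.1 = p'.1 -> p.2 = p'.2 -> p = p'.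
Proof. by case: p p' => [a c] [a' c'] /= -> ->. Qed.

Lemma XS f : X (fshift f) = T (X f).
Proof.
apply: (etrans (X_E (fshift f))); apply: (etrans _ (esym (T_E (X f)))).
apply: dsum_ext; last first.
  apply: (etrans (Za_fshift f)); exact: (congr1 R0a (esym (congr1 snd (X_E f)))).
rewrite [LHS]/= [RHS]/= (YX f); apply: congr1.
have n1 z : rn z < 1 -> psum (mulop gst f) z = gst z * psum f z.
  exact: (mult_mulop f gst_mult).2.
apply: mulopE => z z1.
by rewrite (psum_fshift _ z1) (psum_fshift _ z1) n1// mulrCA.
Qed.

Lemma Y_linear : linear Y.
Proof.
move=> a v w; rewrite !YE.
have lW := adjoint_linear K_complete W_op.
have -> : (a *: v + w).2 = a *: v.2 + w.2 by [].
have -> : (a *: v + w).1 = a *: v.1 + w.1 by [].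
rewrite lW.
have -> : val (a *: v.1 + w.1) = a *: val v.1 + val w.1 by [].
have -> : val (a *: Wa v.2 + Wa w.2) = a *: val (Wa v.2) + val (Wa w.2) by [].
by rewrite addrACA -scalerDr.
Qed.

Lemma T_linear : linear T.
Proof.
move=> a v w; rewrite !T_E Y_linear (@fshift_linear R) PB_lin; apply: dsum_ext => //=.
exact: (adjoint_linear H0_complete R0_op).
Qed.

Lemma X_linear : linear X.
Proof.
move=> a f h; rewrite (X_E f) (X_E h) X_E; apply: dsum_ext => /=.
  by rewrite (mult_linear gst_mult) PB_lin.
by rewrite PK_lin (adjoint_linear H0_complete Z_op).
Qed.

Lemma iter_T n v : iter n T v = (PB (iter n (@fshift R) (Y v)), iter n R0a v.2).
Proof.
suff [h1 h2] : Y (iter n T v) = iter n (@fshift R) (Y v) /\ (iter n T v).2 = iter n R0a v.2.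
  by apply: dsum_ext => //=; rewrite -h1 PB_Y.
by elim: n => [//|n [IH1 IH2]]; rewrite !iterS YT IH1 T_E /= IH2.
Qed.

Lemma dot_x_iter n m y : dot (x n) (iter m R0a y) = lam n ^+ m * dot (x n) y.
Proof.
elim: m => [|m IH]; first by rewrite mul1r.
by rewrite iterS dot_x_R0a IH mulrA -exprS.
Qed.

Lemma dot_comb_series N m (a c : nat -> C) y :
  dot (comb x N a) (\sum_(i < m) c i *: iter i R0a y) =
  dot (comb x N (fun j => (\sum_(i < m) (c i)^* * (b j)%:C%C ^+ i) * a j)) y.
Proof.
rewrite /comb !dot_suml; apply: eq_bigr => j _.
rewrite [RHS]dotZl dotZl -mulrA mulrCA; congr (_ * _).
rewrite dotC (dot_suml _ _ (fun i : 'I_m => c i *: iter i R0a y)) rmorph_sum /=.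
rewrite mulr_suml; apply: eq_bigr => i _.
rewrite dotZl rmorphM /= -dotC dot_x_iter mulrA; congr (_ * _ * _).
by case: nodes => ->.
Qed.


(** * Boundedness of the powers of T *)
Variables (MW : R) (MW0 : 0 <= MW) (W_le : forall k, rn (W k) <= MW * rn k).
Variables (P : nat -> H0 -> H0) (Mp : R) (Mp0 : 0 <= Mp)
  (P_op : forall n, bounded_op (P n)) (P_le : forall n y, rn (P n y) <= Mp * rn y)
  (P_comb : forall n N (a : nat -> C), (n < N)%N -> P n (comb x N a) = comb x n.+1 a).

Lemma partial_le n N (a : nat -> C) : (n <= N)%N ->
  rn (comb x n a) <= Mp * rn (comb x N a).
Proof.
case: n => [_|n nN]; first by rewrite /comb big_ord0 rn0 mulr_ge0 ?rn_ge0.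
by rewrite -(P_comb a nN).
Qed.

Lemma dot_comb_iter N m (a : nat -> C) y :
  dot (comb x N a) (iter m R0a y) = dot (comb x N (fun j => (b j ^+ m)%:C%C * a j)) y.
Proof.
rewrite /comb !dot_suml; apply: eq_bigr => j _.
rewrite [RHS]dotZl dotZl dot_x_iter mulrCA mulrA rmorphXn /=.
by case: nodes => ->.
Qed.

(** On finite combinations of the [x n], R0^m multiplies the coefficients by the
    increasing sequence b n ^ m; Abel summation bounds it uniformly in m, and
    the bound passes to the adjoint by duality. *)
Lemma rn_iter_R0a m y : rn (iter m R0a y) <= 2 * Mp * rn y.
Proof.
have [b01 b_incr] : (forall n, 0 < b n < 1) /\ (forall n, b n < b n.+1) by case: nodes.
apply: (dual_dense x_dense) => [|N a]; first by rewrite !mulr_ge0 ?rn_ge0.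
rewrite dot_comb_iter (le_trans (dot_CS _ _))// mulrAC ler_wpM2r ?rn_ge0//.
apply: abel_bound => // [n|n|n|n].
- exact: partial_le.
- by rewrite exprn_ge0//; case/andP: (b01 n) => /ltW.
- have /andP[/ltW h1 _] := b01 n; have /andP[/ltW h2 _] := b01 n.+1.
  by apply: lerXn2r; rewrite ?nnegrE//; exact: ltW.
- by rewrite exprn_ile1//; case/andP: (b01 n) => /ltW ? /ltW.
Qed.

Lemma rn_Wa y : rn (Wa y) <= MW * rn y.
Proof. exact: (rn_adjoint K_complete W_op MW0 W_le). Qed.

Lemma rn_Y v : rn (Y v) <= (1 + MW) * rn v.
Proof.
have h0 := rnD (val v.1) (val (Wa v.2)).
have h1 : rn (val v.1) <= rn v by exact: (rn_dsum1 v).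
have h2 : rn (val (Wa v.2)) <= MW * rn v.2 by exact: (rn_Wa v.2).
have h3 : MW * rn v.2 <= MW * rn v by rewrite ler_wpM2l//; exact: (rn_dsum2 v).
have e : rn (Y v) <= rn (val v.1) + rn (val (Wa v.2)) by exact: h0.
by rewrite (le_trans e)// mulrDl mul1r; lra.
Qed.

Lemma rn_iter_fshift n f : rn (iter n (@fshift R) f) = rn f.
Proof. by elim: n => [//|n IH]; rewrite iterS rn_fshift. Qed.

Lemma T_power_bounded n v : rn (iter n T v) <= (1 + MW + 2 * Mp) * rn v.
Proof.
rewrite iter_T; apply: (le_trans (rn_dsum_le _)); rewrite /= mulrDl lerD//.
  rewrite (le_trans (rn_PB nodes _))// rn_iter_fshift; exact: rn_Y.
by rewrite (le_trans (rn_iter_R0a _ _))// ler_wpM2l ?mulr_ge0//; exact: rn_dsum2.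
Qed.

Lemma disc_max_le (p : {poly C}) (D : R) :
  (forall z, rn z <= 1 -> rn p.[z] <= D) -> disc_max p <= D.
Proof.
move=> h; apply: ge_sup; first by exists (rn p.[0]); exists 0 => //=; rewrite normr0.
by move=> _ [z /= z1 <-]; apply: h; rewrite -le1C.
Qed.

Lemma iter_T2 n v : (iter n T v).2 = iter n R0a v.2.
Proof. by rewrite iter_T. Qed.

Lemma series_snd m (c : nat -> C) (F : nat -> dsum (BH2 lam) H0) :
  (\sum_(i < m) c i *: F i).2 = \sum_(i < m) c i *: (F i).2.
Proof. by elim: m => [|m IH]; rewrite ?big_ord0// !big_ord_recr /= -IH. Qed.

Lemma series_fst m (c : nat -> C) (F : nat -> dsum (BH2 lam) H0) :
  (\sum_(i < m) c i *: F i).1 = \sum_(i < m) c i *: (F i).1.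
Proof. by elim: m => [|m IH]; rewrite ?big_ord0// !big_ord_recr /= -IH. Qed.

(** On {0} x H0 the second component of p(T) is the value of p at the adjoint of
    R0, and the adjoint of that operator multiplies the n-th coefficient by the
    conjugate of p(b n). *)
Lemma poly_multiplier (K D : R) (p : {poly C}) : 0 <= K -> 0 <= D ->
  (forall v, rn (\sum_(i < size p) p`_i *: iter i T v) <= K * disc_max p * rn v) ->
  (forall z, rn z <= 1 -> rn p.[z] <= D) ->
  forall N (a : nat -> C),
    rn (comb x N (fun j => p.[(b j)%:C%C]^* * a j)) <= K * D * rn (comb x N a).
Proof.
move=> K0 D0 hT pD N a; apply: rn_dual => [|y]; first by rewrite !mulr_ge0 ?rn_ge0.
pose v0 : dsum (BH2 lam) H0 := (0, y).
have v0E : rn v0 <= rn y by rewrite (le_trans (rn_dsum_le _))//= rn0 add0r.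
have hy : rn (\sum_(i < size p) p`_i *: iter i R0a y) <= K * D * rn y.
  have -> : \sum_(i < size p) p`_i *: iter i R0a y
      = (\sum_(i < size p) p`_i *: iter i T v0).2.
    by rewrite series_snd; apply: eq_bigr => i _; rewrite iter_T2.
  rewrite (le_trans (rn_dsum2 _))// (le_trans (hT v0))//.
  have h1 : K * disc_max p <= K * D by rewrite ler_wpM2l// disc_max_le.
  rewrite (@le_trans _ _ (K * D * rn v0))//; first by rewrite ler_wpM2r ?rn_ge0.
  by rewrite ler_wpM2l// mulr_ge0.
have -> : dot (comb x N (fun j => p.[(b j)%:C%C]^* * a j)) y
    = dot (comb x N a) (\sum_(i < size p) p`_i *: iter i R0a y).
  rewrite (dot_comb_series N (size p) a (fun i => p`_i)); congr (dot _ y).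
  apply: comb_eq => j _; congr (_ * _); rewrite horner_coef rmorph_sum.
  by apply: eq_bigr => i _; rewrite rmorphM rmorphXn /= conj_re.
rewrite (le_trans (dot_CS _ _))// mulrC mulrAC ler_wpM2r ?rn_ge0//.
Qed.

(** Polynomials of bounded supremum interpolate arbitrary signs at finitely many
    nodes, up to a small error, so polynomial boundedness would make all changes
    of signs uniformly bounded on the combinations of the [x n]. *)
Lemma not_polynomially_bounded (delta m0 : R) : 0 < m0 -> (forall n, m0 <= rn (x n)) ->
  finitely_independent x -> 0 < delta ->
  (forall n N, delta <= rn (bprod b (fun j => j != n) N (b n)%:C%C)) ->
  polynomially_bounded T -> riesz_basis x.
Proof.
move=> m00 x_ge x_indep d0 carl [K K0 hT].
have [_ b01 b_incr q01 [bq _]] := nodes.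
have [Ki Ki0 interp] := interpolation b01 q01 bq d0 carl.
have hT' (p : {poly C}) v :
    rn (\sum_(i < size p) p`_i *: iter i T v) <= K * disc_max p * rn v.
  by have := hT p v; rewrite !rnE -rmorphM lecR.
apply: (@riesz_of_unconditional _ _ x m0 MW (K * (Ki + 1))) => //.
- by apply/closed_spanE.
- by move=> n; rewrite -W_u (le_trans (W_le _))// (rn_unit nodes) mulr1.
- by rewrite mulr_gt0//; lra.
move=> N a eps eps2.
have [n|phi [pa_phi phi_le phiE]] := interp N (fun n => (eps n)%:C%C).
  by rewrite rnr -(ler_pXn2r (n := 2)) ?nnegrE// real_normK ?num_real// eps2 expr1n.
pose p n : {poly C} := sval (cid (pa_phi _ (inv_succ_gt0 R n))).
have pE n z : rn z <= 1 -> rn ((p n).[z] - phi z) <= inv_succ R n.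
  exact: (svalP (cid (pa_phi _ (inv_succ_gt0 R n)))).
have p_lim j : (j < N)%N -> tends (fun n => (p n).[(b j)%:C%C]^*) (eps j)%:C%C.
  move=> jN; rewrite -(conj_re (eps j)); apply: tends_conj; rewrite -phiE//.
  move=> e e0; have [N0 hN] := inv_succ_small e0; exists N0 => n /hN; apply: le_lt_trans.
  by apply: pE; rewrite b_real ?b01//; case/andP: (b01 j) => _ /ltW.
apply: (tends_rn_le (u := fun n => comb x N (fun j => (p n).[(b j)%:C%C]^* * a j))).
  apply: (tends_sum (u := fun j n => ((p n).[(b j)%:C%C]^* * a j) *: x j)
    (l := fun j => ((eps j)%:C%C * a j) *: x j)) => j jN.
  move=> e e0; have [|N0 hN] := p_lim j jN (e / (rn (a j) * rn (x j) + 1)).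
    by rewrite divr_gt0// ltr_wpDl// mulr_ge0 ?rn_ge0.
  exists N0 => n /hN; rewrite ltr_pdivlMr; last by rewrite ltr_wpDl// mulr_ge0 ?rn_ge0.
  rewrite -scalerBl -mulrBl rnZ rnM; move: (rn _) (rn (a j)) (rn (x j)) (rn_ge0 ((p n).[(b j)%:C%C]^* - (eps j)%:C%C)).
  move=> r1 r2 r3; nra.
move=> n; apply: (poly_multiplier (ltW K0)); [by lra|exact: hT'|].
move=> z z1; have h1 := pE n z z1; have h2 := phi_le z z1; have h3 := inv_succ_le1 R n.
by have := rnD ((p n).[z] - phi z) (phi z); rewrite subrK; lra.
Qed.



(** * Injectivity of Z *)
Variable delta : R.
Hypotheses (d0 : 0 < delta)
  (carl : forall n N, delta <= rn (bprod b (fun j => j != n) N (b n)%:C%C)).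
Hypothesis g_neq0 : forall z, rn z < 1 -> g z != 0.

(** The projection to K_B of the Blaschke product that omits the n-th factor; it
    does not vanish at b n by the Carleson condition. *)
Lemma dual_vector n : exists w : KB lam, dot (u n) w != 0 /\
  forall j, j != n -> dot (u j) w = 0.
Proof.
have [_ b01 _ q01 [bq _]] := nodes.
have [h _ hE] := mult_hardy (mult_blim b01 q01 bq (fun j => j != n)).
have r1 j : rn ((b j)%:C%C : C) < 1 by exact: (rn_node nodes).
exists (PK h); split=> [|j jn].
  apply/eqP => E; have E2 := dot_unitPK nodes n h; rewrite E in E2.
  move/esym/eqP: E2; rewrite mulf_eq0 (negPf (ucoef_neq0 nodes n)) conjC_eq0 /=.
  rewrite hE// => /eqP E3.
  have := tends_rn_ge (blim_tends b01 q01 bq (fun j => j != n) (r1 n)) (carl n).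
  by rewrite E3 rn0 leNgt d0.
apply: (etrans (dot_unitPK nodes j h)).
by rewrite hE// (blim_zero b01 q01 bq (P := fun j => j != n))// conjC0 mulr0.
Qed.

Lemma comb_deltaE n j : P n (x j) = if (j <= n)%N then x j else 0.
Proof.
have [jn|nj] := leqP j n.
  have h : x j = comb x n.+2 (fun i => (i == j)%:R).
    by rewrite -(comb1 x j) (comb_widen x (m := n.+2)) ?ltnS ?(leqW jn)//; apply: comb_eq => i _; case: ltnP => //; case: eqP => // -> ; rewrite ltnn.
  rewrite [in LHS]h P_comb// h [in RHS](combS x n.+1) .
  by rewrite (gtn_eqF (jn : (j < n.+1)%N)) scale0r addr0.
rewrite -(comb1 x j) P_comb; last exact: leqW.
rewrite /comb big1// => i _; rewrite (ltn_eqF (leq_trans (ltn_ord i) nj)).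
by rewrite scale0r.
Qed.

Lemma sum_delta (V : lmodType C) n (e : nat -> V) i :
  \sum_(j < n) (j == i :> nat)%:R *: e j = if (i < n)%N then e i else 0.
Proof.
case: ltnP => [lin|nli].
  rewrite (bigD1 (Ordinal lin))//= eqxx scale1r big1 ?addr0// => j ji.
  have ji' : j != i :> nat by exact: ji.
  by rewrite (negPf ji') scale0r.
by rewrite big1// => j _; rewrite (ltn_eqF (leq_trans (ltn_ord j) nli)) scale0r.
Qed.

(** The coefficient functionals are h |-> <Z h, w_j> up to nonzero factors, with
    (w_j) biorthogonal to (u_j), so the partial sum projections factor through
    Z. *)
Lemma P_of_Z n y : Z y = 0 -> P n y = 0.
Proof.
move=> Zy.
pose w j := sval (cid (dual_vector j)).
have w_diag j : dot (u j) (w j) != 0 by exact: (svalP (cid (dual_vector j))).1.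
have w_off i j : i != j -> dot (u i) (w j) = 0 by exact: (svalP (cid (dual_vector j))).2.
have gn j : g (lam j) != 0.
  by case: (nodes) => -> b01 _ _ _; apply: g_neq0; rewrite b_real//; case/andP: (b01 j).
pose Q y' := \sum_(j < n.+1) ((g (lam j) * dot (u j) (w j))^-1 * dot (Z y') (w j)) *: x j.
have lZ := Z_op.1.
have [_ [MZ MZ0 hZ]] := (bounded_opP Z).1 Z_op.
have Q_op : bounded_op Q.
  apply/bounded_opP; split=> [a y1 y2|].
    have L (c : C) j : (c * dot (Z (a *: y1 + y2)) (w j)) *: x j
        = a *: ((c * dot (Z y1) (w j)) *: x j) + (c * dot (Z y2) (w j)) *: x j.
      by rewrite lZ dotDl dotZl scalerA -scalerDl mulrDr mulrCA.
    by rewrite /Q scaler_sumr -big_split; apply: eq_bigr => j _; exact: L.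
  exists (\sum_(j < n.+1) rn (g (lam j) * dot (u j) (w j))^-1 * (MZ * rn (w j)) * rn (x j)).
    by apply: sumr_ge0 => j _; rewrite !mulr_ge0 ?rn_ge0.
  move=> y1; rewrite /Q (le_trans (rn_sum _ _ _))// mulr_suml; apply: ler_sum => j _.
  rewrite rnZ rnM [leRHS]mulrAC ler_wpM2r ?rn_ge0// -mulrA ler_wpM2l ?rn_ge0//.
  by rewrite (le_trans (dot_CS _ _))// mulrAC ler_wpM2r ?rn_ge0.
suff -> : P n y = Q y.
  by rewrite /Q big1// => j _; rewrite Zy dot0l mulr0 scale0r.
apply: (dense_eq x_dense (P_op n) Q_op) => i; rewrite comb_deltaE /Q Z_x.
have F j : (g (lam j) * dot (u j) (w j))^-1 * dot (g (lam i) *: u i) (w j) = (j == i)%:R.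
  rewrite dotZl; have [->|ji] := eqVneq j i.
    by rewrite mulVf// mulf_neq0.
  have ij : i != j by rewrite eq_sym.
  by rewrite (w_off i j ij) mulr0 mulr0.
have -> : \sum_(j < n.+1) ((g (lam j) * dot (u j) (w j))^-1
      * dot (g (lam i) *: u i) (w j)) *: x j = \sum_(j < n.+1) (j == i :> nat)%:R *: x j.
  by apply: eq_bigr => j _; rewrite F.
by rewrite sum_delta ltnS.
Qed.

(** A vector killed by Z is killed by all the partial sum projections, which
    converge strongly to the identity. *)
Lemma Z_injective y : Z y = 0 -> y = 0.
Proof.
move=> Zy; apply: rn0_eq; apply/eqP; rewrite eq_le rn_ge0 andbT.
apply/ler_addgt0Pl => e e0; rewrite addr0.
have [|N [a ha]] := x_dense y (e := e / (1 + Mp)); first by rewrite divr_gt0// ltr_wpDr.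
pose a' i := if (i < N)%N then a i else 0.
have cE : comb x N a = comb x N.+1 a' by rewrite (comb_widen x a (leqnSn N)).
have PE : P N (comb x N a) = comb x N a.
  by rewrite cE P_comb.
have h1 := rnD (y - comb x N a) (comb x N a); rewrite subrK in h1.
have h2 : rn (comb x N a) <= Mp * rn (y - comb x N a).
  by rewrite -{1}PE rnBC -[P N _]subr0 -(P_of_Z N Zy) -(linB (P_op N).1) P_le.
move: ha; rewrite ltr_pdivlMr; last by rewrite ltr_wpDr.
by rewrite mulrDr mulr1 mulrC => /ltW; apply: le_trans; rewrite (le_trans h1)// lerD2l.
Qed.

Lemma Za_dense y (e : R) : 0 < e -> exists k, rn (y - Za k) < e.
Proof.
move=> e0; pose D : set H0 := [set Za k | k in setT].
have lZ := adjoint_linear H0_complete Z_op.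
have [|a y1 y2 [k1 _ <-] [k2 _ <-]|y1 hy1|_ [k _ <-] hk] := @dense_of_orth _ _ D H0_complete _ _ _ y e e0; last by exists k.
- by exists 0 => //; rewrite (lin0 lZ).
- by exists (a *: k1 + k2) => //; rewrite lZ.
apply: Z_injective; apply: dot_eq0 => k.
by rewrite (adjoint_dot H0_complete Z_op); apply: hy1; exists k.
Qed.


(** * X and Y are quasiaffinities *)
Lemma T_bounded : bounded_op T.
Proof.
apply/bounded_opP; split; first exact: T_linear.
exists (1 + MW + 2 * Mp); first by rewrite !addr_ge0// mulr_ge0.
by move=> v; exact: (T_power_bounded 1 v).
Qed.

Lemma Y_bounded : bounded_op Y.
Proof.
apply/bounded_opP; split; first exact: Y_linear.
by exists (1 + MW); [rewrite addr_ge0|exact: rn_Y].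
Qed.

Lemma X_bounded : bounded_op X.
Proof.
apply/bounded_opP; split; first exact: X_linear.
have [_ [MZ MZ0 hZ]] := (bounded_opP Z).1 Z_op.
exists (Mg + MZ) => [|f]; first exact: addr_ge0.
rewrite X_E; apply: (le_trans (rn_dsum_le _)); rewrite /= mulrDl lerD//.
  by rewrite (le_trans (rn_PB nodes _))//; exact: (mult_mulop f gst_mult).1.
rewrite (le_trans (rn_adjoint H0_complete Z_op MZ0 hZ _))// ler_wpM2l//.
exact: (rn_PK nodes f).
Qed.

Lemma gst_neq0 z : rn z < 1 -> gst z != 0.
Proof. by move=> z1; rewrite /gstar conjC_eq0 g_neq0// rn_conj. Qed.

Lemma X_injective f : X f = 0 -> f = 0.
Proof.
move=> Xf; have h : mulop gst f = 0 by rewrite -YX Xf (lin0 Y_linear).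
apply: psum_inj => z z1; have := (mult_mulop f gst_mult).2 z z1.
rewrite h psum0 ?lt1C// => /esym/eqP; rewrite mulf_eq0 (negPf (gst_neq0 z1)) /=.
by move/eqP.
Qed.

Lemma Y_injective v : Y v = 0 -> v = 0.
Proof.
move=> Yv; have h1 := PB_Y v; have h2 := PK_Y v; rewrite Yv in h1 h2.
apply: dsum_ext; first by rewrite -h1 (lin0 PB_lin).
apply: test0 => n; rewrite dot0r; have h := dot_u_Wa n v.2.
by rewrite -h2 (lin0 PK_lin) dot0r in h.
Qed.

Hypothesis gst_dense : forall f (e : R), 0 < e -> exists h, rn (f - mulop gst h) < e.

Lemma Y_dense : dense (range Y).
Proof.
apply: dense_rangeP => f e /(gst_dense f)[h hh]; exists (mulop gst h) => //.
by exists (X h) => //; exact: YX.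
Qed.

(** The second component is approximated by choosing k in K_B, as Z* has dense
    range; the error in the first one lies in BH^2 and is corrected by adding a
    multiple of B, which does not change the second component. *)
Lemma X_dense : dense (range X).
Proof.
apply: dense_rangeP => v e e0; have e2 : 0 < e / 2 by rewrite divr_gt0.
have [_ b01 _ q01 [bq BE]] := nodes.
have [k hk] := Za_dense v.2 e2.
have mB : mult (blim b xpredT) 1 := mult_blim b01 q01 bq xpredT.
pose p0 : BH2 lam := v.1 - PB (mulop gst (val k)).
have /asboolP[h0 h0E] : val p0 \in M := valP p0.
have p0E : val p0 = mulop (blim b xpredT) h0.
  by apply/esym; apply: mulopE => z z1; rewrite h0E ?lt1C// BE.
have [f1 hf1] := gst_dense h0 e2.
have BM h : mulop (blim b xpredT) h \in M.
  by apply/asboolP; exists h => z; rewrite lt1C => z1; rewrite (mult_mulop h mB).2// BE.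
pose fB := mulop (blim b xpredT) f1.
exists (X (val k + fB)); first by exists (val k + fB).
have PBid h : h \in M -> exists2 p : BH2 lam, val p = h & PB h = p.
  move=> hM; exists (Sub h hM : BH2 lam); first exact: SubK.
  by have := PB_id (Sub h hM : BH2 lam); rewrite SubK.
have KfB : PK (val k + fB) = k.
  have [p pE _] := PBid _ (BM f1).
  by rewrite addrC /fB -pE; exact: (proj_of_sum nodes p k).2.
have comm : mulop gst fB = mulop (blim b xpredT) (mulop gst f1).
  exact: mulop_comm gst_mult mB.
have p0d : p0 - PB (mulop gst fB) = PB (mulop (blim b xpredT) (h0 - mulop gst f1)).
  rewrite comm (linB (mult_linear mB)) (linB PB_lin) -p0E PB_id.
  by [].
have h1 : rn (p0 - PB (mulop gst fB)) < e / 2.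
  rewrite p0d (le_lt_trans (rn_PB nodes _))//; apply: le_lt_trans hf1.
  by have := (mult_mulop (h0 - mulop gst f1) mB).1; rewrite mul1r.
have -> : v - X (val k + fB) = (p0 - PB (mulop gst fB), v.2 - Za k).
  apply: dsum_ext.
    have e1 : (X (val k + fB)).1 = PB (mulop gst (val k + fB)).
      exact: (congr1 fst (X_E (val k + fB))).
    apply: (etrans (congr1 (fun t => v.1 - t) e1)).
    rewrite (linD (mult_linear gst_mult)) (linD PB_lin) opprD addrA.
    by [].
  have e2' : (X (val k + fB)).2 = Za (PK (val k + fB)).
    exact: (congr1 snd (X_E (val k + fB))).
  apply: (etrans (congr1 (fun t => v.2 - t) e2')).
  by rewrite KfB.
apply: (le_lt_trans (rn_dsum_le _)); rewrite [e]splitr; exact: ltrD h1 hk.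
Qed.


(** * Functional calculus *)
Lemma sum_ord_tail (V : zmodType) n m (F : nat -> V) :
  \sum_(i < n + m) F i - \sum_(i < n) F i = \sum_(i < m) F (n + i)%N.
Proof. by rewrite big_split_ord [X in X - _]addrC addrK. Qed.

Lemma summable_tail (c : nat -> C) : cvgn (series (fun n => `|c n| : C)) ->
  forall e : R, 0 < e -> exists N, forall n m, (N <= n)%N ->
    \sum_(i < m) rn (c (n + i)%N) <= e.
Proof.
move=> /cvg_ex[l /tendsC hl] e e0.
have [N hN] := tends_cauchy hl e0.
exists N => n m Nn; have := hN (n + m)%N n (leq_trans Nn (leq_addr _ _)) Nn.
rewrite (sum_ord_tail n m (fun i => `|c i|)) => /ltW.
have -> : \sum_(i < m) `|c (n + i)%N| = (\sum_(i < m) rn (c (n + i)%N))%:C%C.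
  by rewrite rmorph_sum; apply: eq_bigr => i _; exact: rnE.
by rewrite rnr ger0_norm// sumr_ge0// => i _; exact: rn_ge0.
Qed.

Lemma gst_taylor (c : nat -> C) z : taylor_coefs g c -> rn z < 1 ->
  tends (fun m => \sum_(i < m) (c i)^* * z ^+ i) (gst z).
Proof.
move=> gc z1; have z1' : `|z^*| < 1 by rewrite lt1C rn_conj.
have := tends_conj (tendsC (gc _ z1')); apply: tends_ext => m.
by rewrite rmorph_sum; apply: eq_bigr => i _; rewrite rmorphM rmorphXn /= conjCK.
Qed.

Lemma psum_series m (c : nat -> C) (F : nat -> H2) z : rn z < 1 ->
  psum (\sum_(i < m) c i *: F i) z = \sum_(i < m) c i * psum (F i) z.
Proof.
move=> z1; elim: m => [|m IH]; first by rewrite !big_ord0 psum0// lt1C.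
have -> : \sum_(i < m.+1) c i *: F i = \sum_(i < m) c i *: F i + c m *: F m.
  exact: big_ord_recr.
by rewrite (psumD _ _ z1) (psumZ _ _ z1) IH [RHS]big_ord_recr.
Qed.

Lemma psum_iter_fshift n f z : rn z < 1 -> psum (iter n (@fshift R) f) z = z ^+ n * psum f z.
Proof.
move=> z1; elim: n => [|n IH]; first by rewrite mul1r.
by rewrite iterS (psum_fshift _ z1) IH mulrA -exprS.
Qed.

Lemma rn_series (V : normedModType C) m (c : nat -> C) (F : nat -> V) (D : R) :
  (forall i, rn (F i) <= D) -> 
  rn (\sum_(i < m) c i *: F i) <= (\sum_(i < m) rn (c i)) * D.
Proof.
move=> hF; rewrite (le_trans (rn_sum _ _ _))// mulr_suml; apply: ler_sum => i _.
by rewrite rnZ ler_wpM2l ?rn_ge0.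
Qed.

(** The remainder is the pointwise limit of sums sum_(n <= i < n + m), whose
    norms are at most the sum of the moduli of the coefficients. *)
Lemma shift_series_tail (c : nat -> C) n (e : R) f : taylor_coefs g c -> 0 <= e ->
  (forall m, \sum_(i < m) rn (c (n + i)%N) <= e) ->
  rn (mulop gst f - \sum_(i < n) (c i)^* *: iter i (@fshift R) f) <= e * rn f.
Proof.
move=> gc e0 tail.
have [||F hF FE] := @hardy_limit R
    (fun m => \sum_(i < m) (c (n + i)%N)^* *: iter (n + i) (@fshift R) f)
    (fun z => (gst z - \sum_(i < n) (c i)^* * z ^+ i) * psum f z) (e * rn f).
- move=> m; apply: (le_trans (@rn_series _ m (fun i => (c (n + i)%N)^*)
    (fun i => iter (n + i) (@fshift R) f) (rn f) _)).
    by move=> i; rewrite rn_iter_fshift.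
  rewrite ler_wpM2r ?rn_ge0//; apply: le_trans (tail m).
  by apply: ler_sum => i _; rewrite rn_conj.
- move=> z z1.
  have h := tendsB (gst_taylor gc z1) (tends_cst (\sum_(i < n) (c i)^* * z ^+ i)).
  have h1 : tends (fun m => \sum_(i < n + m) (c i)^* * z ^+ i - \sum_(i < n) (c i)^* * z ^+ i)
      (gst z - \sum_(i < n) (c i)^* * z ^+ i).
    by move=> d /h[N hN]; exists N => m Nm; apply: hN; rewrite (leq_trans Nm)// leq_addl.
  have := tendsM h1 (tends_cst (psum f z)); apply: tends_ext => m.
  rewrite (sum_ord_tail n m (fun i => (c i)^* * z ^+ i)).
  rewrite (@psum_series m (fun i => (c (n + i)%N)^*) (fun i => iter (n + i) (@fshift R) f) z z1).
  by rewrite mulr_suml; apply: eq_bigr => i _; rewrite psum_iter_fshift// mulrA.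
suff -> : mulop gst f - \sum_(i < n) (c i)^* *: iter i (@fshift R) f = F by [].
apply: psum_inj => z z1; rewrite FE// psumB// ((mult_mulop f gst_mult).2 z z1).
rewrite (@psum_series n (fun i => (c i)^*) (fun i => iter i (@fshift R) f) z z1).
rewrite mulrBl; congr (_ - _); rewrite mulr_suml; apply: eq_bigr => i _.
by rewrite psum_iter_fshift// mulrA.
Qed.

(** Tested on a combination of the [x n], the operators become scalars, for
    which the series of g converges at the nodes; the remainder is again a limit
    of bounded sums. *)
Lemma basis_series_tail (c : nat -> C) n (e : R) y : taylor_coefs g c -> 0 <= e ->
  (forall m, \sum_(i < m) rn (c (n + i)%N) <= e) ->
  rn (Za (Wa y) - \sum_(i < n) (c i)^* *: iter i R0a y) <= e * (2 * Mp) * rn y.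
Proof.
move=> gc e0 tail.
apply: (dual_dense x_dense) => [|N a]; first by rewrite !mulr_ge0 ?rn_ge0.
pose D m := \sum_(i < m) (c (n + i)%N)^* *: iter (n + i) R0a y.
have D_le m : rn (D m) <= e * (2 * Mp) * rn y.
  apply: (le_trans (@rn_series _ m (fun i => (c (n + i)%N)^*)
    (fun i => iter (n + i) R0a y) (2 * Mp * rn y) _)).
    by move=> i; exact: rn_iter_R0a.
  rewrite -(mulrA e) ler_wpM2r ?mulr_ge0 ?rn_ge0//; apply: le_trans (tail m).
  by apply: ler_sum => i _; rewrite rn_conj.
have D_lim : tends (fun m => dot (comb x N a) (D m))
    (dot (comb x N a) (Za (Wa y) - \sum_(i < n) (c i)^* *: iter i R0a y)).
  have S m : dot (comb x N a) (\sum_(i < m) (c i)^* *: iter i R0a y)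
      = \sum_(j < N) a j * (dot (x j) y * \sum_(i < m) c i * lam j ^+ i).
    rewrite (dot_comb_series N m a (fun i => (c i)^*)) /comb dot_suml.
    apply: eq_bigr => j _.
    have -> : \sum_(i < m) c i * lam j ^+ i = \sum_(i < m) (c i)^*^* * (b j)%:C%C ^+ i.
      by apply: eq_bigr => i _; rewrite conjCK; case: nodes => ->.
    by rewrite dotZl; move: (\sum_(_ < _) _) => s; rewrite (mulrC s) -mulrA (mulrC s).
  have L : dot (comb x N a) (Za (Wa y)) = \sum_(j < N) a j * (dot (x j) y * g (lam j)).
    rewrite /comb dot_suml; apply: eq_bigr => j _; rewrite dotZl dot_x_Za dot_u_Wa.
    by rewrite (mulrC (g _)).
  have lim : tends (fun m => dot (comb x N a) (\sum_(i < m) (c i)^* *: iter i R0a y))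
      (dot (comb x N a) (Za (Wa y))).
    rewrite L; apply: tends_ext (fun m => esym (S m)) _.
    apply: (tends_sum (u := fun j m => a j * (dot (x j) y * \sum_(i < m) c i * lam j ^+ i))
      (l := fun j => a j * (dot (x j) y * g (lam j)))) => j _.
    do 2 apply: tendsMl.
    have lam1 : `|lam j| < 1.
      by rewrite lt1C; case: nodes => -> b01 _ _ _; rewrite b_real//; case/andP: (b01 j).
    exact: (tendsC (gc _ lam1)).
  have h := tendsB lim (tends_cst (dot (comb x N a) (\sum_(i < n) (c i)^* *: iter i R0a y))).
  rewrite dotBr => d /h[N0 hN]; exists N0 => m Nm.
  have := hN (n + m)%N (leq_trans Nm (leq_addl _ _)).
  have E : dot (comb x N a) (D m) = dot (comb x N a) (\sum_(i < n + m) (c i)^* *: iter i R0a y)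
      - dot (comb x N a) (\sum_(i < n) (c i)^* *: iter i R0a y).
    by rewrite /D -(sum_ord_tail n m (fun i => (c i)^* *: iter i R0a y)) dotBr.
  by rewrite E.
apply: (tends_rn_le D_lim) => m; rewrite (le_trans (dot_CS _ _))// mulrC.
by rewrite ler_wpM2r ?rn_ge0.
Qed.

Lemma XY_functional_calculus (c : nat -> C) : taylor_coefs g c ->
  cvgn (series (fun n => `|c n| : C)) ->
  op_series_cvg (fun n => (c n)^*) T (fun v => X (Y v)).
Proof.
move=> gc cc e0' /gt0C[e e0 ->].
pose K := 1 + MW + 2 * Mp.
have K0 : 0 < K by rewrite /K -addrA ltr_wpDr ?addr_ge0 ?mulr_ge0.
have [|N hN] := summable_tail cc (e := e / K); first by rewrite divr_gt0.
have d0' : 0 <= e / K by rewrite divr_ge0// ltW.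
exists N => // n /= Nn v; have tail m := hN n m Nn.
rewrite !rnE -rmorphM lecR; apply: (le_trans (rn_dsum_le _)).
have -> : e * rn v = e / K * ((1 + MW) * rn v) + e / K * (2 * Mp) * rn v.
  by rewrite -(mulrA (e / K) (2 * Mp)) -mulrDr -mulrDl -/K mulrA divfK// gt_eqF.
apply: lerD.
  have -> : (X (Y v) - \sum_(k < n) (c k)^* *: iter k T v).1
      = PB (mulop gst (Y v) - \sum_(i < n) (c i)^* *: iter i (@fshift R) (Y v)).
    have e1 : (X (Y v) - \sum_(k < n) (c k)^* *: iter k T v).1
      = (X (Y v)).1 - (\sum_(k < n) (c k)^* *: iter k T v).1 by [].
    apply: (etrans e1); rewrite (linB PB_lin) (lin_sum PB_lin).
    have e3 := series_fst n (fun i => (c i)^* ) (fun i => iter i T v).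
    apply: (etrans (congr1 (fun t => (X (Y v)).1 - t) e3)).
    have e2 : (X (Y v)).1 = PB (mulop gst (Y v)) := congr1 fst (X_E (Y v)).
    rewrite e2; congr (_ - _); apply: eq_bigr => i _.
    by rewrite (linZ PB_lin) iter_T.
  rewrite (le_trans (rn_PB nodes _))// (le_trans (shift_series_tail (Y v) gc d0' tail))//.
  by rewrite ler_wpM2l// rn_Y.
have -> : (X (Y v) - \sum_(k < n) (c k)^* *: iter k T v).2
    = Za (Wa v.2) - \sum_(i < n) (c i)^* *: iter i R0a v.2.
  have e1 : (X (Y v) - \sum_(k < n) (c k)^* *: iter k T v).2
    = (X (Y v)).2 - (\sum_(k < n) (c k)^* *: iter k T v).2 by [].
  have e3 := series_snd n (fun i => (c i)^* ) (fun i => iter i T v).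
  apply: (etrans e1); apply: (etrans (congr1 (fun t => (X (Y v)).2 - t) e3)).
  have e2 : (X (Y v)).2 = Za (PK (Y v)) := congr1 snd (X_E (Y v)).
  rewrite e2 PK_Y; congr (_ - _); apply: eq_bigr => i _.
  by rewrite iter_T.
rewrite (le_trans (basis_series_tail v.2 gc d0' tail))//.
apply: ler_wpM2l; last exact: (rn_dsum2 v).
by rewrite mulr_ge0// mulr_ge0.
Qed.

(** * The adjoint of Y on the reproducing kernels *)
Lemma adjoint_Y f : adjoint Y f = (PB f, W (PK f)).
Proof.
apply: adjoint_uniq => v.
have e1 : dot (Y v) f = dot (val v.1) f + dot (val (Wa v.2)) f by exact: dotDl.
have e2 : dot (val v.1) f = dot v.1 (PB f).
  by rewrite dotC -(dot_PB nodes f v.1) -dotC.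
have e3 : dot (val (Wa v.2)) f = dot v.2 (W (PK f)).
  have h := dot_PK nodes f (Wa v.2).
  rewrite -h dotC -(adjoint_dot K_complete W_op); exact/esym/dotC.
by apply: (etrans e1); rewrite e2 e3.
Qed.

Lemma adjoint_Y_le f : rn (adjoint Y f) <= (1 + MW) * rn f.
Proof.
rewrite adjoint_Y (le_trans (rn_dsum_le _))//= mulrDl mul1r lerD ?(rn_PB nodes)//.
by rewrite (le_trans (W_le _))// ler_wpM2l// (rn_PK nodes).
Qed.

(** B h_l belongs to BH^2, and <B h_l, h_l> = B(l) |h_l|^2. *)
Lemma rn_PB_kern (eta : R) l : rn l < 1 -> eta <= rn (blim b xpredT l) ->
  eta * rn (kern l) <= rn (PB (kern l)).
Proof.
have [_ b01 _ q01 [bq BE]] := nodes; move=> l1 hl.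
have mB : mult (blim b xpredT) 1 := mult_blim b01 q01 bq xpredT.
have [h1 h2] := mult_mulop (kern l) mB; rewrite mul1r in h1.
have hM : mulop (blim b xpredT) (kern l) \in M.
  by apply/asboolP; exists (kern l) => z; rewrite lt1C => z1; rewrite h2// BE.
have k0 := kern_gt0 l1.
rewrite -(ler_pM2r k0) -mulrA -expr2.
have e : dot (kern l) (mulop (blim b xpredT) (kern l))
    = (blim b xpredT l * (rn (kern l) ^+ 2)%:C%C)^*.
  by rewrite dotC -(psum_dot _ l1) h2// (psum_dot _ l1) dotxx.
pose p : BH2 lam := Sub (mulop (blim b xpredT) (kern l)) hM.
have h3 := dot_PB nodes (kern l) p.
rewrite SubK e in h3.
have rp : rn p <= rn (kern l) by rewrite rn_sub SubK.
have := dot_CS (PB (kern l)) p.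
rewrite h3 rn_conj rnM rnr ger0_norm ?sqr_ge0// => h4.
apply: le_trans (le_trans h4 _); first by rewrite ler_wpM2r ?sqr_ge0.
by rewrite ler_wpM2l ?rn_ge0.
Qed.

(** The distance from h_l to the line of [u n] is rho |h_l|, with rho the
    pseudohyperbolic distance from l to b n. If rho is small, the image of h_l
    under W is therefore dominated by that of its component along [u n], a
    multiple of [x n]. *)
Lemma rn_W_kern (m0 : R) n l : rn l < 1 -> m0 <= rn (x n) ->
  rn (bfactor (b n) l) <= 2^-1 -> 0 < m0 -> MW * rn (bfactor (b n) l) <= m0 / 4 ->
  m0 / 4 * rn (kern l) <= rn (W (PK (kern l))).
Proof.
have arith (r1 r2 r3 r4 r5 : R) : r1 <= m0 / 4 * r5 -> r4 * m0 <= r3 -> r3 - r1 <= r2 ->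
  r5 / 2 * m0 <= r4 * m0 -> m0 / 4 * r5 <= r2 by lra.
have [_ b01 _ q01 [bq BE]] := nodes; move=> l1 x_ge rho_half m00 rho_le.
pose c := dot (kern l) (val (u n)).
have u1 : rn (val (u n)) = 1 by rewrite -rn_sub; exact: (rn_unit nodes n).
have c2 : rn c ^+ 2 = (1 - rn (bfactor (b n) l) ^+ 2) * rn (kern l) ^+ 2.
  rewrite (bfactor_defect (b01 n) (ltW l1)) (rn_kern l1) /c dotC rn_conj.
  rewrite (dot_unit nodes) rnM rn_conj exprMn (rn_ucoef nodes).
  rewrite psum_kern ?(rn_node nodes)// rnM rn1 mul1r rnV exprVn.
  have -> : rn (1 - l^* * (b n)%:C%C) = rn (1 - (b n)%:C%C * l).
    rewrite -[LHS]rn_conj; congr rn; rewrite rmorphB rmorph1 rmorphM /= conj_re mulrC.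
    by congr (1 - _ * _); exact: conjCK.
  rewrite mulrAC mulfK// subr_eq0 eq_sym lt_eqF// expr_lt1// rn_ge0.
  by [].
have k0 := kern_gt0 l1.
have c_ge : rn (kern l) / 2 <= rn c.
  rewrite -(ler_pXn2r (n := 2)) ?nnegrE ?rn_ge0 ?divr_ge0 ?rn_ge0// c2.
  rewrite exprMn mulrC ler_wpM2r ?sqr_ge0//; have := rn_ge0 (bfactor (b n) l); nra.
pose F := kern l - c *: val (u n).
have F2 : rn F = rn (bfactor (b n) l) * rn (kern l).
  apply/eqP; rewrite -(eqrXn2 (n := 2)) ?mulr_ge0 ?rn_ge0//; apply/eqP.
  rewrite /F rnB_sq rnZ u1 mulr1 dotZr -/c [c^* * c]mulrC mul_conj /= c2 exprMn.
  by ring.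
have WE : W (PK (kern l)) = c *: x n + W (PK F).
  have lW := W_op.1.
  have e1 : PK (val (u n)) = u n.
    by have := (proj_of_sum nodes 0 (u n)).2; rewrite add0r.
  rewrite -W_u -{1}e1 -(linZ lW) -(linZ PK_lin) -(linD lW) -(linD PK_lin).
  by rewrite /F addrC subrK.
have h1 : rn (W (PK F)) <= m0 / 4 * rn (kern l).
  rewrite (le_trans (W_le _))//.
  rewrite (le_trans (ler_wpM2l MW0 (rn_PK nodes F)))// F2 mulrA.
  by rewrite ler_wpM2r ?rn_ge0.
have h2 : rn c * m0 <= rn (c *: x n) by rewrite rnZ ler_wpM2l ?rn_ge0.
have h3 := rn_subl (c *: x n) (- W (PK F)); rewrite opprK rnN -WE in h3.
have h4 : rn (kern l) / 2 * m0 <= rn c * m0 by rewrite ler_wpM2r// ltW.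
exact: arith h1 h2 h3 h4.
Qed.

(** Either l is close to a node in the pseudohyperbolic metric, and the second
    component of the adjoint is large, or B(l) is bounded below, and the first
    one is. *)
Lemma adjoint_Y_ge (m0 : R) : 0 < m0 -> (forall n, m0 <= rn (x n)) ->
  exists2 e : R, 0 < e & forall l, rn l < 1 -> e * rn (kern l) <= rn (adjoint Y (kern l)).
Proof.
move=> m00 x_ge; have [_ b01 _ q01 [bq BE]] := nodes.
(* rho <= 1/2 keeps the component of h_l along [u n] at least |h_l| / 2, and rho
   MW <= m0 / 4 makes the remaining part small under W. *)
pose rho := Num.min 2^-1 (m0 / 4 / (MW + 1)).
have MW1 : 0 < MW + 1 by rewrite ltr_wpDl.
have m4 : 0 < m0 / 4 by rewrite divr_gt0.
have rho0 : 0 < rho by rewrite lt_min invr_gt0 ltr0n divr_gt0.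
have [eta eta0 heta] := blim_lower b01 q01 bq rho0.
exists (Num.min eta (m0 / 4)); first by rewrite lt_min eta0.
move=> l l1; rewrite adjoint_Y; have k0 := ltW (kern_gt0 l1).
have [[n hn]|hn] := pselect (exists n, rn (bfactor (b n) l) < rho).
  apply: le_trans (rn_dsum2 _); rewrite /=.
  apply: (le_trans _ (@rn_W_kern m0 n l l1 (x_ge n) _ m00 _)).
  - by rewrite ler_wpM2r// ge_min lexx orbT.
  - by rewrite (le_trans (ltW hn))// ge_min lexx.
  have h1 : rn (bfactor (b n) l) <= m0 / 4 / (MW + 1).
    by rewrite (le_trans (ltW hn))// ge_min lexx orbT.
  move: h1; rewrite ler_pdivlMr// => h1; have := rn_ge0 (bfactor (b n) l).
  by move: (rn _) h1 => r; nra.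
apply: le_trans (rn_dsum1 _); rewrite /=.
apply: (le_trans _ (@rn_PB_kern eta l l1 _)).
  by rewrite ler_wpM2r// ge_min lexx.
apply: heta => // n; rewrite leNgt; apply/negP => h; apply: hn; by exists n.
Qed.

End Transfer.

(** * Bounded and outer functions *)
Section Final.
Variable R : realType.
Local Notation C := R[i].

Lemma szego_norm (l : C) : `|l| < 1 -> `|szego l| = (sqrtC (1 - `|l| ^+ 2))^-1.
Proof.
rewrite lt1C => l1; rewrite szegoE//.
have d0 : 0 <= 1 - rn l ^+ 2 by rewrite subr_ge0 exprn_ile1 ?rn_ge0 ?ltW.
have dE : 1 - `|l| ^+ 2 = (1 - rn l ^+ 2)%:C%C :> C by rewrite rnE rmorphB rmorphXn.
have s0 : 0 <= (1 - `|l| ^+ 2 : C) by rewrite dE lecR.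
apply/eqP; rewrite -(eqrXn2 (n := 2)) ?invr_ge0 ?sqrtC_ge0 ?normr_ge0//.
have -> : `|kern l| = (rn (kern l))%:C%C by exact: rnE.
by rewrite exprVn sqrtCK dE -rmorphXn rn_kern// fmorphV.
Qed.

Lemma hinf_mult (g : C -> C) : hardy_infty g -> exists2 Mg : R, 0 <= Mg & mult g Mg.
Proof.
move=> [[c gc] [M gM]].
have M0 : 0 <= M by rewrite (le_trans _ (gM 0 _)) ?normr0.
have gM' z : rn z < 1 -> rn (g z) <= Re M.
  by rewrite -lt1C => /gM; rewrite rnE -{1}(ReK M0) lecR.
have [h _ hE] := hinf_hardy gc gM'.
exists (Re M); first by rewrite (le_trans _ (gM' 0 _)) ?rn_ge0// rn0.
exact: (psum_mult hE gM').
Qed.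

(** An exponential has no zeros. *)
Lemma outer_neq0 (g : C -> C) z : outer g -> rn z < 1 -> g z != 0.
Proof.
move=> [c [k [c1 _ gE]]] z1; rewrite gE ?lt1C// mulf_neq0//.
  by rewrite -normr_eq0 c1 oner_neq0.
apply/eqP => E; have := rn_cexp (herglotz k z); rewrite E rn0 => /esym/eqP.
by rewrite gt_eqF ?expR_gt0.
Qed.

End Final.

(* In the order of R[i], 0 < z forces z to be real. *)
Theorem theorem2p9 (R : realType)
  (lam : nat -> R[i])
  (lam01 : forall n, 0 < lam n < 1)
  (lam_incr : forall n, lam n < lam n.+1)
  (lam_carleson : carleson lam)
  (H0 : hilbertType R[i]) (x : nat -> H0)
  (x_indep : finitely_independent x)
  (x_span : closed_span x = setT)
  (x_inf : exists2 c : R[i], 0 < c & forall n, c <= `|x n|)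
  (x_proj : bounded_basis_projections x)
  (W : KB lam -> H0) (W_op : bounded_op W)
  (W_u : forall n, W (unit_kernel lam n) = x n)
  (x_not_riesz : ~ riesz_basis x)
  (g : R[i] -> R[i]) (g_Hinfty : hardy_infty g) (g_outer : outer g)
  (g_lam : cvgn (series (fun n => `|g (lam n)| ^+ 2 : R[i])))
  (R0 : H0 -> H0) (R0_op : bounded_op R0)
  (R0_x : forall n, R0 (x n) = lam n *: x n)
  (Z : H0 -> KB lam) (Z_op : bounded_op Z)
  (Z_x : forall n, Z (x n) = g (lam n) *: unit_kernel lam n) :
  let T := opT W R0 in
  let Y := opY W in
  let X := opX g Z in
  bounded_op T /\ power_bounded T /\ ~ polynomially_bounded T /\
  quasiaffinity X /\ quasiaffinity Y /\
  (forall v, Y (T v) = ushift (Y v)) /\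
  (forall f, X (ushift f) = T (X f)) /\
  (forall f, Y (X f) = mulop (gstar g) f) /\
  (forall ghat : nat -> R[i], taylor_coefs g ghat ->
     cvgn (series (fun n => `|ghat n| : R[i])) ->
     op_series_cvg (fun n => (ghat n)^*) T (fun v => X (Y v))) /\
  (forall l : R[i], `|l| < 1 ->
     `|szego l| = (sqrtC (1 - `|l| ^+ 2))^-1) /\
  (exists c d : R[i], [/\ 0 < c, 0 < d &
     forall l : R[i], `|l| < 1 ->
       c * `|szego l| <= `|adjoint Y (szego l)| <= d * `|szego l|]).
Proof.
move=> T Y X.
have [b [q [delta [[lamE b01 b_incr q01] [bq d0 carl BE]]]]] :=
  carleson_facts lam01 lam_incr lam_carleson.
have nodes : blaschke_nodes lam b q by split.
have x_dense : dense_span x by apply/closed_spanE.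
have [_ /gt0C[m0 m00 ->] x_ge'] := x_inf.
have x_ge n : m0 <= rn (x n) by have := x_ge' n; rewrite rnE lecR.
have [P [Mp [Mp0 P_op P_le P_comb]]] := projection_partial x_proj.
have [_ [MW MW0 W_le]] := (bounded_opP W).1 W_op.
have [Mg Mg0 g_mult] := hinf_mult g_Hinfty.
have g_neq0 z : rn z < 1 -> g z != 0 := @outer_neq0 R g z g_outer.
have gst_dense f (e : R) : 0 < e -> exists h, rn (f - mulop (gstar g) h) < e.
  by move=> e0; exact: (outer_dense Mg0 g_outer g_mult f e0).
have TE := T_power_bounded nodes x_dense W_op W_u R0_op R0_x MW0 W_le Mp0 P_le P_comb.
split; first exact (T_bounded nodes x_dense W_op W_u R0_op R0_x MW0 W_le Mp0 P_le P_comb).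
split.
  by exists (1 + MW + 2 * Mp)%:C%C => n _ v; rewrite !rnE -rmorphM lecR; exact (TE n v).
split.
  move=> pb; apply: x_not_riesz.
  exact (not_polynomially_bounded nodes x_dense W_op W_u R0_op R0_x W_le
    m00 x_ge x_indep d0 carl pb).
split.
  split.
  - exact (X_bounded nodes Mg0 g_mult Z_op).
  - move=> f; exact (@X_injective _ _ _ _ nodes _ _ _ W_op W_u _ _ Mg0 g_mult _ Z_op Z_x g_neq0 f).
  - exact (X_dense nodes x_dense Mg0 g_mult Z_op Z_x Mp0 P_op P_le P_comb d0 carl
      g_neq0 gst_dense).
split.
  split.
  - exact (Y_bounded W_op MW0 W_le).
  - move=> v; exact (@Y_injective _ _ _ _ nodes _ _ x_dense _ W_op W_u v).
  - exact (Y_dense nodes W_op W_u Mg0 g_mult Z_op Z_x gst_dense).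
split; first by move=> v; rewrite ushiftE; exact (YT nodes W_op W_u R0_op R0_x v).
split.
  move=> f; rewrite ushiftE.
  exact (XS nodes x_dense W_op W_u R0_op R0_x Mg0 g_mult Z_op Z_x f).
split; first by move=> f; exact (YX nodes W_op W_u Mg0 g_mult Z_op Z_x f).
split.
  move=> ghat gc cc; exact (XY_functional_calculus nodes x_dense W_op W_u R0_op R0_x
    Mg0 g_mult Z_op Z_x MW0 W_le Mp0 P_le P_comb gc cc).
split; first exact: szego_norm.
have [e e0 he] := adjoint_Y_ge nodes W_op W_u MW0 W_le m00 x_ge.
have MW1 : 0 < 1 + MW by rewrite ltr_pwDl.
exists e%:C%C, (1 + MW)%:C%C; split; rewrite ?ltcR//.
move=> l; rewrite lt1C => l1; rewrite szegoE// !rnE -!rmorphM !lecR.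
apply/andP; split; first exact (he l l1).
exact (adjoint_Y_le nodes W_op MW0 W_le (kern l)).
Qed.
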